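(* Let $\mathcal H$ be a Hilbert space, and let $\mathcal W:\mathcal H\to[0,+\infty]$ be a weakly lower semicontinuous function which has exactly two zeros $e^-$ and $e^+$ ($e^-\neq e^+$), and satisfies $\liminf_{\|v\|\to\infty}\mathcal W(v)>0$. Let $\mathcal A$ and $\mathcal J_{\mathbb R}$ be the class and the functional defined in the context. Then the condition $$\inf_{V\in\mathcal A}\mathcal J_{\mathbb R}(V)<+\infty \qquad (\ast)$$ implies that $\mathcal J_{\mathbb R}$ admits a minimizer $U\in\mathcal A$, i.e. $\mathcal J_{\mathbb R}(U)=\min_{V\in\mathcal A}\mathcal J_{\mathbb R}(V)$, such that (a) $U(t)\rightharpoonup e^{\pm}$ (weakly in $\mathcal H$) as $t\to\pm\infty$; (b) $\frac12\|U'(t)\|^2=\mathcal W(U(t))$ for a.e. $t\in\mathbb R$. Assuming moreover that $\mathcal W\in C^1(\mathcal H;\mathbb R)$, then $(\ast)$ holds, and $U\in C^2(\mathbb R;\mathcal H)$ is a classical solution of $U''(t)=\nabla\mathcal W(U(t))$ for all $t\in\mathbb R$.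
   Context: $\mathcal H$ is a real Hilbert space with inner product $\langle\cdot,\cdot\rangle$ and norm $\|\cdot\|$. Set $\mathbf n:=\frac{e^+-e^-}{\|e^+-e^-\|}$ and $l_0:=\|e^+-e^-\|$. The constrained class $\mathcal A$ is the set of all $V\in H^1_{\rm loc}(\mathbb R;\mathcal H)$ (vector-valued Sobolev space) for which there exist real numbers $t_V^-<t_V^+$ (depending on $V$) such that $\langle V(t)-e^-,\mathbf n\rangle\le 3l_0/4$ for all $t\le t_V^-$, and $\langle V(t)-e^-,\mathbf n\rangle\ge l_0/4$ for all $t\ge t_V^+$. The action functional is $\mathcal J_{\mathbb R}(V):=\int_{\mathbb R}\big[\frac12\|V'(t)\|^2+\mathcal W(V(t))\big]\,dt\in[0,+\infty]$. When $\mathcal W\in C^1(\mathcal H;\mathbb R)$, $\nabla\mathcal W(u)\in\mathcal H$ is the element defined by $\langle\nabla\mathcal W(u),v\rangle=D\mathcal W(u)v$ for all $v\in\mathcal H$. *)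

(* Defs.v *)
From HB Require Import structures.
From mathcomp Require Import all_boot all_order all_algebra.
From mathcomp Require Import all_classical all_reals all_analysis.

Set Implicit Arguments.
Unset Strict Implicit.
Unset Printing Implicit Defensive.

Import Order.TTheory GRing.Theory Num.Theory.
Import numFieldNormedType.Exports.

Local Open Scope classical_set_scope.
Local Open Scope ring_scope.

HB.mixin Record CompleteNormedModule_isHilbert (R : realType) H
    & CompleteNormedModule R H := {
  inner : H -> H -> R ;
  innerC : forall u v, inner u v = inner v u ;
  innerDl : forall u v w, inner (u + v) w = inner u w + inner v w ;
  innerZl : forall (a : R) u v, inner (a *: u) v = a * inner u v ;
  inner_norm : forall u, inner u u = `|u| ^+ 2
}.

#[short(type="hilbertType")]
HB.structure Definition Hilbert (R : realType) :=
  {H of CompleteNormedModule R H & CompleteNormedModule_isHilbert R H}.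

(* The carrier H with its weak topology: by the Riesz representation theorem,
   the coarsest topology for which all continuous linear forms are continuous
   is the one pulled back from the product space R ^ H by u |-> inner u. *)
Definition weak (R : realType) (H : hilbertType R) : topologicalType :=
  initial_topology (inner : H -> prod_topology (fun _ : H => R)).

Definition weakly_lsc (R : realType) (H : hilbertType R) (W : H -> \bar R) :=
  lower_semicontinuous (X := weak H) W.

Definition weak_cvg (R : realType) (H : hilbertType R) (U : R -> H)
    (F : set_system R) (e : H) :=
  (U t : weak H) @[t --> F] --> (e : weak H).

(* Neighbourhoods of infinity for the norm, as in liminf_{|v| -> oo}. *)
Definition norm_infty (R : realType) (H : hilbertType R) : set_system H :=
  [set A | exists M : R, forall v, M < `|v| -> A v].
Arguments norm_infty {R} H.

Section bochner.
Context d (T : measurableType d) (R : realType) (H : hilbertType R).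
Implicit Types (s : seq (set T * H)) (f : T -> H).

(* The simple function \sum_i x_i 1_(A_i) encoded by the pairs (A_i, x_i);
   the A_i may overlap. *)
Definition simple_eval s (t : T) : H :=
  \sum_(p <- s) (\1_(p.1) t : R) *: p.2.

(* The limit is required at every point, not only almost everywhere: every
   a.e. class of strongly measurable functions has such a representative. *)
Definition strongly_measurable f : Prop :=
  exists2 s : nat -> seq (set T * H),
    (forall n, {in s n, forall p, measurable p.1}) &
    (forall t, simple_eval (s n) t @[n --> \oo] --> f t).

Variable mu : {measure set T -> \bar R}.

Definition simple_integral s : H := \sum_(p <- s) fine (mu p.1) *: p.2.

(* f is Bochner integrable on T, with integral y *)
Definition is_bochner_integral f (y : H) : Prop :=
  strongly_measurable f /\
  exists s : nat -> seq (set T * H),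
    [/\ forall n, {in s n, forall p, measurable p.1 /\ (mu p.1 < +oo)%E},
        (\int[mu]_t (`|f t - simple_eval (s n) t|%:E))%E @[n --> \oo] --> 0%E &
        simple_integral (s n) @[n --> \oo] --> y].

End bochner.

Section sobolev.
Context (R : realType) (H : hilbertType R).
Local Notation mu := (@lebesgue_measure R).
Implicit Types (V G : R -> H).

Definition L2loc V : Prop :=
  strongly_measurable (V : measurableTypeR R -> H) /\
  forall a b : R, (\int[mu]_(t in `[a, b]) ((`|V t| ^+ 2)%:E) < +oo)%E.

(* C^1 functions with compact support, as in Brezis' definition of Sobolev
   spaces on an interval; smooth test functions give the same spaces. *)
Definition test_function (phi : R -> R) : Prop :=
  [/\ forall t, derivable phi t 1, continuous (derive1 phi : R -> R) &
      exists M : R, forall t, M < `|t| -> phi t = 0].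

(* \int phi' V = - \int phi G for every test function phi *)
Definition is_weak_derivative V G : Prop :=
  forall phi, test_function phi ->
    exists2 y : H,
      is_bochner_integral mu (fun t => derive1 phi t *: V t) y &
      is_bochner_integral mu (fun t => phi t *: G t) (- y).

(* Elements of H^1_loc(R; H) are identified with their unique continuous
   representative, so that pointwise values V t are meaningful. *)
Definition H1loc V : Prop :=
  [/\ continuous V, L2loc V & exists2 G, L2loc G & is_weak_derivative V G].

(* A representative of the weak derivative of V, which is determined up to a
   null set when V is in H1loc; the value is irrelevant for other V. *)
Definition weak_deriv V : R -> H :=
  xget (fun=> 0) [set G | L2loc G /\ is_weak_derivative V G].

Definition admissible (em ep : H) : set (R -> H) :=
  [set V | H1loc V /\
    let l0 := `|ep - em| in
    let n := l0^-1 *: (ep - em) in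
    exists tm tp : R, [/\ tm < tp,
      forall t, t <= tm -> inner (V t - em) n <= 3 * l0 / 4 &
      forall t, tp <= t -> l0 / 4 <= inner (V t - em) n]].

Definition action (W : H -> \bar R) V : \bar R :=
  (\int[mu]_t ((2^-1 * `|weak_deriv V t| ^+ 2)%:E + W (V t)))%E.

Definition C2 V : Prop :=
  [/\ forall t, derivable V t 1, forall t, derivable (derive1 V) t 1 &
      continuous (derive1n 2 V : R -> H)].

(* Frechet differentiability, and continuity of the differential as a map into
   the dual of H with its operator norm. *)
Definition C1 (w : H -> R) : Prop :=
  (forall u, differentiable w u) /\
  forall u (e : R), 0 < e ->
    \forall u' \near u, forall v, `|'d w u' v - 'd w u v| <= e * `|v|.

(* The Riesz representative of the differential of w at u. *)
Definition gradient (w : H -> R) (u : H) : H :=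
  xget 0 [set g | forall v, inner g v = 'd w u v].

End sobolev.

(* Main.v *)
Require Import Defs.
From HB Require Import structures.
From mathcomp Require Import all_boot all_order all_algebra.
From mathcomp Require Import all_classical all_reals all_analysis.
From mathcomp Require Import measurable_realfun.
From mathcomp Require Import ring lra.

Set Implicit Arguments.
Unset Strict Implicit.
Unset Printing Implicit Defensive.

Import Order.TTheory GRing.Theory Num.Theory.
Import numFieldNormedType.Exports.

Local Open Scope classical_set_scope.
Local Open Scope ring_scope.

(** Existence is the direct method, run along an ultrafilter.  A path of finite
    action is Hoelder continuous (action_holder) and, since W is bounded below
    near infinity, it is bounded by a constant that depends on its action only
    (action_bounded).  Hence the values of a minimizing sequence V n, seen from
    moving time origins s n, have weak limits along an ultrafilter
    (ultra_weak_limit), and the action is lower semicontinuous for this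
    convergence (action_lsc).  For the potential this follows from the weak
    lower semicontinuity of W, made locally uniform in time (near_trunc).  For
    the kinetic energy one compares sums of squared increments over dyadic
    grids; that such bounds produce a square integrable derivative is the
    Radon-Nikodym property of Hilbert spaces (prim_of_dq_bound), proved with
    the martingale of difference quotients.

    Translations may let the limit degenerate: it can stay in the well of em.
    Let the height of u be its coordinate along ep - em, measured from em.  In
    the slab where the height is between l0 / 4 and 3 l0 / 4, W is bounded
    below (W_coercive), so a path of finite action ends up on one side of it.
    Put the time origin where V n first reaches the height 3 l0 / 4.  If the
    limit ends up above the slab, it is admissible, hence a minimizer.
    Otherwise V n comes back below the slab, and it reaches the height 3 l0 / 4
    again at times that go to infinity relative to the first ones.  Put the
    origin there and repeat: each round leaves one more fixed amount of energy
    behind (crossing_cost), so the process stops (good_limit).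

    The same estimates off weak neighbourhoods of the wells give the weak
    limits at infinity (eventually_weakly_close).  Equipartition comes from
    changing the speed on a half line t >= a by a factor lam: there the kinetic
    energy is multiplied by lam and the potential energy by 1 / lam, so that at
    a minimizer both are equal on every half line (equipartition_half_line),
    hence on every segment, hence pointwise almost everywhere.

    If W is of class C1, the variations U + phi h by test functions phi give
    the Euler-Lagrange equation in weak form (euler_lagrange), and a second
    order version of the du Bois-Reymond lemma (du_bois_reymond2) shows that U
    differs from a second primitive of the gradient along U by an affine
    function (minimizer_affine). *)

(** * Hilbert space: the inner product, Riesz representation *)

Section hilbert.
Context (R : realType) (H : hilbertType R).
Implicit Types (u v w h : H) (a : R).

Lemma innerDr u v w : inner u (v + w) = inner u v + inner u w.
Proof. by rewrite innerC innerDl !(innerC u). Qed.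

Lemma innerZr a u v : inner u (a *: v) = a * inner u v.
Proof. by rewrite innerC innerZl innerC. Qed.

Lemma inner0l v : inner (0 : H) v = 0.
Proof. by rewrite -(scale0r (0 : H)) innerZl mul0r. Qed.

Lemma inner0r v : inner v (0 : H) = 0.
Proof. by rewrite innerC inner0l. Qed.

Lemma innerNl u v : inner (- u) v = - inner u v.
Proof. by rewrite -scaleN1r innerZl mulN1r. Qed.

Lemma innerNr u v : inner u (- v) = - inner u v.
Proof. by rewrite innerC innerNl innerC. Qed.

Lemma innerBl u v w : inner (u - v) w = inner u w - inner v w.
Proof. by rewrite innerDl innerNl. Qed.

Lemma inner_suml (I : Type) (r : seq I) (F : I -> H) h :
  inner (\sum_(i <- r) F i) h = \sum_(i <- r) inner (F i) h.
Proof.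
elim: r => [|i r IH]; first by rewrite !big_nil inner0l.
by rewrite !big_cons innerDl IH.
Qed.

Lemma normD_sqr u v : `|u + v| ^+ 2 = `|u| ^+ 2 + 2 * inner u v + `|v| ^+ 2.
Proof. by rewrite -!inner_norm !innerDl !innerDr (innerC v u); ring. Qed.

Lemma normB_sqr u v : `|u - v| ^+ 2 = `|u| ^+ 2 - 2 * inner u v + `|v| ^+ 2.
Proof. by rewrite normD_sqr innerNr normrN mulrN. Qed.

Lemma inner_le u v : inner u v <= `|u| * `|v|.
Proof.
have [->|u0] := eqVneq u 0; first by rewrite inner0l normr0 mul0r.
have [->|v0] := eqVneq v 0; first by rewrite inner0r normr0 mulr0.
have up : 0 < `|u| by rewrite normr_gt0.
have vp : 0 < `|v| by rewrite normr_gt0.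
have := sqr_ge0 `|(`|v| *: u - `|u| *: v)|.
rewrite normB_sqr !normrZ innerZl innerZr !normr_id => h.
have : 0 <= 2 * (`|u| * `|v|) * (`|u| * `|v| - inner u v) by nra.
by rewrite pmulr_rge0 ?subr_ge0// mulr_gt0 ?mulr_gt0.
Qed.

Lemma abs_inner_le u v : `|inner u v| <= `|u| * `|v|.
Proof. by rewrite ler_norml inner_le lerNl -innerNl -(normrN u) inner_le. Qed.

Lemma inner_ext u v : (forall h, inner u h = inner v h) -> u = v.
Proof.
move=> uv; apply/eqP; rewrite -subr_eq0 -normr_eq0 -sqrf_eq0 -inner_norm.
by rewrite innerBl uv subrr.
Qed.

Lemma norm_le_inner u a :
  0 <= a -> (forall h, inner u h <= a * `|h|) -> `|u| <= a.
Proof.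
move=> a0 /(_ u); rewrite inner_norm expr2.
have [->|u0] := eqVneq u 0; first by rewrite normr0.
by rewrite ler_pM2r// normr_gt0.
Qed.

Lemma cvg_sqr_norm {T : Type} (F : set_system T) (FF : Filter F) (f : T -> H)
    u :
  f @ F --> u -> `|f t| ^+ 2 @[t --> F] --> `|u| ^+ 2.
Proof.
by move=> /cvg_norm fu; under eq_fun do rewrite expr2; rewrite expr2; exact: cvgM.
Qed.

Lemma inner_cvg {T : Type} (F : set_system T) (FF : Filter F) (f g : T -> H)
    u v :
  f @ F --> u -> g @ F --> v -> inner (f t) (g t) @[t --> F] --> inner u v.
Proof.
move=> fu gv.
have fgE t : inner (f t) (g t) =
    (`|f t + g t| ^+ 2 - `|f t| ^+ 2 - `|g t| ^+ 2) / 2.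
  by rewrite normD_sqr; field.
have -> : inner u v = (`|u + v| ^+ 2 - `|u| ^+ 2 - `|v| ^+ 2) / 2.
  by rewrite normD_sqr; field.
under eq_fun do rewrite fgE.
apply: cvgMr_tmp; apply: cvgB; first apply: cvgB.
- by apply: cvg_sqr_norm; exact: cvgD.
- exact: cvg_sqr_norm.
- exact: cvg_sqr_norm.
Qed.

Lemma innerl_cvg {T : Type} (F : set_system T) (FF : Filter F) (f : T -> H)
    u h :
  f @ F --> u -> inner (f t) h @[t --> F] --> inner u h.
Proof. by move=> fu; apply: inner_cvg fu _; exact: cvg_cst. Qed.

(** The representing vector minimizes |v|^2 / 2 - f v: by the parallelogram
    identity every minimizing sequence is Cauchy. *)
Lemma riesz (f : H -> R) (C : R) :
  (forall u v, f (u + v) = f u + f v) -> (forall a u, f (a *: u) = a * f u) ->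
  (forall u, `|f u| <= C * `|u|) -> exists g, forall h, inner g h = f h.
Proof.
move=> fD fZ fC.
have f_cvg (v : nat -> H) l : v @ \oo --> l -> (f (v n) @[n --> \oo] --> f l).
  move=> vl; apply/cvgrPdist_le => e e0.
  have C1 : 0 < `|C| + 1 by rewrite ltr_wpDl.
  move/cvgrPdist_le : vl => /(_ (e / (`|C| + 1))).
  rewrite divr_gt0// => /(_ isT); apply: filterS => n nv.
  have -> : f l - f (v n) = f (l - v n).
    by rewrite fD -(scaleN1r (v n)) fZ mulN1r.
  apply: (le_trans (fC _)).
  rewrite ler_pdivlMr// in nv; apply: le_trans nv.
  rewrite mulrC ler_wpM2l// (le_trans (ler_norm _))// lerDl.
  exact: ler01.
pose I v := `|v| ^+ 2 / 2 - f v.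
have I_lb v : - (C ^+ 2 / 2) <= I v.
  rewrite /I; have := fC v; have := ler_norm (f v).
  have := sqr_ge0 (`|v| - C); nra.
have infI : has_inf (range I).
  by split; [exists (I 0), 0|exists (- (C ^+ 2 / 2)) => _ [v _ <-]].
set m := inf (range I).
have m_le v : m <= I v by apply: ge_inf; [case: infI|exists v].
have /choice [v vm] : forall n, exists v, I v < m + n.+1%:R^-1.
  move=> n; have [_ [v _ <-] ?] := @inf_adherent _ (range I) n.+1%:R^-1
    ltac:(by rewrite invr_gt0) infI.
  by exists v.
have para x y : `|x - y| ^+ 2 = 4 * (I x + I y) - 8 * I (2^-1 *: (x + y)).
  rewrite /I normB_sqr normrZ exprMn normD_sqr fZ fD.
  by rewrite [`|2^-1 : R|]gtr0_norm//; field.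
have vnm n p : (n <= p)%N -> `|v n - v p| ^+ 2 <= 8 * n.+1%:R^-1.
  move=> np; rewrite para; have := m_le (2^-1 *: (v n + v p)).
  have := vm n; have := vm p.
  have : (p.+1%:R^-1 : R) <= n.+1%:R^-1 by rewrite lef_pV2 ?posrE// ler_nat.
  move: (I _) (I _) (I _) (n.+1%:R^-1) (p.+1%:R^-1) => a b c d e; lra.
have : cvg (v @ \oo).
  apply: cauchy_cvg; apply/cauchy_exP => e e0.
  have : (8 * (n.+1%:R^-1 : R)) @[n --> \oo] --> 8 * (0 : R).
    by apply: cvgMl_tmp; exact: cvg_harmonic.
  rewrite mulr0 => /cvgrPdist_lt/(_ (e ^+ 2)); rewrite exprn_gt0// => /(_ isT).
  move=> [N _ NE]; exists (v N); exists N => // p /= Np.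
  rewrite -ball_normE /=.
  have := NE N (leqnn _); rewrite sub0r normrN ger0_norm; last first.
    by rewrite mulr_ge0.
  move=> /(le_lt_trans (vnm _ _ Np)).
  by rewrite ltr_pXn2r ?nnegrE// ltW.
move=> /cvg_ex[g vg].
have Ig : I g <= m.
  have : I (v n) @[n --> \oo] --> I g.
    apply: cvgB; last exact: f_cvg.
    apply: cvgMr_tmp.
    exact: cvg_sqr_norm.
  have : m + (n.+1%:R^-1 : R) @[n --> \oo] --> m + 0.
    by apply: cvgD; [exact: cvg_cst|exact: cvg_harmonic].
  rewrite addr0 => h1 h2; apply: (ler_cvg_to h2 h1).
  by near=> n; exact/ltW/vm.
have key h t : 0 <= t ^+ 2 * `|h| ^+ 2 / 2 + t * (inner g h - f h).
  have := le_trans Ig (m_le (g + t *: h)).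
  rewrite /I normD_sqr normrZ exprMn real_normK ?num_real// innerZr fD fZ.
  lra.
exists g => h; apply/eqP; rewrite -subr_eq0; apply/eqP.
set d := inner g h - f h.
have [h0|h0] := eqVneq h 0.
  by rewrite /d h0 inner0r -(scale0r (0 : H)) fZ mul0r subr0.
have hp : 0 < `|h| ^+ 2 by rewrite exprn_gt0// normr_gt0.
have := key h (- (d / `|h| ^+ 2)); rewrite -/d.
have -> : (- (d / `|h| ^+ 2)) ^+ 2 * `|h| ^+ 2 / 2 + - (d / `|h| ^+ 2) * d =
    - (d ^+ 2 / (2 * `|h| ^+ 2)) by field; rewrite normr_eq0.
rewrite oppr_ge0 => dle.
have : d ^+ 2 / (2 * `|h| ^+ 2) == 0.
  by rewrite eq_le dle divr_ge0 ?sqr_ge0// mulr_ge0// ltW.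
by rewrite mulf_eq0 sqrf_eq0 invr_eq0 mulf_eq0 (gt_eqF hp) pnatr_eq0 !orbF => /eqP.
Unshelve. all: by end_near. Qed.

(** ** Weak limits along an ultrafilter *)

(** Convergence along an ultrafilter replaces the extraction of weakly
    convergent subsequences: every bounded family converges weakly, because
    each of its coordinates converges and the limits form a bounded linear
    form. *)
Lemma ultra_weak_limit (T : Type) (G : set_system T) (GU : UltraFilter G)
    (v : T -> H) (M : R) :
  (\forall n \near G, `|v n| <= M) ->
  exists u, forall h, inner (v n) h @[n --> G] --> inner u h.
Proof.
move=> vM.
have GP : ProperFilter G by exact: ultra_proper.
have /choice[l lP] : forall h, exists l : R,
    (inner (v n) h @[n --> G] --> l) /\ `|l| <= M * `|h|.
  move=> h; set A := `[- (M * `|h|), M * `|h|]%classic : set R.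
  have cA : compact A by exact: segment_compact.
  have GA : \forall n \near G, A (inner (v n) h).
    near=> n; rewrite /A/= in_itv/= -ler_norml.
    apply: (le_trans (abs_inner_le _ _)); rewrite ler_wpM2r//.
    by near: n.
  rewrite compact_ultra/= in cA.
  have UG : UltraFilter ((fun n => inner (v n) h) @ G).
    split; first exact: fmap_proper_filter.
    move=> F FF GF; rewrite predeqE => B; split; last exact: GF.
    move=> FB; have [//|] := in_ultra_setVsetC ((fun n => inner (v n) h) @^-1` B) GU.
    move=> nB; have : F (~` B) by apply: GF.
    move=> FnB; have : F (B `&` ~` B) by exact: filterI.
    by rewrite setICr => /filter_not_empty.
  have [l [Al vl]] := cA _ UG GA.
  exists l; split => //; move: Al; rewrite /A/= in_itv/= -ler_norml//.
have lD u w : l (u + w) = l u + l w.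
  have e : inner (v n) (u + w) @[n --> G] --> l u + l w.
    have -> : (fun n => inner (v n) (u + w)) =
        (fun n => inner (v n) u + inner (v n) w).
      by apply/funext => n; rewrite innerDr.
    by apply: cvgD; exact: (lP _).1.
  exact: (cvg_unique _ (lP _).1 e).
have lZ a u : l (a *: u) = a * l u.
  have e : inner (v n) (a *: u) @[n --> G] --> a * l u.
    have -> : (fun n => inner (v n) (a *: u)) = (fun n => a * inner (v n) u).
      by apply/funext => n; rewrite innerZr.
    by apply: cvgMl_tmp; exact: (lP _).1.
  exact: (cvg_unique _ (lP _).1 e).
have [u uP] := riesz lD lZ (fun h => (lP h).2).
by exists u => h; rewrite uP; exact: (lP h).1.
Unshelve. all: by end_near. Qed.

(** The weak topology is pulled back from the topology of pointwise convergence
    by the map u |-> inner u. *)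
Lemma weak_cvgP (T : Type) (F : set_system T) (FF : Filter F) (v : T -> H) u :
  (forall h, inner (v n) h @[n --> F] --> inner u h) ->
  (v n : weak H) @[n --> F] --> (u : weak H).
Proof.
move=> vu A; rewrite nbhsE => -[B [[C oC <-] Cu] BA].
have : (fun n => inner (v n) : {ptws H -> R}) @ F --> (inner u : {ptws H -> R}).
  by apply: (iffRL (@pointwise_cvgP H R ((fun n => inner (v n)) @ F) (inner u) _)) => h; exact: vu.
move=> /(_ C) vC.
have : F (v @^-1` (inner @^-1` C)) by apply: vC; apply: open_nbhs_nbhs.
by apply: filterS => n /= Cn; exact: BA.
Qed.

Lemma weakly_lsc_cvg (W : H -> \bar R) (T : Type) (F : set_system T)
    (FF : Filter F) (v : T -> H) u a :
  weakly_lsc W -> (forall h, inner (v n) h @[n --> F] --> inner u h) ->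
  (a%:E < W u)%E -> \forall n \near F, (a%:E < W (v n))%E.
Proof.
move=> Wl vu aW; have [V uV VW] := Wl u a aW.
have FV : F (v @^-1` V) := weak_cvgP FF vu uV.
by apply: filterS FV => n; exact: VW.
Qed.

End hilbert.

(** * Strongly measurable functions *)

Section strongly_measurable.
Context d (T : measurableType d) (R : realType) (H : hilbertType R).
Implicit Types (s : seq (set T * H)) (f g : T -> H).

Definition simple s := {in s, forall p, measurable p.1}.

Lemma simple_cons p s : simple (p :: s) <-> measurable p.1 /\ simple s.
Proof.
split=> [ps|[mp ms] q]; first split; first by apply: ps; rewrite mem_head.
  by move=> q qs; apply: ps; rewrite inE qs orbT.
by rewrite inE => /predU1P[->//|]; exact: ms.
Qed.

Lemma simple_eval_cons p s t :
  simple_eval (p :: s) t = (\1_(p.1) t : R) *: p.2 + simple_eval s t.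
Proof. by rewrite /simple_eval big_cons. Qed.

Lemma simple_eval_cat s s' t :
  simple_eval (s ++ s') t = simple_eval s t + simple_eval s' t.
Proof. by rewrite /simple_eval big_cat. Qed.

Lemma measurable_simple_inner s f : simple s ->
  (forall h, measurable_fun [set: T] (fun t => inner (f t) h)) ->
  measurable_fun [set: T] (fun t => inner (simple_eval s t) (f t)).
Proof.
elim: s => [_ _|p s IH /simple_cons[mp ms] mf].
  under eq_fun do rewrite /simple_eval big_nil inner0l.
  exact: measurable_cst.
under eq_fun do rewrite simple_eval_cons innerDl innerZl innerC.
apply: measurable_funD; last exact: IH.
by apply: measurable_funM => //; exact: measurable_indic.
Qed.

Lemma strongly_measurable_innerl f h : strongly_measurable f ->
  measurable_fun [set: T] (fun t => inner (f t) h).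
Proof.
move=> [s ms sf].
apply: (@measurable_fun_cvg _ _ _ _
    (fun n t => inner (simple_eval (s n) t) h)) => [n|t _].
  apply: (@measurable_simple_inner _ (cst h)) => [|h']; first exact: ms.
  exact: (measurable_cst (inner h h')).
exact: innerl_cvg.
Qed.

Lemma strongly_measurable_inner f g :
  strongly_measurable f -> strongly_measurable g ->
  measurable_fun [set: T] (fun t => inner (f t) (g t)).
Proof.
move=> [s ms sf] mg.
apply: (@measurable_fun_cvg _ _ _ _
    (fun n t => inner (simple_eval (s n) t) (g t))) => [n|t _].
  apply: measurable_simple_inner => [|h]; first exact: ms.
  exact: strongly_measurable_innerl.
by apply: inner_cvg (sf t) _; exact: cvg_cst.
Qed.

Lemma strongly_measurable_sqr_norm f : strongly_measurable f ->
  measurable_fun [set: T] (fun t => `|f t| ^+ 2).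
Proof.
by move=> mf; under eq_fun do rewrite -inner_norm; exact: strongly_measurable_inner.
Qed.

Lemma strongly_measurable_norm f : strongly_measurable f ->
  measurable_fun [set: T] (fun t => `|f t|).
Proof.
move=> /strongly_measurable_sqr_norm mf.
have -> : (fun t => `|f t|) = (fun t => Num.sqrt (`|f t| ^+ 2)).
  by apply/funext => t; rewrite sqrtr_sqr normr_id.
apply: (@measurableT_comp _ _ _ _ _ _ (@Num.sqrt R)) mf.
exact: (continuous_measurable_fun (@sqrt_continuous R)).
Qed.

Lemma strongly_measurable_simple s : simple s -> strongly_measurable (simple_eval s).
Proof. by move=> ms; exists (fun=> s) => // t; exact: cvg_cst. Qed.

Lemma strongly_measurableD f g : strongly_measurable f -> strongly_measurable g ->
  strongly_measurable (fun t => f t + g t).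
Proof.
move=> [s ms sf] [s' ms' sg]; exists (fun n => s n ++ s' n) => [n p|t].
  by rewrite mem_cat => /orP[]; [exact: ms|exact: ms'].
under eq_fun do rewrite simple_eval_cat.
by apply: cvgD.
Qed.

(** The product of a scalar step function and a vector-valued one. *)
Definition simple_mul (l : seq (set T * R)) s : seq (set T * H) :=
  [seq (p.1 `&` q.1, p.2 *: q.2) | p <- l, q <- s].

Lemma simple_eval_mul l s t :
  simple_eval (simple_mul l s) t =
  (\sum_(p <- l) (\1_(p.1) t : R) * p.2) *: simple_eval s t.
Proof.
rewrite /simple_eval /simple_mul big_allpairs_dep /= scaler_suml.
apply: eq_bigr => p _; rewrite scaler_sumr; apply: eq_bigr => q _.
by rewrite indicI /= !scalerA; congr (_ *: _); rewrite mulrAC.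
Qed.

Lemma simple_mulP l s : {in l, forall p, measurable p.1} -> simple s ->
  simple (simple_mul l s).
Proof.
by move=> ml ms _ /allpairsP[[p q] [/= /ml mp /ms mq ->]]; exact: measurableI.
Qed.

(** The scalar factor is itself given by step functions, so that indicators and
    dyadic discretizations of continuous functions are both covered. *)
Lemma strongly_measurableZ (l : nat -> seq (set T * R)) (phi : T -> R) f :
  (forall n, {in l n, forall p, measurable p.1}) ->
  (forall t, \sum_(p <- l n) (\1_(p.1) t : R) * p.2 @[n --> \oo] --> phi t) ->
  strongly_measurable f -> strongly_measurable (fun t => phi t *: f t).
Proof.
move=> ml lphi [s ms sf]; exists (fun n => simple_mul (l n) (s n)) => [n|t].
  by apply: simple_mulP => //; exact: ms.
under eq_fun do rewrite simple_eval_mul.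
by apply: cvgZ; [exact: lphi|exact: sf].
Qed.

Lemma strongly_measurable_cstZ (a : R) f :
  strongly_measurable f -> strongly_measurable (fun t => a *: f t).
Proof.
apply: (strongly_measurableZ (l := fun=> [:: (setT, a)])).
  by move=> n p; rewrite inE => /eqP ->; exact: measurableT.
move=> t; under eq_fun do rewrite big_seq1 /= indicT mul1r; exact: cvg_cst.
Qed.

Lemma strongly_measurable_restrict (A : set T) f : measurable A ->
  strongly_measurable f -> strongly_measurable (fun t => (\1_A t : R) *: f t).
Proof.
move=> mA; apply: (strongly_measurableZ (l := fun=> [:: (A, 1)])).
  by move=> n p; rewrite inE => /eqP ->.
by move=> t; under eq_fun do rewrite big_seq1 /= mulr1; exact: cvg_cst.
Qed.

Lemma strongly_measurable_comp (d' : measure_display) (T' : measurableType d') (theta : T' -> T) f :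
  @measurable_fun d' d T' T [set: T'] theta ->
  strongly_measurable f -> strongly_measurable (f \o theta).
Proof.
move=> mt [s ms sf].
exists (fun n => [seq (theta @^-1` p.1, p.2) | p <- s n]) => [n _ /mapP[p ps ->]|t].
  by rewrite -[X in measurable X]setTI; apply: mt => //; exact: ms ps.
rewrite /simple_eval; under eq_fun do rewrite big_map.
exact: sf.
Qed.

End strongly_measurable.

(** ** Dyadic cells of the line *)

Section dyadic.
Context (R : realType).
Implicit Types (t : R) (n : nat).

Definition dlen n : R := 2^-1 ^+ n.

(** The left end of the dyadic cell of length 2^-n that contains t. *)
Definition dleft n t : R := (Num.floor (t / dlen n))%:~R * dlen n.

Lemma dlen_gt0 n : 0 < dlen n.
Proof. by rewrite exprn_gt0// invr_gt0. Qed.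

Lemma dlen_ge0 n : 0 <= dlen n.
Proof. exact/ltW/dlen_gt0. Qed.

Lemma dleft_le n t : dleft n t <= t.
Proof. by rewrite -ler_pdivlMr ?dlen_gt0// floor_le. Qed.

Lemma dleft_gt n t : t < dleft n t + dlen n.
Proof.
have := floorD1_gt (t / dlen n).
rewrite ltr_pdivrMr ?dlen_gt0// => /lt_le_trans; apply.
by rewrite intrD mulrDl mul1r.
Qed.

Lemma dleftE n (i : int) t :
  i%:~R * dlen n <= t < i%:~R * dlen n + dlen n -> dleft n t = i%:~R * dlen n.
Proof.
move=> /andP[it ti]; rewrite /dleft (@floor_def _ _ i)//.
rewrite ler_pdivlMr ?dlen_gt0// ltr_pdivrMr ?dlen_gt0// it/= (lt_le_trans ti)//.
by rewrite intrD mulrDl mul1r.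
Qed.

Lemma dlen_cvg : dlen n @[n --> \oo] --> 0.
Proof. by apply: cvg_expr; rewrite ger0_norm ?invr_ge0// invf_lt1// ltr1n. Qed.

Lemma dleft_cvg t : dleft n t @[n --> \oo] --> t.
Proof.
apply: (@squeeze_cvgr _ _ _ _ (fun n => t - dlen n) (cst t)).
- by near=> n; rewrite dleft_le andbT lerBlDr ltW// dleft_gt.
- by rewrite -[X in _ --> X]subr0; apply: cvgB; [exact: cvg_cst|exact: dlen_cvg].
- exact: cvg_cst.
Unshelve. all: by end_near. Qed.

(** The cells of length 2^-n that tile [-n, n[, by their left ends. *)
Definition dcells n : seq R :=
  [seq - n%:R + j%:R * dlen n | j <- index_iota 0 (2 * n * 2 ^ n)].

Lemma big_dcells (E : lmodType R) (x : R -> E) n t : - n%:R <= t < n%:R ->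
  \sum_(a <- dcells n) (\1_(`[a, a + dlen n[%classic) t : R) *: x a =
  x (dleft n t).
Proof.
move=> /andP[nt tn]; set h := dlen n; have h0 : 0 < h := dlen_gt0 n.
have h2 : (2 ^ n)%:R * h = 1 :> R.
  by rewrite natrX /h /dlen -exprMn mulfV// expr1n.
have nE : n%:R = (n * 2 ^ n)%:R * h :> R by rewrite natrM -mulrA h2 mulr1.
pose k := Num.floor (t / h).
have kt : k%:~R * h <= t := dleft_le n t.
have tk : t < k%:~R * h + h := dleft_gt n t.
have k_ge : 0 <= k + (n * 2 ^ n)%:Z.
  rewrite -ltzD1 -(ltr_int R) !intrD -(ltr_pM2r h0) mul0r !mulrDl -nE mul1r.
  lra.
have k_lt : k + (n * 2 ^ n)%:Z < (2 * n * 2 ^ n)%:Z.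
  rewrite -(ltr_int R) intrD -(ltr_pM2r h0) mulrDl -nE -mulnA -[X in _ < X * _]/((2 * (n * 2 ^ n))%N%:R).
  rewrite natrM -mulrA -nE; lra.
pose j0 := absz (k + (n * 2 ^ n)%:Z).
have j0E : j0%:R = k%:~R + (n * 2 ^ n)%:R :> R.
  by rewrite -[LHS]/(j0%:Z%:~R) gez0_abs// intrD.
have j0_lt : (j0 < 2 * n * 2 ^ n)%N by rewrite -ltz_nat gez0_abs.
have leftE (j : nat) : - n%:R + j%:R * h = (j%:Z - (n * 2 ^ n)%:Z)%:~R * h.
  by rewrite intrD mulrDl intrN mulNr -nE addrC.
rewrite /dcells big_map big_mkord.
rewrite (bigD1 (Ordinal j0_lt))//= big1 ?addr0 => [|j jj0].
  rewrite indicE mem_set; last first.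
    by rewrite /= in_itv/= -/h j0E mulrDl -nE; apply/andP; split; lra.
  by rewrite scale1r -/h j0E mulrDl -nE [k%:~R * _ + _]addrC addKr.
rewrite indicE memNset ?scale0r// => /=; rewrite in_itv/= leftE => /dleftE.
rewrite /dleft -/h -/k => /(mulIf (lt0r_neq0 h0))/eqP; rewrite eqr_int => /eqP kE.
move/negP: jj0; apply; apply/eqP/val_inj => /=.
by rewrite /j0 kE subrK.
Qed.

End dyadic.

(** * The Bochner integral *)

Section bochner_theory.
Context d (T : measurableType d) (R : realType) (H : hilbertType R).
Variable mu : {measure set T -> \bar R}.
Implicit Types (s : seq (set T * H)) (f g : T -> H).

Definition finite_simple s :=
  {in s, forall p, measurable p.1 /\ (mu p.1 < +oo)%E}.

Lemma finite_simpleW s : finite_simple s -> simple s.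
Proof. by move=> sP p /sP[]. Qed.

Lemma finite_simple_cons p s : finite_simple (p :: s) ->
  [/\ measurable p.1, (mu p.1 < +oo)%E & finite_simple s].
Proof.
move=> ps; have [mp fp] := ps p (mem_head _ _); split => // q qs.
by apply: ps; rewrite inE qs orbT.
Qed.

Lemma integrable_finite_indic (A : set T) : measurable A -> (mu A < +oo)%E ->
  mu.-integrable [set: T] (EFin \o (\1_A : T -> R)).
Proof.
move=> mA fA; apply/integrableP; split.
  by apply/measurable_EFinP; exact: measurable_indic.
under eq_integral do rewrite /= ger0_norm ?ler0n//.
by rewrite integral_indic// setIT.
Qed.

Lemma Rintegral_indic (A : set T) : measurable A ->
  \int[mu]_t (\1_A t : R) = fine (mu A).
Proof. by move=> mA; rewrite /Rintegral integral_indic// setIT. Qed.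

Lemma integral_simple_inner s h : finite_simple s ->
  mu.-integrable [set: T] (EFin \o (fun t => inner (simple_eval s t) h)) /\
  \int[mu]_t (inner (simple_eval s t) h) = inner (simple_integral mu s) h.
Proof.
elim: s => [_|p s IH /finite_simple_cons[mp fp /IH[si sE]]].
  rewrite /simple_eval /simple_integral big_nil inner0l.
  have -> : (fun t : T => inner (\sum_(p <- [::] : seq (set T * H))
      (\1_(p.1) t : R) *: p.2) h) = cst 0.
    by apply/funext => t; rewrite big_nil inner0l.
  by split; [exact: integrable0|rewrite Rintegral_cst// mul0r].
have -> : (fun t => inner (simple_eval (p :: s) t) h) =
    (fun t => \1_(p.1) t * inner p.2 h + inner (simple_eval s t) h).
  by apply/funext => t; rewrite simple_eval_cons innerDl innerZl.
have ip : mu.-integrable [set: T] (EFin \o (\1_(p.1) : T -> R)).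
  exact: integrable_finite_indic.
have ip' : mu.-integrable [set: T] (EFin \o (fun t => \1_(p.1) t * inner p.2 h)).
  have := integrableZr measurableT (inner p.2 h) ip.
  by apply: eq_integrable => // t _ /=; rewrite EFinM.
split.
  have := integrableD measurableT ip' si.
  by apply: eq_integrable => // t _ /=; rewrite EFinD.
rewrite RintegralD// sE RintegralZr// Rintegral_indic//.
by rewrite /simple_integral big_cons innerDl innerZl.
Qed.

Definition norm_integrable f :=
  strongly_measurable f /\ (\int[mu]_t (`|f t|%:E) < +oo)%E.

Lemma norm_integrable_norm f : norm_integrable f ->
  mu.-integrable [set: T] (EFin \o (fun t => `|f t|)).
Proof.
move=> [mf foo]; apply/integrableP; split.
  by apply/measurable_EFinP; exact: strongly_measurable_norm.
by under eq_integral do rewrite /= normr_id.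
Qed.

Lemma integrable_inner f h : norm_integrable f ->
  mu.-integrable [set: T] (EFin \o (fun t => inner (f t) h)).
Proof.
move=> fi; have fn := norm_integrable_norm fi.
have := integrableZr measurableT `|h| fn.
apply: le_integrable => //.
  by apply/measurable_EFinP; apply: strongly_measurable_innerl; case: fi.
move=> t _ /=; rewrite lee_fin (le_trans (abs_inner_le _ _))//.
by rewrite normrM !normr_id.
Qed.

Lemma Rintegral_inner_le f h : norm_integrable f ->
  `|\int[mu]_t (inner (f t) h)| <= fine (\int[mu]_t (`|f t|%:E)) * `|h|.
Proof.
move=> fi; have fn := norm_integrable_norm fi; have fh := integrable_inner h fi.
apply: (le_trans (le_normr_Rintegral measurableT fh)).
rewrite -[fine _]/(\int[mu]_t `|f t|) -RintegralZr//; apply: le_Rintegral => //.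
- exact: integrable_norm.
- by have := integrableZr measurableT `|h| fn.
- by move=> t _; exact: abs_inner_le.
Qed.

(** On a Hilbert space the Pettis integral is given by the representation
    theorem; below it is seen to be the Bochner integral. *)
Lemma norm_integrable_pettis f : norm_integrable f ->
  exists y, forall h, inner y h = \int[mu]_t (inner (f t) h).
Proof.
move=> fi; apply: (@riesz _ _ _ (fine (\int[mu]_t (`|f t|%:E)))).
- move=> u v; rewrite -RintegralD//; try exact: integrable_inner.
  by apply: eq_Rintegral => t _; rewrite innerDr.
- move=> a u; rewrite -RintegralZl//; last exact: integrable_inner.
  by apply: eq_Rintegral => t _; rewrite innerZr.
- by move=> u; exact: Rintegral_inner_le.
Qed.

Lemma norm_integrable_simple s : finite_simple s -> norm_integrable (simple_eval s).
Proof.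
move=> sP; split; first exact/strongly_measurable_simple/finite_simpleW.
elim: s sP => [_|p s IH /finite_simple_cons[mp fp sP]].
  under eq_integral do rewrite /simple_eval big_nil normr0.
  by rewrite integral0 ltry.
have ms := strongly_measurable_simple (finite_simpleW sP).
have ip : mu.-integrable [set: T] (EFin \o (fun t => \1_(p.1) t * `|p.2| : R)).
  have := integrableZr measurableT `|p.2| (integrable_finite_indic mp fp).
  by apply: eq_integrable => // t _ /=; rewrite EFinM.
have := integrableD measurableT ip (norm_integrable_norm (conj ms (IH sP))).
move=> /integrableP[mps]; apply: le_lt_trans; apply: ge0_le_integral => //.
- apply/measurable_EFinP/strongly_measurable_norm/strongly_measurable_simple.
  by move=> q; rewrite inE => /predU1P[->//|]; exact: finite_simpleW.
- exact: measurableT_comp.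
- move=> t _ /=; rewrite lee_fin simple_eval_cons (le_trans (ler_normD _ _))//.
  by rewrite normrZ ger0_norm ?ler0n// ler_norm.
Qed.

Lemma norm_integrableB f g : norm_integrable f -> norm_integrable g ->
  norm_integrable (fun t => f t - g t).
Proof.
move=> fi gi.
have mfg : strongly_measurable (fun t => f t - g t).
  under eq_fun do rewrite -(scaleN1r (g _)).
  apply: strongly_measurableD; first by case: fi.
  by apply: strongly_measurable_cstZ; case: gi.
split => //.
have := integrableD measurableT (norm_integrable_norm fi) (norm_integrable_norm gi).
move=> /integrableP[mps]; apply: le_lt_trans; apply: ge0_le_integral => //.
- by apply/measurable_EFinP; exact: strongly_measurable_norm.
- exact: measurableT_comp.
- move=> t _ /=; rewrite lee_fin (le_trans (ler_normB _ _))//.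
  by rewrite ler_norm.
Qed.

Lemma simple_integral_dist f y s : norm_integrable f ->
  (forall h, inner y h = \int[mu]_t (inner (f t) h)) -> finite_simple s ->
  `|y - simple_integral mu s| <= fine (\int[mu]_t (`|f t - simple_eval s t|%:E)).
Proof.
move=> fi yE sP; have si := norm_integrable_simple sP.
apply: norm_le_inner => [|h]; first by apply: fine_ge0; exact: integral_ge0.
have [ish sE] := integral_simple_inner h sP.
rewrite innerBl yE -sE -RintegralB//; last exact: integrable_inner.
under eq_Rintegral do rewrite -innerBl.
apply: (le_trans (ler_norm _)).
exact: (Rintegral_inner_le h (norm_integrableB fi si)).
Qed.

Lemma cvg_bochner f y (s : nat -> seq (set T * H)) : norm_integrable f ->
  (forall h, inner y h = \int[mu]_t (inner (f t) h)) ->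
  (forall n, finite_simple (s n)) ->
  (\int[mu]_t (`|f t - simple_eval (s n) t|%:E))%E @[n --> \oo] --> 0%E ->
  simple_integral mu (s n) @[n --> \oo] --> y.
Proof.
move=> fi yE sP s0.
have {}s0 : fine (\int[mu]_t (`|f t - simple_eval (s n) t|%:E)) @[n --> \oo] -->
    (0 : R).
  by apply: fine_cvg; rewrite -[X in _ --> X]/(0%:E).
apply/cvgrPdist_le => e e0; move/cvgrPdist_le : s0 => /(_ e e0).
apply: filterS => n; rewrite sub0r normrN => /(le_trans (ler_norm _)).
by apply: le_trans; exact: simple_integral_dist.
Qed.

Lemma bochner_integrable f y : is_bochner_integral mu f y -> norm_integrable f.
Proof.
move=> [mf [s [sP /fine_cvgP[[N _ sN] _] _]]]; split => //.
have /norm_integrable_simple si := sP N.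
have mfs : strongly_measurable (fun t => f t - simple_eval (s N) t).
  under eq_fun do rewrite -(scaleN1r (simple_eval _ _)).
  apply: strongly_measurableD => //.
  by apply: strongly_measurable_cstZ; case: si.
have fsi : norm_integrable (fun t => f t - simple_eval (s N) t).
  split => //; have := sN N (leqnn N); rewrite ge0_fin_numE//.
  exact: integral_ge0.
have := integrableD measurableT (norm_integrable_norm fsi) (norm_integrable_norm si).
move=> /integrableP[mps]; apply: le_lt_trans; apply: ge0_le_integral => //.
- by apply/measurable_EFinP; exact: strongly_measurable_norm.
- exact: measurableT_comp.
- move=> t _ /=; rewrite lee_fin -[X in `|X|](subrK (simple_eval (s N) t)).
  by rewrite (le_trans (ler_normD _ _))// ler_norm.
Qed.

Lemma bochner_inner f y h : is_bochner_integral mu f y ->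
  inner y h = \int[mu]_t (inner (f t) h).
Proof.
move=> fy; have fi := bochner_integrable fy.
have [z zE] := norm_integrable_pettis fi.
case: fy => _ [s [sP s0 sy]].
have sz := cvg_bochner fi zE sP s0.
have -> : y = z by apply: (cvg_unique _ sy sz).
exact: zE.
Qed.

(** The approximating simple functions of f are cut off where they exceed
    2|f|, for domination, and where |f| is small, to have finite measure. *)
Lemma is_bochner_integralP f y : norm_integrable f ->
  (forall h, inner y h = \int[mu]_t (inner (f t) h)) ->
  is_bochner_integral mu f y.
Proof.
move=> fi yE; have [mf foo] := fi; split => //.
have [s ms sf] := mf.
have mn := strongly_measurable_norm mf.
have mD n : measurable [set t | (n.+1%:R)^-1 <= `|f t|].
  rewrite -[X in measurable X]setTI.
  by apply: measurable_fun_le => //; exact: measurable_cst.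
pose B n := [set t | (n.+1%:R)^-1 <= `|f t|] `&`
            [set t | `|simple_eval (s n) t| <= 2 * `|f t|].
have mB n : measurable (B n).
  apply: measurableI => //.
  rewrite -[X in measurable X]setTI; apply: measurable_fun_le => //.
    exact/strongly_measurable_norm/strongly_measurable_simple/ms.
  by apply: measurable_funM => //; exact: measurable_cst.
have fB n : (mu (B n) < +oo)%E.
  have : (mu (B n) <= \int[mu]_t ((n.+1%:R * `|f t|)%:E))%E.
    rewrite -(setIT (B n)) -integral_indic//; apply: ge0_le_integral => //.
    - by apply/measurable_EFinP; exact: measurable_indic.
    - by apply/measurable_EFinP; apply: measurable_funM => //; exact: measurable_cst.
    - move=> t _; rewrite lee_fin indicE; case: (boolP (t \in B n)) => /=.
        rewrite inE => -[/= + _]; rewrite -ler_pdivrMl// mulr1//.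
      by move=> _; rewrite mulr_ge0.
  move=> /le_lt_trans; apply.
  under eq_integral do rewrite EFinM.
  rewrite ge0_integralZl//; first exact: lte_mul_pinfty.
  by apply/measurable_EFinP; exact: mn.
pose s' n := simple_mul [:: (B n, 1 : R)] (s n).
have s'E n t : simple_eval (s' n) t = (\1_(B n) t : R) *: simple_eval (s n) t.
  by rewrite simple_eval_mul big_seq1 /= mulr1.
have s'P n : finite_simple (s' n).
  move=> z /allpairsP[[p q] [/= + qs ->]]; rewrite inE => /eqP -> /=.
  have mq := ms n q qs.
  split; first exact: measurableI.
  apply: le_lt_trans (fB n); apply: le_measure; rewrite ?inE//.
  exact: measurableI.
have s'f n t : `|simple_eval (s' n) t| <= 2 * `|f t|.
  rewrite s'E indicE; case: (boolP (t \in B n)) => [|_].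
    by rewrite inE => -[_ /=]; rewrite scale1r.
  by rewrite scale0r normr0 mulr_ge0.
have s'_cvg t : simple_eval (s' n) t @[n --> \oo] --> f t.
  have [f0|f0] := eqVneq (f t) 0.
    suff -> : (fun n => simple_eval (s' n) t) = cst (f t) by exact: cvg_cst.
    apply/funext => n; apply/eqP; rewrite /= f0 -normr_le0.
    by have := s'f n t; rewrite f0 normr0 mulr0.
  have fp : 0 < `|f t| by rewrite normr_gt0.
  apply: cvg_trans (sf t); apply: near_eq_cvg; near=> n.
  rewrite s'E indicE mem_set ?scale1r//; split => /=.
    near: n; have /cvgrPdist_le/(_ _ fp) := @cvg_harmonic R.
    by apply: filterS => n /=; rewrite sub0r normrN ger0_norm.
  near: n; have /cvg_norm/cvgrPdist_le/(_ _ fp) := sf t.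
  apply: filterS => n /=; rewrite distrC => /(le_trans (ler_norm _)).
  by rewrite lerBlDr mulr2n mulrDl mul1r.
have s0 : (\int[mu]_t (`|f t - simple_eval (s' n) t|%:E))%E @[n --> \oo] --> 0%E.
  have -> : 0%E = (\int[mu]_t (cst 0 t : \bar R))%E by rewrite integral0.
  apply: (@dominated_cvg _ _ _ mu _ measurableT _ _
    (fun t => (3 * `|f t|)%:E)) => //.
  - move=> n; apply/measurable_EFinP/strongly_measurable_norm.
    under eq_fun do rewrite -(scaleN1r (simple_eval _ _)).
    apply: strongly_measurableD => //; apply: strongly_measurable_cstZ.
    exact/strongly_measurable_simple/finite_simpleW.
  - move=> t _; apply/fine_cvgP; split; first exact: nearW.
    have : (f t - simple_eval (s' n) t) @[n --> \oo] --> f t - f t.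
      by apply: cvgB; [exact: cvg_cst|exact: s'_cvg].
    by move=> /cvg_norm; rewrite subrr normr0.
  - have := integrableZr measurableT 3 (norm_integrable_norm fi).
    by apply: eq_integrable => // t _ /=; rewrite -EFinM mulrC.
  - move=> n t _ /=; rewrite lee_fin normr_id (le_trans (ler_normB _ _))//.
    have := s'f n t; lra.
exists s'; split => [n||]; [exact: s'P|exact: s0|exact: cvg_bochner s0].
Unshelve. all: by end_near. Qed.

End bochner_theory.

(** * Integrals over the segments of the line *)

Section line.
Context (R : realType).
Local Notation mu := (@lebesgue_measure R).
Implicit Types (f g : R -> R) (a b c x y z : R).

Definition loc_int f :=
  measurable_fun [set: R] f /\ forall a b, mu.-integrable `[a, b] (EFin \o f).

Definition itg f a b : R := \int[mu]_(t in `[a, b]) f t.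

Let mitv a b : measurable (`[a, b]%classic : set (measurableTypeR R)).
Proof. exact: measurable_itv. Qed.

Lemma loc_int_continuous f : continuous f -> loc_int f.
Proof.
move=> cf; split; first exact: continuous_measurable_fun.
move=> a b; apply: continuous_compact_integrable; first exact: segment_compact.
exact: continuous_subspaceT.
Qed.

Lemma loc_int_cst c : loc_int (cst c).
Proof. by apply: loc_int_continuous => x; exact: cvg_cst. Qed.

Lemma loc_intD f g : loc_int f -> loc_int g -> loc_int (fun t => f t + g t).
Proof.
move=> [mf fi] [mg gi]; split; first exact: measurable_funD.
move=> a b; have := integrableD (mitv a b) (fi a b) (gi a b).
by apply: eq_integrable => // t _ /=; rewrite EFinD.
Qed.

Lemma loc_intZ c f : loc_int f -> loc_int (fun t => c * f t).
Proof.
move=> [mf fi]; split; first by apply: measurable_funM => //; exact: measurable_cst.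
move=> a b; have := integrableZl (mitv a b) c (fi a b).
by apply: eq_integrable => // t _ /=; rewrite EFinM.
Qed.

Lemma loc_intN f : loc_int f -> loc_int (fun t => - f t).
Proof. by move=> /(loc_intZ (-1)); under eq_fun do rewrite mulN1r. Qed.

Lemma loc_intB f g : loc_int f -> loc_int g -> loc_int (fun t => f t - g t).
Proof. by move=> fi gi; apply: loc_intD => //; exact: loc_intN. Qed.

Lemma loc_int_le f g : measurable_fun [set: R] f ->
  (forall t, `|f t| <= g t) -> loc_int g -> loc_int f.
Proof.
move=> mf fg [mg gi]; split => // a b; apply: le_integrable (gi a b) => //.
  by apply/measurable_EFinP; exact: measurable_funTS.
by move=> t _ /=; rewrite lee_fin (le_trans (fg t))// ler_norm.
Qed.

Lemma loc_int_norm f : loc_int f -> loc_int (fun t => `|f t|).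
Proof.
move=> [mf fi]; split; first exact: measurableT_comp.
by move=> a b; exact: integrable_norm (fi a b).
Qed.

Lemma loc_int_indic f (A : set R) : measurable A -> loc_int f ->
  loc_int (fun t => \1_A t * f t).
Proof.
move=> mA fi; apply: (@loc_int_le _ (fun t => `|f t|)).
- by apply: measurable_funM; [exact: measurable_indic|case: fi].
- move=> t; rewrite normrM indicE; case: (t \in A).
    by rewrite normr1 mul1r.
  by rewrite normr0 mul0r.
- exact: loc_int_norm.
Qed.

(** A continuous factor is bounded on every segment. *)
Lemma loc_intM f g : continuous f -> loc_int g -> loc_int (fun t => f t * g t).
Proof.
move=> cf [mg gi]; split.
  by apply: measurable_funM => //; exact: continuous_measurable_fun.
move=> a b; have [ab|ba] := leP a b; last first.
  by rewrite set_itv_ge ?bnd_simp -?ltNge//; exact: integrable_set0.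
have cfn : {within `[a, b], continuous (fun t => `|f t|)}.
  apply: continuous_subspaceT => t.
  by apply: cvg_norm; exact: cf.
have [c _ fc] := EVT_max ab cfn.
have := integrableZl (mitv a b) `|f c| (gi a b).
apply: le_integrable => //.
  apply/measurable_EFinP; apply: measurable_funTS.
  by apply: measurable_funM => //; exact: continuous_measurable_fun.
move=> t tab /=; rewrite lee_fin !normrM normr_id ler_wpM2r//.
exact: fc.
Qed.

Lemma itgD f g a b : loc_int f -> loc_int g ->
  itg (fun t => f t + g t) a b = itg f a b + itg g a b.
Proof. by move=> [_ fi] [_ gi]; exact: RintegralD. Qed.

Lemma itgB f g a b : loc_int f -> loc_int g ->
  itg (fun t => f t - g t) a b = itg f a b - itg g a b.
Proof. by move=> [_ fi] [_ gi]; exact: RintegralB. Qed.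

Lemma itgZ f c a b : loc_int f -> itg (fun t => c * f t) a b = c * itg f a b.
Proof. by move=> [_ fi]; exact: RintegralZl. Qed.

Lemma itg_cst c a b : a <= b -> itg (fun=> c) a b = c * (b - a).
Proof.
move=> ab; rewrite /itg Rintegral_cst//= lebesgue_measure_itv/= lte_fin.
by move: ab; rewrite le_eqVlt => /predU1P[->|->]//; rewrite ltxx subrr.
Qed.

Lemma itg_ge0 f a b : (forall t, a <= t <= b -> 0 <= f t) -> 0 <= itg f a b.
Proof. by move=> f0; apply: Rintegral_ge0 => t /=; rewrite in_itv/=; exact: f0. Qed.

Lemma itg_le f g a b : loc_int f -> loc_int g ->
  (forall t, a <= t <= b -> f t <= g t) -> itg f a b <= itg g a b.
Proof.
move=> [_ fi] [_ gi] fg; by apply: le_Rintegral => // t /=; rewrite in_itv/=; exact: fg.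
Qed.

Lemma itg_norm f a b : loc_int f -> `|itg f a b| <= itg (fun t => `|f t|) a b.
Proof. by move=> [_ fi]; exact: le_normr_Rintegral. Qed.

Lemma itgxx f a : itg f a a = 0.
Proof. by rewrite /itg set_itv1 Rintegral_set1. Qed.

Lemma itg_split f a b c : loc_int f -> a <= b -> b <= c ->
  itg f a c = itg f a b + itg f b c.
Proof.
move=> [_ fi] ab bc; have := @Rintegral_itvB _ f (BLeft a) (BRight c) b (fi a c).
rewrite !bnd_simp => /(_ ab bc) /eqP; rewrite subr_eq => /eqP.
rewrite [X in _ = X + _]Rintegral_itv_obnd_cbnd; first by rewrite addrC.
apply: integrableS (fi a c) => //.
by move=> t /=; rewrite !in_itv/= => /andP[bt ->]; rewrite (le_trans ab) ?ltW.
Qed.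

Lemma itg_le_sub f a b c d : loc_int f -> (forall t, 0 <= f t) ->
  a <= b -> b <= c -> c <= d -> itg f b c <= itg f a d.
Proof.
move=> fi f0 ab bc cd; rewrite (itg_split fi (le_trans ab bc) cd).
rewrite (itg_split fi ab bc).
have := @itg_ge0 f a b (fun t _ => f0 t); have := @itg_ge0 f c d (fun t _ => f0 t).
lra.
Qed.

Lemma eq_itg f g a b : loc_int f -> loc_int g ->
  (forall t, a < t < b -> f t = g t) -> itg f a b = itg g a b.
Proof.
move=> [_ fi] [_ gi] fg.
have oo (h : R -> R) : (forall a b, mu.-integrable `[a, b] (EFin \o h)) ->
    itg h a b = \int[mu]_(t in `]a, b[) h t.
  move=> hi; rewrite Rintegral_itv_bndo_bndc.
    rewrite Rintegral_itv_obnd_cbnd//; apply: integrableS (hi a b) => //.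
    exact: subset_itv_oc_cc.
  by apply: integrableS (hi a b) => //; exact: subset_itv_oo_cc.
rewrite !oo//; apply: eq_Rintegral => t; rewrite inE/= in_itv/=; exact: fg.
Qed.

Lemma Rintegral_support f a b : (forall t, ~ (a <= t <= b) -> f t = 0) ->
  \int[mu]_t f t = itg f a b.
Proof.
move=> f0; rewrite [RHS]Rintegral_mkcond; congr (Rintegral _ _ _).
apply/funext => t; rewrite patchE; case: ifPn => //; rewrite notin_setE/= in_itv/=.
exact: f0.
Qed.

Lemma continuous_unif (E : normedModType R) (f : R -> E) a b e :
  continuous f -> 0 < e ->
  exists2 d, 0 < d & forall s t, a <= s <= b -> `|s - t| <= d -> `|f s - f t| <= e.
Proof.
move=> cf e0.
have /compact_near_coveringP/(_ R 0^'+ (fun d s => forall t, `|s - t| <= d ->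
    `|f s - f t| <= e)) : compact `[a, b] by exact: segment_compact.
case=> [s _|d /= d0 dP].
  have e20 : 0 < e / 2 by rewrite divr_gt0.
  have /cvgrPdist_le/(_ _ e20) := cf s => -[r /= r0 rP].
  have r20 : 0 < r / 2 by rewrite divr_gt0.
  near=> s' d => /= t st.
  have s's : `|s - s'| < r / 2 by near: s'; exact: cvgr_dist_lt.
  have dr : d < r / 2 by near: d; exact: nbhs_right_lt.
  have -> : f s' - f t = (f s - f t) - (f s - f s').
    by rewrite opprB [RHS]addrC addrA subrK.
  rewrite (le_trans (ler_normB _ _))// [leRHS]splitr lerD//; apply: rP => /=.
    rewrite -(subrK s' s) -addrA (le_lt_trans (ler_normD _ _))//.
    by rewrite [ltRHS]splitr ltrD// (le_lt_trans st).
  by rewrite (lt_trans s's)// ltr_pdivrMr// ltr_pMr// ltr1n.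
exists (d / 2); first by rewrite divr_gt0.
have d2 : ball_ [eta Num.Def.normr] 0 d (d / 2).
  by rewrite /= sub0r normrN gtr0_norm ?divr_gt0// ltr_pdivrMr// ltr_pMr// ltr1n.
by move=> s t sab; apply: dP => //; rewrite divr_gt0.
Unshelve. all: by end_near. Qed.

(** Cut [a, b] into intervals shorter than d. *)
Lemma additive_le (Psi m : R -> R -> R) a b d : 0 < d -> a <= b ->
  (forall x y z, a <= x -> x <= y -> y <= z -> z <= b ->
    Psi x z = Psi x y + Psi y z) ->
  (forall x y z, a <= x -> x <= y -> y <= z -> z <= b -> m x z = m x y + m y z) ->
  (forall x y, a <= x -> x <= y -> y <= b -> y <= x + d -> `|Psi x y| <= m x y) ->
  `|Psi a b| <= m a b.
Proof.
move=> d0 ab PsiD mD Psim.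
have step n : forall y, a <= y -> y <= b -> y <= a + n%:R * d ->
    `|Psi a y| <= m a y.
  elim: n => [|n IH] y ay yb yn.
    by apply: Psim => //; move: yn; rewrite mul0r addr0; lra.
  have [yd|yd] := leP y (a + d); first exact: Psim.
  have ax : a <= y - d by lra.
  have xy : y - d <= y by lra.
  rewrite (PsiD _ (y - d))// (mD _ (y - d))// (le_trans (ler_normD _ _))// lerD//.
    apply: IH => //; first lra.
    by move: yn; rewrite -natr1 mulrDl mul1r; lra.
  by apply: Psim => //; lra.
pose n := Num.bound ((b - a) / d).
apply: (step n) => //; rewrite -lerBlDl -ler_pdivrMr// ltW//.
by apply: archi_boundP; rewrite divr_ge0 ?subr_ge0// ltW.
Qed.

Lemma itg_derive1 (phi : R -> R) a b : (forall t, derivable phi t 1) ->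
  continuous (derive1 phi : R -> R) -> a <= b ->
  itg (derive1 phi) a b = phi b - phi a.
Proof.
move=> dphi cphi; rewrite le_eqVlt => /predU1P[->|ab]; first by rewrite itgxx subrr.
have cp : continuous phi.
  by move=> x; apply: differentiable_continuous; exact/derivable1_diffP.
rewrite /itg /Rintegral (@continuous_FTC2 _ _ phi)//.
- exact: continuous_subspaceT.
- split; first by move=> x _; exact: dphi.
    by apply: cvg_at_right_filter; exact: cp.
  by apply: cvg_at_left_filter; exact: cp.
Qed.

(** The defect is an additive interval function.  On a short interval phi and v
    are almost constant, so it is small compared to the integral of
    |g| + |phi'|. *)
Lemma itg_by_parts (v g phi : R -> R) a b : a <= b ->
  continuous v -> loc_int g -> (forall x y, x <= y -> v y - v x = itg g x y) ->
  (forall t, derivable phi t 1) -> continuous (derive1 phi : R -> R) ->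
  itg (fun t => phi t * g t) a b + itg (fun t => derive1 phi t * v t) a b =
  phi b * v b - phi a * v a.
Proof.
move=> ab cv gi vg dphi cphi.
have cp : continuous phi.
  by move=> x; apply: differentiable_continuous; exact/derivable1_diffP.
have pgi : loc_int (fun t => phi t * g t) by exact: loc_intM.
have dpi : loc_int (derive1 phi : R -> R) by exact: loc_int_continuous.
have pvi : loc_int (fun t => derive1 phi t * v t).
  by apply: loc_intM => //; exact: loc_int_continuous.
pose Psi x y := phi y * v y - phi x * v x -
  (itg (fun t => phi t * g t) x y + itg (fun t => derive1 phi t * v t) x y).
pose m x y := itg (fun t => `|g t| + `|derive1 phi t|) x y.
have mi : loc_int (fun t => `|g t| + `|derive1 phi t|).
  by apply: loc_intD; exact: loc_int_norm.
suff Psi_le e : 0 < e -> `|Psi a b| <= e * m a b.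
  have m0 : 0 <= m a b by apply: itg_ge0 => t _; rewrite addr_ge0.
  suff : `|Psi a b| <= 0.
    by rewrite normr_le0 subr_eq0 => /eqP.
  apply/ler_addgt0Pl => e e0; rewrite addr0.
  apply: (le_trans (Psi_le (e / (m a b + 1)) _)); first by rewrite divr_gt0// ltr_wpDl.
  by rewrite mulrAC ler_pdivrMr ?ltr_wpDl// ler_pM2l// lerDl ler01.
move=> e0.
have [d1 d10 phid] := @continuous_unif _ phi a b e cp e0.
have [d2 d20 vd] := @continuous_unif _ v a b e cv e0.
apply: (@additive_le Psi (fun x y => e * m x y) a b (Num.min d1 d2)) => //.
- by rewrite lt_min d10.
- move=> x y z _ xy yz _; rewrite /Psi (itg_split pgi xy yz) (itg_split pvi xy yz).
  by ring.
- by move=> x y z _ xy yz _; rewrite /m (itg_split mi xy yz) mulrDr.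
move=> x y ax xy yb; rewrite -lerBlDl le_min => /andP[xyd1 xyd2].
have i1 : loc_int (fun t => (phi y - phi t) * g t).
  by apply: loc_intM => // t; apply: cvgB; [exact: cvg_cst|exact: cp].
have i2 : loc_int (fun t => (v x - v t) * derive1 phi t).
  by apply: loc_intM => // t; apply: cvgB; [exact: cvg_cst|exact: cv].
have -> : Psi x y = itg (fun t => (phi y - phi t) * g t) x y +
                    itg (fun t => (v x - v t) * derive1 phi t) x y.
  have -> : (fun t => (phi y - phi t) * g t) =
      (fun t => phi y * g t - phi t * g t) by apply/funext => t; ring.
  have -> : (fun t => (v x - v t) * derive1 phi t) =
      (fun t => v x * derive1 phi t - derive1 phi t * v t).
    by apply/funext => t; ring.
  rewrite !itgB//; try exact: loc_intZ.
  by rewrite !itgZ// -vg// itg_derive1// /Psi; ring.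
rewrite (le_trans (ler_normD _ _))// /m itgD; try exact: loc_int_norm.
rewrite mulrDr lerD//.
- rewrite (le_trans (itg_norm _ _ i1))// -itgZ; last exact: loc_int_norm.
  apply: itg_le; [exact: loc_int_norm|exact/loc_intZ/loc_int_norm|].
  move=> t /andP[xt ty]; rewrite normrM ler_wpM2r//; apply: phid.
    by rewrite (le_trans ax)//= yb (le_trans xt ty).
  by rewrite ger0_norm; lra.
- rewrite (le_trans (itg_norm _ _ i2))// -itgZ; last exact: loc_int_norm.
  apply: itg_le; [exact: loc_int_norm|exact/loc_intZ/loc_int_norm|].
  move=> t /andP[xt ty]; rewrite normrM ler_wpM2r//; apply: vd.
    by rewrite ax/= (le_trans xy).
  by rewrite distrC ger0_norm; lra.
Qed.

(** ** Primitives, and functions with vanishing integrals *)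

Lemma primitive_exists g : loc_int g -> exists2 w : R -> R, continuous w &
  forall x y, x <= y -> w y - w x = itg g x y.
Proof.
move=> gi; pose w t := if 0 <= t then itg g 0 t else - itg g t 0.
have wE x y : x <= y -> w y - w x = itg g x y.
  move=> xy; rewrite /w; case: (leP 0 y) => y0; case: (leP 0 x) => x0.
  - by rewrite (itg_split gi x0 xy); ring.
  - by rewrite (itg_split gi (ltW x0) y0); ring.
  - lra.
  - by rewrite (itg_split gi xy (ltW y0)); ring.
exists w => // t.
have t1 : t - 1 < t + 1 by lra.
have cpi := @parameterized_integral_continuous R (t - 1) (t + 1) g (ltW t1) (gi.2 _ _).
have tin : t \in `]t - 1, t + 1[ by rewrite in_itv/=; apply/andP; split; lra.
have h : {for t, continuous (fun s => itg g (t - 1) s)}.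
  exact: (within_continuous_continuous t1 cpi tin).
have wE' s : t - 1 <= s -> w (t - 1) + itg g (t - 1) s = w s.
  by move=> /wE <-; rewrite addrC subrK.
have : {for t, continuous (fun s => w (t - 1) + itg g (t - 1) s)}.
  by apply: cvgD; [exact: cvg_cst|exact: h].
rewrite /prop_for /continuous_at wE'; last lra.
apply: cvg_trans; apply: near_eq_cvg; near=> s; apply: wE'.
by near: s; apply: filterS (lt_nbhsr (_ : t - 1 < t)) => [s /ltW//|]; lra.
Unshelve. all: by end_near. Qed.

(** Lebesgue's differentiation theorem. *)
Lemma itg0_ae f : loc_int f -> (forall x y, x <= y -> itg f x y = 0) ->
  {ae mu, forall t, f t = 0}.
Proof.
move=> fi f0.
have lf : locally_integrable [set: R] f.
  split; [by case: fi|exact: openT|move=> K _ cK].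
  have [M [_ KM]] := compact_bounded cK.
  have : mu.-integrable K (EFin \o f).
    apply: integrableS (fi.2 (- (M + 1)) (M + 1)) => //.
      exact: compact_measurable.
    move=> t Kt /=; rewrite in_itv/= -ler_norml.
    by apply: KM Kt; rewrite ltrDl.
  by move=> /integrableP[].
have : {ae mu, forall t, forall n : nat, - n%:R < t -> f t = 0}.
  apply/ae_foralln => n.
  have := FTC1 (fi.2 (- n%:R)) lf; apply: filterS; first exact: (ae_filter_ringOfSetsType mu).
  move=> t /= + nt.
  rewrite lte_fin => /(_ nt)[_ <-].
  have -> : (fun x => \int[mu]_(t in `[- n%:R, x]) f t) = cst 0.
    apply/funext => x /=; case: (leP (- n%:R) x) => [/f0//|nx].
    by rewrite set_itv_ge ?bnd_simp -?ltNge// Rintegral_set0.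
  by rewrite derive1_cst.
apply: filterS; first exact: (ae_filter_ringOfSetsType mu).
move=> t /(_ (Num.bound `|t|)); apply.
by rewrite ltrNl (le_lt_trans (ler_norm _))// normrN archi_boundP.
Qed.

End line.

(** * Vector-valued primitives and the Sobolev class *)

Section vector_line.
Context (R : realType) (H : hilbertType R).
Local Notation mu := (@lebesgue_measure R).
Local Notation smeas f := (strongly_measurable (f : measurableTypeR R -> H)).
Implicit Types (V F G : R -> H) (a b c x y z t : R) (h : H).

Let dcell_list (E : Type) n (u : R -> E) : seq (set R * E) :=
  [seq (`[a, a + dlen R n[%classic, u a) | a <- dcells R n].

Let dcell_listP (E : eqType) n (u : R -> E) :
  {in dcell_list n u, forall p,
    measurable (p.1 : set (measurableTypeR R))}.
Proof. by move=> p /mapP[a _ ->] /=; exact: measurable_itv. Qed.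

Let dcell_cvg (E : normedModType R) (u : R -> E) t : continuous u ->
  \sum_(a <- dcells R n) (\1_(`[a, a + dlen R n[%classic) t : R) *: u a
    @[n --> \oo] --> u t.
Proof.
move=> cu; have : u (dleft n t) @[n --> \oo] --> u t.
  by apply: continuous_cvg; [exact: cu|exact: dleft_cvg].
apply: cvg_trans; apply: near_eq_cvg; near=> n; rewrite big_dcells//.
have : `|t| < n%:R by near: n; exact: nbhs_infty_gtr.
by rewrite ltr_norml => /andP[/ltW -> ->].
Unshelve. all: by end_near. Qed.

Lemma continuous_strongly_measurable V : continuous V -> smeas V.
Proof.
move=> cV; exists (fun n => dcell_list n V) => [n|t]; first exact: dcell_listP.
by rewrite /simple_eval; under eq_fun do rewrite big_map; exact: dcell_cvg.
Qed.

Lemma strongly_measurable_contZ (phi : R -> R) G : continuous phi -> smeas G ->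
  smeas (fun t => phi t *: G t).
Proof.
move=> cphi; apply: (@strongly_measurableZ _ _ _ _ (fun n => dcell_list n phi)).
  by move=> n; exact: dcell_listP.
by move=> t; under eq_fun do rewrite big_map; exact: (@dcell_cvg R^o).
Qed.

(** ** Locally square integrable functions *)

Lemma loc_int_sqr G : L2loc G -> loc_int (fun t => `|G t| ^+ 2).
Proof.
move=> [mG G2]; have mn := strongly_measurable_sqr_norm mG.
split => // a b; apply/integrableP; split.
  by apply/measurable_EFinP; exact: measurable_funTS.
by under eq_integral do rewrite /= ger0_norm ?sqr_ge0//; exact: G2.
Qed.

Lemma loc_int_normL2 G : L2loc G -> loc_int (fun t => `|G t|).
Proof.
move=> G2; apply: (@loc_int_le _ _ (fun t => 1 + `|G t| ^+ 2)).
- by apply: strongly_measurable_norm; case: G2.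
- move=> t; rewrite normr_id; have := sqr_ge0 (`|G t| - 1); nra.
- by apply: loc_intD; [exact: loc_int_cst|exact: loc_int_sqr].
Qed.

Lemma loc_int_inner G h : L2loc G -> loc_int (fun t => inner (G t) h).
Proof.
move=> G2; apply: (@loc_int_le _ _ (fun t => `|h| * `|G t|)).
- by apply: strongly_measurable_innerl; case: G2.
- by move=> t; rewrite mulrC; exact: abs_inner_le.
- exact/loc_intZ/loc_int_normL2.
Qed.

Lemma L2locP G : smeas G -> loc_int (fun t => `|G t| ^+ 2) -> L2loc G.
Proof.
move=> mG [_ Gi]; split => // a b; move/integrableP: (Gi a b) => [_].
by under eq_integral do rewrite /= ger0_norm ?sqr_ge0//.
Qed.

Lemma L2locD F G : L2loc F -> L2loc G -> L2loc (fun t => F t + G t).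
Proof.
move=> F2 G2; have m : smeas (fun t => F t + G t).
  by apply: strongly_measurableD; [case: F2|case: G2].
apply: L2locP => //.
apply: (@loc_int_le _ _ (fun t => 2 * (`|F t| ^+ 2 + `|G t| ^+ 2))).
- exact: strongly_measurable_sqr_norm.
- move=> t; rewrite ger0_norm ?sqr_ge0// normD_sqr.
  have := sqr_ge0 `|F t - G t|; rewrite normB_sqr; lra.
- by apply: loc_intZ; apply: loc_intD; exact: loc_int_sqr.
Qed.

Lemma L2locZ c G : L2loc G -> L2loc (fun t => c *: G t).
Proof.
move=> G2; have m : smeas (fun t => c *: G t).
  by apply: strongly_measurable_cstZ; case: G2.
apply: L2locP => //; under eq_fun do rewrite normrZ exprMn.
exact/loc_intZ/loc_int_sqr.
Qed.

Lemma L2locB F G : L2loc F -> L2loc G -> L2loc (fun t => F t - G t).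
Proof.
move=> F2 G2; under eq_fun do rewrite -(scaleN1r (G _)).
by apply: L2locD => //; exact: L2locZ.
Qed.

Lemma L2loc_continuous V : continuous V -> L2loc V.
Proof.
move=> cV; apply: L2locP; first exact: continuous_strongly_measurable.
by apply: loc_int_continuous => t; apply: cvg_sqr_norm; exact: cV.
Qed.

Lemma L2loc_restrict (A : set R) G : measurable A -> L2loc G ->
  L2loc (fun t => (\1_A t : R) *: G t).
Proof.
move=> mA G2; apply: L2locP.
  by apply: (@strongly_measurable_restrict _ (measurableTypeR R)) => //; case: G2.
have -> : (fun t => `|(\1_A t : R) *: G t| ^+ 2) =
    (fun t => \1_A t * `|G t| ^+ 2).
  apply/funext => t; rewrite normrZ exprMn indicE.
  by case: (t \in A); rewrite ?normr1 ?expr1n// normr0 expr0n.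
by apply: loc_int_indic => //; exact: loc_int_sqr.
Qed.

(** The quadratic identity behind both the energy bounds and the martingale
    property of difference quotients. *)
Lemma itg_sqrB G h a b : L2loc G -> a <= b ->
  itg (fun t => `|G t - h| ^+ 2) a b =
  itg (fun t => `|G t| ^+ 2) a b - 2 * itg (fun t => inner (G t) h) a b +
  (b - a) * `|h| ^+ 2.
Proof.
move=> G2 ab; under eq_fun do rewrite normB_sqr.
have iG := loc_int_sqr G2; have ih := loc_int_inner h G2.
have i2 := loc_intZ 2 ih.
have i3 := loc_intB iG i2; have i4 := @loc_int_cst R (`|h| ^+ 2).
by rewrite (itgD _ _ i3 i4) (itgB _ _ iG i2) (itgZ _ _ _ ih) itg_cst// [`|h| ^+ 2 * _]mulrC.
Qed.

(** ** Primitives *)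

(** V is the indefinite integral of G, tested against vectors.  H1loc V amounts
    to the existence of such a G, which is then the weak derivative of V almost
    everywhere: see prim_H1loc, weak_derivP and weak_deriv_ae. *)
Definition prim V G := [/\ continuous V, L2loc G &
  forall a b h, a <= b -> inner (V b - V a) h = itg (fun t => inner (G t) h) a b].

Lemma prim_chord V G a b : prim V G -> a <= b ->
  `|V b - V a| ^+ 2 <= (b - a) * itg (fun t => `|G t| ^+ 2) a b.
Proof.
move=> [_ G2 VG]; rewrite le_eqVlt => /predU1P[->|ab].
  by rewrite !subrr mul0r normr0 expr0n.
have ba : 0 < b - a by rewrite subr_gt0.
pose k := (b - a)^-1 *: (V b - V a).
have : 0 <= itg (fun t => `|G t - k| ^+ 2) a b by apply: itg_ge0 => t _; exact: sqr_ge0.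
rewrite (itg_sqrB _ G2 (ltW ab)) -(VG a b k (ltW ab)) innerZr inner_norm normrZ exprMn.
rewrite [`|(b - a)^-1|]gtr0_norm ?invr_gt0//.
set K := itg _ _ _; set q := `|_| ^+ 2.
have -> : K - 2 * ((b - a)^-1 * q) + (b - a) * ((b - a)^-1 ^+ 2 * q) =
    K - (b - a)^-1 * q by field; exact: lt0r_neq0.
by rewrite subr_ge0 ler_pdivrMl.
Qed.

Lemma test_function_derive1 (phi : R -> R) M : (forall t, M < `|t| -> phi t = 0) ->
  forall t, M < `|t| -> derive1 phi t = 0.
Proof.
move=> phi0 t Mt; rewrite derive1E (@near_eq_derive _ _ _ phi (cst 0)).
  exact: derive_cst.
have : \forall s \near t, M < `|s|.
  have h : (fun s : R => `|s|) @ t --> `|t| by apply: cvg_norm; exact: cvg_id.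
  exact: (cvgr_gt _ h _ Mt).
by apply: filterS => s /phi0.
Qed.

Lemma test_function_support (phi : R -> R) M : (forall t, M < `|t| -> phi t = 0) ->
  forall t, ~ (- (`|M| + 1) <= t <= `|M| + 1) -> M < `|t|.
Proof.
move=> phi0 t /negP; rewrite -ler_norml -ltNge.
by have := ler_norm M; lra.
Qed.

Lemma norm_integrable_support F a b : smeas F ->
  loc_int (fun t => `|F t|) -> (forall t, ~ (a <= t <= b) -> F t = 0) ->
  norm_integrable mu F.
Proof.
move=> mF [_ Fi] F0; split => //.
have -> : (\int[mu]_t (`|F t|%:E) = \int[mu]_(t in `[a, b]) (`|F t|%:E))%E.
  rewrite [RHS]integral_mkcond; apply: eq_integral => t _.
  rewrite patchE; case: ifPn => //; rewrite notin_setE/= in_itv/= => /F0 ->.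
  by rewrite normr0.
move/integrableP: (Fi a b) => [_].
by under eq_integral do rewrite /= normr_id.
Qed.

Lemma loc_int_normZ (phi : R -> R) G : continuous phi -> L2loc G ->
  loc_int (fun t => `|phi t *: G t|).
Proof.
move=> cphi G2; under eq_fun do rewrite normrZ.
apply: loc_intM; last exact: loc_int_normL2.
by move=> t; apply: cvg_norm; exact: cphi.
Qed.

(** Integration by parts in each coordinate; Bochner integrability comes from
    the compact support of phi. *)
Lemma prim_weak_derivative V G : prim V G -> is_weak_derivative V G.
Proof.
move=> [cV G2 VG] phi [dphi cphi [M phi0]].
have cp : continuous phi.
  by move=> x; apply: differentiable_continuous; exact/derivable1_diffP.
have dphi0 := test_function_derive1 phi0.
have supp := test_function_support phi0.
set N := `|M| + 1; have N0 : 0 <= N by rewrite addr_ge0.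
have V2 := L2loc_continuous cV.
have i1 : norm_integrable mu (fun t => derive1 phi t *: V t).
  apply: (@norm_integrable_support _ (- N) N).
  - by apply: strongly_measurable_contZ => //; case: V2.
  - exact: loc_int_normZ.
  - by move=> t /supp/dphi0 ->; rewrite scale0r.
have i2 : norm_integrable mu (fun t => phi t *: G t).
  apply: (@norm_integrable_support _ (- N) N).
  - by apply: strongly_measurable_contZ => //; case: G2.
  - exact: loc_int_normZ.
  - by move=> t /supp/phi0 ->; rewrite scale0r.
have [y yE] := norm_integrable_pettis i1.
have [z zE] := norm_integrable_pettis i2.
exists y; apply: is_bochner_integralP => // h.
have NN : - N <= N by lra.
have := @itg_by_parts R (fun t => inner (V t) h) (fun t => inner (G t) h) phi
  (- N) N NN _ (loc_int_inner h G2) _ dphi cphi.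
have -> : phi N = 0 by apply: phi0; rewrite ger0_norm// /N; have := ler_norm M; lra.
have -> : phi (- N) = 0.
  by apply: phi0; rewrite normrN ger0_norm// /N; have := ler_norm M; lra.
rewrite !mul0r subrr => ibp.
rewrite innerNl yE (@Rintegral_support _ _ (- N) N); last first.
  by move=> t /supp/dphi0 ->; rewrite scale0r inner0l.
rewrite (@Rintegral_support _ _ (- N) N); last first.
  by move=> t /supp/phi0 ->; rewrite scale0r inner0l.
under [in RHS]eq_fun do rewrite innerZl.
under [in LHS]eq_fun do rewrite innerZl.
apply/eqP; rewrite eqr_oppLR -addr_eq0 addrC; apply/eqP; rewrite addrC.
rewrite addrC ibp//.
- by move=> t; apply: innerl_cvg; exact: cV.
- by move=> x y' xy; rewrite -innerBl VG.
Qed.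

Lemma prim_H1loc V G : prim V G -> H1loc V.
Proof.
move=> VG; have [cV G2 _] := VG; split => //; first exact: L2loc_continuous.
by exists G => //; exact: prim_weak_derivative.
Qed.

End vector_line.

Section du_bois_reymond.
Context (R : realType).
Local Notation mu := (@lebesgue_measure R).

Lemma derive1_increment (E : normedModType R) (V : R -> E) (k : E) (t : R) :
  (forall e, 0 < e -> exists2 d, 0 < d & forall x y, t - d <= x -> x <= y ->
    y <= t + d -> `|V y - V x - (y - x) *: k| <= e * (y - x)) ->
  derivable V t 1 /\ derive1 V t = k.
Proof.
move=> Vk.
have Vcvg : (fun h : R => h^-1 *: ((V \o shift t) (h *: 1) - V t)) @ 0^' --> k.
  apply/cvgrPdist_le => e e0; have [d d0 dP] := Vk e e0.
  near=> h; have h0 : h != 0 by near: h; exact: nbhs_dnbhs_neq.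
  have hd : `|h| < d.
    by near: h; exact: dnbhs0_lt.
  have hn : 0 < `|h| by rewrite normr_gt0.
  rewrite -(ler_pM2l hn) -normrZ scalerBr scalerA mulfV// scale1r.
  rewrite /= [h *: 1]mulr1 distrC.
  move: hd; rewrite ltr_norml => /andP[hd1 hd2].
  have [hp|hp] := leP 0 h.
    have := dP t (h + t); rewrite addrK ger0_norm// mulrC; apply; lra.
  have := dP (h + t) t.
  have -> : t - (h + t) = - h by ring.
  rewrite scaleNr opprK -normrN opprD opprB ltr0_norm// mulrC; apply; lra.
split; first exact: (cvgP k).
by rewrite derive1E; exact: (cvg_lim _ Vcvg).
Unshelve. all: by end_near. Qed.

Lemma derive1_primitive (w g : R -> R) (t : R) : continuous g ->
  (forall x y, x <= y -> w y - w x = itg g x y) ->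
  derivable w t 1 /\ derive1 w t = g t.
Proof.
move=> cg wg; apply: derive1_increment => e e0.
have [d d0 dP] := @continuous_unif _ _ g t t e cg e0.
exists d => // x y tx xy yt; rewrite wg//.
have gi := loc_int_continuous cg.
have gti : loc_int (fun=> g t) by exact: loc_int_cst.
have -> : (y - x) *: g t = itg (fun=> g t) x y by rewrite itg_cst// mulrC.
rewrite -itgB// (le_trans (itg_norm _ _ (loc_intB gi gti)))//.
rewrite -itg_cst//; apply: itg_le; [|exact: loc_int_cst|].
  by apply: loc_int_norm; exact: loc_intB.
move=> s /andP[xs sy]; rewrite distrC; apply: dP; first by rewrite lexx.
by rewrite ler_norml; apply/andP; split; lra.
Qed.

Lemma test_function_primitive (rho : R -> R) a b : continuous rho -> a <= b ->
  (forall t, ~ (a <= t <= b) -> rho t = 0) -> itg rho a b = 0 ->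
  exists2 phi, test_function phi & derive1 phi = rho.
Proof.
move=> crho ab rho0 irho.
have ri := loc_int_continuous crho.
have [w _ wE] := primitive_exists ri.
pose phi t := w t - w a.
have phiE x y : x <= y -> phi y - phi x = itg rho x y.
  by move=> xy; rewrite -wE// /phi; ring.
have dphi t := derive1_primitive t crho phiE.
have dE : derive1 phi = rho by apply/funext => t; have [] := dphi t.
exists phi => //; split; [by move=> t; have [] := dphi t|by rewrite dE|].
have zero x y : x <= y -> (forall t, x < t < y -> rho t = 0) -> itg rho x y = 0.
  move=> xy z; rewrite (@eq_itg _ _ (cst 0))//; last exact: loc_int_cst.
  by rewrite itg_cst// mul0r.
exists (`|a| + `|b|) => t abt; have [ta|ta] := leP t a.
  apply/eqP; rewrite /phi -oppr_eq0 opprB; apply/eqP; rewrite wE//.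
  by apply: zero => // s /andP[ts sa]; apply: rho0; lra.
have [tb|bt] := leP t b.
  have a1 := ler_norm (- a); have b1 := ler_norm b; rewrite normrN in a1.
  have a2 := normr_ge0 a; have b2 := normr_ge0 b.
  suff : `|t| <= `|a| + `|b| by rewrite leNgt abt.
  by rewrite ler_norml; apply/andP; split; lra.
rewrite /phi wE ?ltW// (itg_split ri ab (ltW bt)) irho add0r.
by apply: zero => [|s /andP[bs st]]; [exact: ltW|apply: rho0; lra].
Qed.

(** Tents play the role of mollifiers. *)
Definition tent (c eta t : R) : R := Num.max 0 (eta - `|t - c|).

Lemma tent_continuous c eta : continuous (tent c eta).
Proof.
have cu : continuous (fun t => eta - `|t - c|).
  move=> t; apply: cvgB; first exact: cvg_cst.
  by apply: cvg_norm; apply: cvgB; [exact: cvg_id|exact: cvg_cst].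
have -> : tent c eta = (fun t => (eta - `|t - c| + `|eta - `|t - c| |) / 2).
  by apply/funext => t; rewrite /tent maxr_absE add0r sub0r normrN.
by move=> t; apply: cvgMr_tmp; apply: cvgD; [|apply: cvg_norm]; exact: cu.
Qed.

Lemma tent_ge0 c eta t : 0 <= tent c eta t.
Proof. by rewrite /tent le_max lexx. Qed.

Lemma tent_out c eta t : eta <= `|t - c| -> tent c eta t = 0.
Proof. by move=> h; apply/max_idPl; rewrite subr_le0. Qed.

Lemma tent_average (z : R -> R) c eta e a b : continuous z -> 0 < eta ->
  (forall t, `|t - c| <= eta -> `|z c - z t| <= e) ->
  a <= c - eta -> c + eta <= b ->
  0 < itg (tent c eta) a b /\
  `|(itg (tent c eta) a b)^-1 * itg (fun t => tent c eta t * z t) a b - z c| <= e.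
Proof.
move=> cz eta0 ze ac cb; have ct := @tent_continuous c eta.
have ti := loc_int_continuous ct; have zi := loc_int_continuous cz.
set A := itg (tent c eta) a b.
have A0 : 0 < A.
  have : itg (tent c eta) (c - eta / 2) (c + eta / 2) <= A.
    by apply: itg_le_sub => //; first exact: tent_ge0; lra.
  apply: lt_le_trans.
  have : itg (fun=> eta / 2) (c - eta / 2) (c + eta / 2) <=
         itg (tent c eta) (c - eta / 2) (c + eta / 2).
    apply: itg_le => //; first exact: loc_int_cst.
    move=> t tc; rewrite /tent le_max; apply/orP; right.
    rewrite lerBrDr -lerBrDl ler_norml; lra.
  by apply: lt_le_trans; rewrite itg_cst; [nra|lra].
split => //; rewrite -(ler_pM2l A0) -[X in X * `|_|](gtr0_norm A0) -normrM.
rewrite mulrBr mulrA mulfV ?gt_eqF// mul1r.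
have tzi : loc_int (fun t => tent c eta t * z t) by exact: loc_intM.
rewrite [A * z c]mulrC -itgZ// -itgB//; last exact: loc_intZ.
rewrite (le_trans (itg_norm _ _ _))//; first by apply: loc_intB => //; exact: loc_intZ.
rewrite mulrC -itgZ//; apply: itg_le.
- by apply: loc_int_norm; apply: loc_intB => //; exact: loc_intZ.
- exact: loc_intZ.
- move=> t _; have [tc|tc] := leP (`|t - c|) eta.
    have -> : tent c eta t * z t - z c * tent c eta t =
      tent c eta t * (z t - z c) by ring.
    rewrite normrM (ger0_norm (tent_ge0 _ _ _)) [leRHS]mulrC distrC.
    by rewrite ler_wpM2l ?tent_ge0// ze.
  by rewrite (tent_out (ltW tc)) !(mul0r, mulr0, subrr, normr0).
Qed.

(** The difference of two normalized narrow tents around a and b has mean zero,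
    so it is the derivative of a test function; its integral against z is close
    to z a - z b. *)
Lemma du_bois_reymond (z : R -> R) : continuous z ->
  (forall phi, test_function phi -> \int[mu]_t (derive1 phi t * z t) = 0) ->
  forall a b, z a = z b.
Proof.
move=> cz z0 a b; apply/eqP; rewrite -subr_eq0 -normr_le0.
apply/ler_addgt0Pl => e e0; rewrite addr0.
have e2 : 0 < e / 2 by rewrite divr_gt0.
have near_ c : exists2 eta, 0 < eta &
    forall t, `|t - c| <= eta -> `|z c - z t| <= e / 2.
  have [eta eta0 etaP] := @continuous_unif _ _ z c c _ cz e2.
  by exists eta => // t tc; apply: etaP; [rewrite lexx|rewrite distrC].
have [eta1 eta10 za] := near_ a; have [eta2 eta20 zb] := near_ b.
pose l := Num.min (a - eta1) (b - eta2); pose r := Num.max (a + eta1) (b + eta2).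
have la : l <= a - eta1 by rewrite ge_min lexx.
have lb : l <= b - eta2 by rewrite ge_min lexx orbT.
have ar : a + eta1 <= r by rewrite le_max lexx.
have br : b + eta2 <= r by rewrite le_max lexx orbT.
have [A0 Aa] := tent_average cz eta10 za la ar.
have [B0 Bb] := tent_average cz eta20 zb lb br.
set A := itg (tent a eta1) l r in A0 Aa; set B := itg (tent b eta2) l r in B0 Bb.
pose rho t := A^-1 * tent a eta1 t - B^-1 * tent b eta2 t.
have ia := loc_int_continuous (@tent_continuous a eta1).
have ib := loc_int_continuous (@tent_continuous b eta2).
have zi := loc_int_continuous cz.
have rho_out t : ~ (l <= t <= r) -> rho t = 0.
  move=> /negP; rewrite negb_and -!ltNge => tlr.
  by rewrite /rho !tent_out ?mulr0 ?subrr// ler_normr; lra.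
have crho : continuous rho.
  by move=> t; apply: cvgB; apply: cvgMl_tmp; exact: tent_continuous.
have lr : l <= r by lra.
have [phi tphi phiE] := @test_function_primitive rho l r crho lr rho_out
  ltac:(by rewrite itgB ?itgZ ?mulVf ?subrr ?gt_eqF//; exact: loc_intZ).
have := z0 phi tphi; rewrite phiE (@Rintegral_support _ _ l r); last first.
  by move=> t /rho_out ->; rewrite mul0r.
have za_i : loc_int (fun t => tent a eta1 t * z t).
  by apply: loc_intM zi; exact: tent_continuous.
have zb_i : loc_int (fun t => tent b eta2 t * z t).
  by apply: loc_intM zi; exact: tent_continuous.
have -> : (fun t => rho t * z t) = (fun t => A^-1 * (tent a eta1 t * z t) -
    B^-1 * (tent b eta2 t * z t)).
  by apply/funext => t; rewrite /rho; ring.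
rewrite itgB; try exact: loc_intZ.
rewrite !itgZ// => AB.
move: Aa Bb; set p := A^-1 * _; set q := B^-1 * _.
have -> : p = q by apply/eqP; rewrite -subr_eq0 AB.
move=> qa qb; have -> : z a - z b = (q - z b) - (q - z a) by ring.
by rewrite (le_trans (ler_normB _ _))// [e]splitr lerD.
Qed.

End du_bois_reymond.

Section weak_derivative.
Context (R : realType) (H : hilbertType R).
Local Notation mu := (@lebesgue_measure R).
Implicit Types (V F G : R -> H) (a b c x y z t : R) (h : H).

(** For each h, the difference between <V, h> and a primitive of <G, h> is
    orthogonal to all derivatives of test functions. *)
Lemma weak_derivative_prim V G : continuous V -> L2loc G ->
  is_weak_derivative V G -> prim V G.
Proof.
move=> cV G2 VG; split => // a b h ab.
have gi := loc_int_inner h G2.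
have [w cw wE] := primitive_exists gi.
have cv : continuous (fun t => inner (V t) h).
  by move=> t; apply: innerl_cvg; exact: cV.
suff : inner (V a) h - w a = inner (V b) h - w b.
  by rewrite innerBl -wE//; lra.
apply: (@du_bois_reymond _ (fun t => inner (V t) h - w t)).
  by move=> t; apply: cvgB; [exact: cv|exact: cw].
move=> phi tphi; have [dphi cphi [M phi0]] := tphi.
have [y yV yG] := VG phi tphi.
have dphi0 := test_function_derive1 phi0.
have supp := test_function_support phi0.
set N := `|M| + 1 in supp; have N0 : 0 <= N by rewrite addr_ge0.
have NN : - N <= N by lra.
have cp : continuous phi.
  by move=> x; apply: differentiable_continuous; exact/derivable1_diffP.
have := itg_by_parts NN cw gi wE dphi cphi.
have -> : phi N = 0 by apply: phi0; rewrite ger0_norm// /N; have := ler_norm M; lra.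
have -> : phi (- N) = 0.
  by apply: phi0; rewrite normrN ger0_norm// /N; have := ler_norm M; lra.
rewrite !mul0r subrr.
move=> ibp.
have e1 : inner y h = itg (fun t => derive1 phi t * inner (V t) h) (- N) N.
  rewrite (bochner_inner h yV) (@Rintegral_support _ _ (- N) N).
    by under eq_fun do rewrite innerZl.
  by move=> t /supp/dphi0 ->; rewrite scale0r inner0l.
have e2 : - inner y h = itg (fun t => phi t * inner (G t) h) (- N) N.
  rewrite -innerNl (bochner_inner h yG) (@Rintegral_support _ _ (- N) N).
    by under eq_fun do rewrite innerZl.
  by move=> t /supp/phi0 ->; rewrite scale0r inner0l.
rewrite (@Rintegral_support _ _ (- N) N); last first.
  by move=> t /supp/dphi0 ->; rewrite mul0r.
have i1 : loc_int (fun t => derive1 phi t * inner (V t) h).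
  by apply: loc_intM => //; exact: loc_int_continuous.
have i2 : loc_int (fun t => derive1 phi t * w t).
  by apply: loc_intM => //; exact: loc_int_continuous.
have -> : (fun t => derive1 phi t * (inner (V t) h - w t)) =
    (fun t => derive1 phi t * inner (V t) h - derive1 phi t * w t).
  by apply/funext => t; rewrite mulrBr.
by rewrite itgB// -e1; lra.
Qed.

Lemma weak_derivP V : H1loc V -> prim V (weak_deriv V).
Proof.
move=> [cV _ [G G2 VG]].
have [D2 DV] : [set G | L2loc G /\ is_weak_derivative V G] (weak_deriv V).
  by rewrite /weak_deriv; case: xgetP => [_ -> //|/(_ G)[]].
exact: weak_derivative_prim.
Qed.

(** The values of F are limits of combinations of countably many vectors; F is
    orthogonal to each of them almost everywhere, hence to itself. *)
Lemma strongly_measurable_ae0 F : strongly_measurable (F : measurableTypeR R -> H) ->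
  (forall h, {ae mu, forall t, inner (F t) h = 0}) -> {ae mu, forall t, F t = 0}.
Proof.
move=> [s _ sF] F0.
have : {ae mu, forall t, forall n (i : nat),
    inner (F t) (nth (set0, 0) (s n) i).2 = 0}.
  by apply/ae_foralln => n; apply/ae_foralln => i; exact: F0.
apply: filterS; first exact: (ae_filter_ringOfSetsType mu).
move=> t Ft; apply/eqP; rewrite -normr_eq0 -sqrf_eq0 -inner_norm; apply/eqP.
have h1 : inner (simple_eval (s n) t) (F t) @[n --> \oo] --> inner (F t) (F t).
  by apply: innerl_cvg; exact: sF.
have h0 : (fun n => inner (simple_eval (s n) t) (F t)) = cst 0.
  apply/funext => n; rewrite /simple_eval inner_suml (big_nth (set0, 0)).
  by apply: big1 => i _; rewrite innerZl innerC Ft mulr0.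
rewrite h0 in h1; apply: (@cvg_unique _ (@Rhausdorff R) _ _ _ _ h1).
exact: cvg_cst.
Qed.

Lemma prim_unique V F G : prim V F -> prim V G -> {ae mu, forall t, F t = G t}.
Proof.
move=> [_ F2 VF] [_ G2 VG].
have D2 := L2locB F2 G2.
have : {ae mu, forall t, F t - G t = 0}.
  apply: strongly_measurable_ae0; first by case: D2.
  move=> h; apply: itg0_ae; first exact: loc_int_inner.
  move=> x y xy; under eq_fun do rewrite innerBl.
  by rewrite itgB -?VF -?VG ?subrr//; exact: loc_int_inner.
apply: filterS; first exact: (ae_filter_ringOfSetsType mu).
by move=> t /eqP; rewrite subr_eq0 => /eqP.
Qed.

Lemma weak_deriv_ae V G : prim V G -> {ae mu, forall t, weak_deriv V t = G t}.
Proof. by move=> VG; exact: prim_unique (weak_derivP (prim_H1loc VG)) VG. Qed.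

End weak_derivative.

(** * Primitives from bounded dyadic energies *)

Section grid.
Context (R : realType).
Implicit Types (i : int) (n m k : nat) (x y z t : R).

Definition gpt n i : R := i%:~R * dlen R n.

Lemma gptS n i : gpt n (i + 1) = gpt n i + dlen R n.
Proof. by rewrite /gpt intrD mulrDl mul1r. Qed.

Lemma gpt_le n i j : i <= j -> gpt n i <= gpt n j.
Proof. by move=> ij; rewrite ler_wpM2r ?ler_int// dlen_ge0. Qed.

Lemma dlenD n m : (2 ^ m)%:R * dlen R (n + m) = dlen R n.
Proof. by rewrite /dlen exprD mulrCA natrX -exprMn mulfV// expr1n mulr1. Qed.

Lemma gpt_widen n m i : (n <= m)%N -> gpt n i = gpt m (i * (2 ^ (m - n))%:Z).
Proof.
move=> nm; rewrite /gpt intrM -mulrA; congr (_ * _).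
by rewrite -[in LHS](dlenD n (m - n)) subnKC.
Qed.

Lemma gpt_nat n (N : int) : N%:~R = gpt n (N * (2 ^ n)%:Z) :> R.
Proof.
have := @gpt_widen 0 n N (leq0n n); rewrite subn0 => <-.
by rewrite /gpt /dlen expr0 mulr1.
Qed.

Lemma dleft_gpt n i t : gpt n i <= t < gpt n i + dlen R n -> dleft n t = gpt n i.
Proof. exact: dleftE. Qed.

Lemma dleft_grid n t : dleft n t = gpt n (Num.floor (t / dlen R n)).
Proof. by []. Qed.

Lemma gpt_dleft n i t : gpt n i <= t -> gpt n i <= dleft n t.
Proof.
rewrite /gpt /dleft -ler_pdivlMr ?dlen_gt0// => it.
by rewrite ler_wpM2r ?dlen_ge0// ler_int floor_ge_int.
Qed.

Lemma dleft_dleft n m t : (n <= m)%N -> dleft n (dleft m t) = dleft n t.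
Proof.
move=> nm; rewrite [RHS]dleft_grid; apply: dleft_gpt; apply/andP; split.
  by rewrite (gpt_widen _ nm); apply: gpt_dleft; rewrite -(gpt_widen _ nm) dleft_le.
exact: le_lt_trans (dleft_le _ _) (dleft_gt _ _).
Qed.

Lemma grid_le n (P Q : R -> R -> R) :
  (forall x, P x x = 0) -> (forall x, Q x x = 0) ->
  (forall x y z, x <= y -> y <= z -> P x z = P x y + P y z) ->
  (forall x y z, x <= y -> y <= z -> Q x z = Q x y + Q y z) ->
  (forall i, P (gpt n i) (gpt n i + dlen R n) <= Q (gpt n i) (gpt n i + dlen R n)) ->
  forall i j, i <= j -> P (gpt n i) (gpt n j) <= Q (gpt n i) (gpt n j).
Proof.
move=> P0 Q0 PD QD PQ i j; rewrite -subr_ge0 => ij.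
have -> : j = i + (absz (j - i))%:Z by rewrite gez0_abs//; ring.
elim: (absz _) => [|k IH]; first by rewrite addr0 P0 Q0.
have -> : i + k.+1%:Z = i + k%:Z + 1 by rewrite -addn1 PoszD addrA.
have h1 : gpt n i <= gpt n (i + k%:Z) by apply: gpt_le; rewrite lerDl.
have h2 : gpt n (i + k%:Z) <= gpt n (i + k%:Z + 1).
  by apply: gpt_le; rewrite lerDl.
by rewrite (PD _ _ _ h1 h2) (QD _ _ _ h1 h2) lerD// gptS.
Qed.

End grid.

Section difference_quotients.
Context (R : realType) (H : hilbertType R).
Variable (U : R -> H).
Hypothesis cU : continuous U.
Implicit Types (i : int) (n m k : nat) (x y z t : R) (h : H).

(** The slope of the level n dyadic polygonal interpolation of U. *)
Definition dq n t : H :=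
  (dlen R n)^-1 *: (U (dleft n t + dlen R n) - U (dleft n t)).

Lemma dq_dleft n m t : (n <= m)%N -> dq n (dleft m t) = dq n t.
Proof. by move=> nm; rewrite /dq dleft_dleft. Qed.

Lemma dq_cell n i t : gpt R n i <= t < gpt R n i + dlen R n ->
  dq n t = (dlen R n)^-1 *: (U (gpt R n i + dlen R n) - U (gpt R n i)).
Proof. by move=> /dleft_gpt tE; rewrite /dq tE. Qed.

Lemma dq_strongly_measurable n :
  strongly_measurable (dq n : measurableTypeR R -> H).
Proof.
exists (fun m => [seq (`[a, a + dlen R m[%classic, dq n a) | a <- dcells R m]).
  by move=> m p /mapP[a _ ->] /=; exact: measurable_itv.
move=> t; rewrite /simple_eval; under eq_fun do rewrite big_map/=.
apply: cvg_near_cst; near=> m; rewrite big_dcells ?dq_dleft//.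
  by near: m; exact: nbhs_infty_ge.
have : `|t| < m%:R by near: m; exact: nbhs_infty_gtr.
by rewrite ltr_norml => /andP[/ltW -> ->].
Unshelve. all: by end_near. Qed.

Lemma dq_L2loc n : L2loc (dq n).
Proof.
have mdq := dq_strongly_measurable n.
have mn := strongly_measurable_sqr_norm mdq.
apply: L2locP => //; split => // a b.
have [ab|ba] := leP a b; last first.
  by rewrite set_itv_ge ?bnd_simp -?ltNge//; exact: integrable_set0.
have ab1 : a - 1 <= b + 1 by lra.
have cUn : {within `[a - 1, b + 1], continuous (fun t => `|U t|)}.
  by apply: continuous_subspaceT => t; apply: cvg_norm; exact: cU.
have [c _ Uc] := EVT_max ab1 cUn.
have := (@loc_int_cst R (((dlen R n)^-1 * (2 * `|U c|)) ^+ 2)).2 a b.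
apply: le_integrable => //.
  by apply/measurable_EFinP; exact: measurable_funTS.
move=> t /=; rewrite in_itv/= => /andP[at_ tb]; rewrite lee_fin.
rewrite !ger0_norm ?sqr_ge0// lerXn2r ?nnegrE//.
  by rewrite mulr_ge0 ?mulr_ge0// invr_ge0 dlen_ge0.
rewrite normrZ ger0_norm ?invr_ge0 ?dlen_ge0//.
rewrite ler_wpM2l ?invr_ge0 ?dlen_ge0// (le_trans (ler_normB _ _))//.
have d0 := dlen_gt0 R n.
have d1 : dlen R n <= 1 by rewrite exprn_ile1 ?invr_ge0 ?invf_le1 ?ler1n.
have := dleft_le n t; have := dleft_gt n t => l1 l2.
rewrite mulr2n mulrDl mul1r lerD//; apply: Uc; rewrite in_itv/=; apply/andP; split; lra.
Qed.

Lemma dq_inner_cell n i h :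
  itg (fun t => inner (dq n t) h) (gpt R n i) (gpt R n i + dlen R n) =
  inner (U (gpt R n i + dlen R n) - U (gpt R n i)) h.
Proof.
have d0 := dlen_gt0 R n.
rewrite (@eq_itg _ _ (fun=> inner ((dlen R n)^-1 *:
    (U (gpt R n i + dlen R n) - U (gpt R n i))) h)).
- rewrite itg_cst ?lerDl ?dlen_ge0// [X in _ * X = _]addrAC subrr add0r innerZl mulrAC mulVf ?gt_eqF//.
  by rewrite mul1r.
- exact: loc_int_inner (dq_L2loc n).
- exact: loc_int_cst.
- by move=> t /andP[/ltW t1 t2]; rewrite (@dq_cell n i)// t1.
Qed.

Lemma dq_inner_grid n i j h : i <= j ->
  itg (fun t => inner (dq n t) h) (gpt R n i) (gpt R n j) =
  inner (U (gpt R n j) - U (gpt R n i)) h.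
Proof.
move=> ij; have gi := loc_int_inner h (dq_L2loc n).
have PD x y z : x <= y -> y <= z -> itg (fun t => inner (dq n t) h) x z =
    itg (fun t => inner (dq n t) h) x y + itg (fun t => inner (dq n t) h) y z.
  exact: itg_split.
have QD x y z : x <= y -> y <= z ->
    inner (U z - U x) h = inner (U y - U x) h + inner (U z - U y) h.
  by move=> _ _; rewrite !innerBl; ring.
apply/eqP; rewrite eq_le; apply/andP; split.
  apply: (@grid_le R n (fun x y => itg (fun t => inner (dq n t) h) x y)
    (fun x y => inner (U y - U x) h)) => // [x|x|k].
  - exact: itgxx.
  - by rewrite subrr inner0l.
  - by rewrite dq_inner_cell.
apply: (@grid_le R n (fun x y => inner (U y - U x) h)
  (fun x y => itg (fun t => inner (dq n t) h) x y)) => // [x|x|k].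
- by rewrite subrr inner0l.
- exact: itgxx.
- by rewrite dq_inner_cell.
Qed.

Lemma dq_sqr_cell n i :
  itg (fun t => `|dq n t| ^+ 2) (gpt R n i) (gpt R n i + dlen R n) =
  (dlen R n)^-1 * `|U (gpt R n i + dlen R n) - U (gpt R n i)| ^+ 2.
Proof.
have d0 := dlen_gt0 R n.
rewrite (@eq_itg _ _ (fun=> `|(dlen R n)^-1 *:
    (U (gpt R n i + dlen R n) - U (gpt R n i))| ^+ 2)).
- rewrite itg_cst ?lerDl ?dlen_ge0// [X in _ * X = _]addrAC subrr add0r normrZ exprMn.
  by rewrite ger0_norm ?invr_ge0 ?dlen_ge0//; field; exact: lt0r_neq0.
- exact: loc_int_sqr (dq_L2loc n).
- exact: loc_int_cst.
- by move=> t /andP[/ltW t1 t2]; rewrite (@dq_cell n i)// t1.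
Qed.

(** Orthogonality of martingale increments: the coarse slope is the average of
    the fine slopes over each coarse cell. *)
Lemma dq_pythagoras n m i j : (n <= m)%N -> i <= j ->
  itg (fun t => `|dq m t - dq n t| ^+ 2) (gpt R n i) (gpt R n j) <=
  itg (fun t => `|dq m t| ^+ 2) (gpt R n i) (gpt R n j) -
  itg (fun t => `|dq n t| ^+ 2) (gpt R n i) (gpt R n j).
Proof.
move=> nm; have d0 := dlen_gt0 R n.
have L2m := dq_L2loc m; have L2n := dq_L2loc n.
have im := loc_int_sqr L2m; have in_ := loc_int_sqr L2n.
have imn := loc_int_sqr (L2locB L2m L2n).
move: i j; apply: (@grid_le R n
  (fun x y => itg (fun t => `|dq m t - dq n t| ^+ 2) x y)
  (fun x y => itg (fun t => `|dq m t| ^+ 2) x y - itg (fun t => `|dq n t| ^+ 2) x y)).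
- by move=> x; exact: itgxx.
- by move=> x; rewrite !itgxx subrr.
- by move=> x y z; exact: itg_split.
- by move=> x y z xy yz; rewrite !(itg_split _ xy yz)//; ring.
move=> i; rewrite dq_sqr_cell.
set a := gpt R n i; set D := U (a + dlen R n) - U a.
pose k := (dlen R n)^-1 *: D.
rewrite (@eq_itg _ _ (fun t => `|dq m t - k| ^+ 2)) => [|//||]; last 2 first.
- apply: loc_int_sqr; apply: L2locB => //; apply: L2loc_continuous => t.
  exact: cvg_cst.
- by move=> t /andP[/ltW t1 t2]; rewrite (@dq_cell n i)// t1.
have aE : a + dlen R n = gpt R m ((i + 1) * (2 ^ (m - n))%:Z).
  by rewrite -(gpt_widen _ _ nm) gptS.
have ia : a = gpt R m (i * (2 ^ (m - n))%:Z) by rewrite -(gpt_widen _ _ nm).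
have -> : itg (fun t => `|dq m t - k| ^+ 2) a (a + dlen R n) =
   itg (fun t => `|dq m t| ^+ 2) a (a + dlen R n) - 2 * inner D k +
   dlen R n * `|k| ^+ 2.
  have -> : inner D k = itg (fun t => inner (dq m t) k) a (a + dlen R n).
    move: k => k; rewrite /D aE ia dq_inner_grid//.
    by rewrite ler_wpM2r// lerDl.
  by rewrite itg_sqrB ?lerDl ?dlen_ge0// [a + _ - a]addrAC subrr add0r.
rewrite /k innerZr inner_norm normrZ exprMn (ger0_norm (ltW _)) ?invr_gt0//.
rewrite le_eqVlt; apply/orP; left; apply/eqP; field; exact: lt0r_neq0.
Qed.

End difference_quotients.

Section windows.
Context (R : realType).
Local Notation mu := (@lebesgue_measure R).

Lemma EFin_itg (f : R -> R) a b : loc_int f ->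
  (itg f a b)%:E = (\int[mu]_(t in `[a, b]) (f t)%:E)%E.
Proof.
move=> [_ fi]; rewrite /itg /Rintegral fineK//.
have mab : measurable (`[a, b]%classic : set (measurableTypeR R)).
  exact: measurable_itv.
exact: (integrable_fin_num mab (fi a b)).
Qed.

Lemma integral_window_le (f : R -> \bar R) (c : \bar R) :
  measurable_fun [set: R] f -> (forall t, (0 <= f t)%E) ->
  (forall N : nat, (\int[mu]_(t in `[(- N%:R)%R, N%:R]) f t <= c)%E) ->
  (\int[mu]_t f t <= c)%E.
Proof.
move=> mf f0 fc.
pose F (N : nat) : set R := `[- N%:R, N%:R]%classic.
have FT : \bigcup_N F N = setT.
  rewrite -subTset => t _; exists (Num.bound `|t|) => //.
  by rewrite /F /= in_itv/= -ler_norml ltW// archi_boundP.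
have := @ge0_nondecreasing_set_cvg_integral _ (measurableTypeR R) R F f mu.
rewrite FT => h; have {h} : (\int[mu]_(t in F N) f t)%E @[N --> \oo] -->
    (\int[mu]_t f t)%E.
  apply: h => [m n mn|i|i|//].
  - rewrite subsetEset => t; rewrite /F /= !in_itv/= => /andP[t1 t2].
    have mnR : (m%:R : R) <= n%:R by rewrite ler_nat.
    by apply/andP; split; lra.
  - exact: measurable_itv.
  - exact: measurable_funTS.
move=> h; rewrite -(cvg_lim _ h)//; apply: lime_le; first exact: (cvgP _ h).
by apply: nearW => N; exact: fc.
Qed.

(** Young's inequality, balanced so that both terms are summable in j when the
    integral of u^2 is at most 4^-j. *)
Lemma young_pow j (u : R) : u <= 2^-1 ^+ j + 2 ^+ j * u ^+ 2.
Proof.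
have p0 : 0 < (2 : R) ^+ j by rewrite exprn_gt0.
have pq : (2 : R) ^+ j * 2^-1 ^+ j = 1 by rewrite -exprMn mulfV ?expr1n.
move: (2 ^+ j : R) (2^-1 ^+ j : R) p0 pq => p q p0 pq.
have : 0 <= p * (u - q / 2) ^+ 2 by rewrite mulr_ge0 ?sqr_ge0// ltW.
have q0 : 0 < q by rewrite -(pmulr_rgt0 _ p0) pq ltr01.
have -> : p * (u - q / 2) ^+ 2 = p * u ^+ 2 - (p * q) * u + (p * q) * q / 4.
  by field.
by rewrite pq; lra.
Qed.

Lemma itg_ae (f g : R -> R) a b : loc_int f -> loc_int g ->
  {ae mu, forall t, f t = g t} -> itg f a b = itg g a b.
Proof.
move=> [mf _] [mg _] fg; congr fine; apply: ae_eq_integral.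
- exact: measurable_itv.
- by apply/measurable_EFinP; exact: measurable_funTS.
- by apply/measurable_EFinP; exact: measurable_funTS.
- move: fg; apply: filterS; first exact: (ae_filter_ringOfSetsType mu).
  by move=> t fgt _; rewrite fgt.
Qed.

Lemma fatou_le (D : set R) (f_ : nat -> R -> R) (f : R -> R) (c : \bar R) :
  measurable (D : set (measurableTypeR R)) ->
  (forall n, measurable_fun [set: R] (f_ n)) ->
  (forall n t, 0 <= f_ n t) -> (forall t, f_ n t @[n --> \oo] --> f t) ->
  (forall n, (\int[mu]_(t in D) (f_ n t)%:E <= c)%E) ->
  (\int[mu]_(t in D) (f t)%:E <= c)%E.
Proof.
move=> mD mf f0 ff fc.
have := @fatou _ _ _ mu D mD (fun n t => (f_ n t)%:E)
  (fun n => measurable_funTS (iffRL (measurable_EFinP _ _) (mf n)))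
  (fun n t _ => f0 n t).
have -> : (\int[mu]_(t in D) limn_einf (fun n => (f_ n t)%:E) =
    \int[mu]_(t in D) (f t)%:E)%E.
  apply: eq_integral => t _; have : (f_ n t)%:E @[n --> \oo] --> (f t)%:E.
    by apply/fine_cvgP; split; [exact: nearW|exact: ff].
  by move=> /cvg_limn_einf_sup[->].
move=> /le_trans; apply; rewrite limn_einf_lim.
apply: lime_le; first exact: is_cvg_einfs.
apply: nearW => n; apply: le_trans (fc n).
by apply: ereal_inf_lbound; exists n => /=.
Qed.

End windows.

Section radon_nikodym.
Context (R : realType) (H : hilbertType R).
Local Notation mu := (@lebesgue_measure R).
Variables (U : R -> H) (C : R).
Hypothesis cU : continuous U.
Hypothesis dqC : forall n (N : nat),
  itg (fun t => `|dq U n t| ^+ 2) (- N%:R) N%:R <= C.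
Implicit Types (i : int) (n m k j l N : nat) (x y z t : R) (h : H).

Let E n N := itg (fun t => `|dq U n t| ^+ 2) (- N%:R) N%:R.

Let pyth n m (a b : int) : (n <= m)%N -> a <= b ->
  itg (fun t => `|dq U m t - dq U n t| ^+ 2) a%:~R b%:~R <=
  itg (fun t => `|dq U m t| ^+ 2) a%:~R b%:~R -
  itg (fun t => `|dq U n t| ^+ 2) a%:~R b%:~R.
Proof.
by move=> nm ab; rewrite !(gpt_nat R n); apply: dq_pythagoras => //; rewrite ler_wpM2r.
Qed.

Let E_mono n m N : (n <= m)%N -> E n N <= E m N.
Proof.
move=> nm; have NN : - N%:Z <= N%:Z by rewrite -subr_ge0 opprK -PoszD.
have := pyth nm NN; rewrite intrN -/(E n N) -/(E m N) => h.
by rewrite -subr_ge0; apply: le_trans h; apply: itg_ge0 => t _; exact: sqr_ge0.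
Qed.

Let E_diff n m N N' : (n <= m)%N -> (N <= N')%N ->
  E m N - E n N <= E m N' - E n N'.
Proof.
move=> nm NN'; have im := loc_int_sqr (dq_L2loc cU m).
have in_ := loc_int_sqr (dq_L2loc cU n).
have NN : (N%:R : R) <= N'%:R by rewrite ler_nat.
have N0 : 0 <= (N%:R : R) by exact: ler0n.
have l1 : - N'%:R <= - N%:R :> R by lra.
have l2 : - N%:R <= N%:R :> R by lra.
rewrite /E (itg_split im l1 (le_trans l2 NN)) (itg_split im l2 NN).
rewrite (itg_split in_ l1 (le_trans l2 NN)) (itg_split in_ l2 NN).
have NNz : - N'%:Z <= - N%:Z by rewrite lerN2 lez_nat.
have NNz' : N%:Z <= N'%:Z by rewrite lez_nat.
have := pyth nm NNz; have := pyth nm NNz'; rewrite !intrN.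
have p a b : 0 <= itg (fun t => `|dq U m t - dq U n t| ^+ 2) a b.
  by apply: itg_ge0 => t _; exact: sqr_ge0.
move=> /(le_trans (p _ _)) + /(le_trans (p _ _)).
rewrite -!pmulrn; lra.
Qed.

Let E_window n N N' : (N <= N')%N -> E n N <= E n N'.
Proof.
move=> NN'; have NN : (N%:R : R) <= N'%:R by rewrite ler_nat.
have N0 : 0 <= (N%:R : R) by exact: ler0n.
apply: itg_le_sub; [exact: loc_int_sqr (dq_L2loc cU n)| |lra|lra|lra].
by move=> t; exact: sqr_ge0.
Qed.

(** E n N is nondecreasing in n and in N and bounded by C.  Close to its
    supremum the increments in n are small; they control the distance between
    slopes by orthogonality.  Increments in n also grow with N, which makes the
    estimate uniform in N. *)
Lemma dq_cauchy (e : R) : 0 < e -> exists k, forall n m N, (k <= n)%N -> (n <= m)%N ->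
  itg (fun t => `|dq U m t - dq U n t| ^+ 2) (- N%:R) N%:R <= e.
Proof.
move=> e0; pose S := [set E p.1 p.2 | p in [set: nat * nat]].
have supS : has_sup S.
  split; first by exists (E 0 0), (0%N, 0%N).
  by exists C => _ [[n N] _ <-]; exact: dqC.
have [_ [[k K] _ <-] /= kK] := sup_adherent e0 supS.
exists k => n m N kn nm.
have NN : - N%:Z <= N%:Z by rewrite -subr_ge0 opprK -PoszD.
have := pyth nm NN; rewrite intrN => /le_trans; apply.
rewrite -/(E m N) -/(E n N).
apply: (le_trans (E_diff nm (leq_maxl N K))).
have : E m (maxn N K) <= sup S.
  by apply: ub_le_sup; [case: supS|exists (m, maxn N K)].
have := E_window k (leq_maxr N K); have := E_mono (maxn N K) kn.
lra.
Qed.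

Lemma dq_fast : exists kappa : nat -> nat, [/\ forall j, (j <= kappa j)%N,
  {homo kappa : j l / (j <= l)%N} &
  forall j l N, (j <= l)%N ->
    itg (fun t => `|dq U (kappa l) t - dq U (kappa j) t| ^+ 2) (- N%:R) N%:R <=
    4^-1 ^+ j].
Proof.
have /choice[k kP] j : exists k, forall n m N, (k <= n)%N -> (n <= m)%N ->
    itg (fun t => `|dq U m t - dq U n t| ^+ 2) (- N%:R) N%:R <= 4^-1 ^+ j.
  by apply: dq_cauchy; rewrite exprn_gt0// invr_gt0.
pose kappa j := (j + \sum_(i < j.+1) k i)%N.
have kappaS j : (kappa j <= kappa j.+1)%N.
  by rewrite /kappa [in leqRHS]big_ord_recr/= leq_add// leq_addr.
have kappa_homo : {homo kappa : j l / (j <= l)%N}.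
  by apply: homo_leq => // j l m; exact: leq_trans.
exists kappa; split => // [j|j l N jl]; first exact: leq_addr.
apply: kP; last exact: kappa_homo.
by rewrite /kappa big_ord_recr/= addnA leq_addl.
Qed.

(** The difference quotients form a martingale bounded in L2.  Along the levels
    of dq_fast they converge almost everywhere, to a function G which inherits the
    bound by Fatou's lemma and whose integrals over dyadic intervals are the
    increments of U. *)
Theorem prim_of_dq_bound :
  exists2 G, prim U G & (\int[mu]_t ((`|G t| ^+ 2)%:E) <= C%:E)%E.
Proof.
have [kappa [kappa_ge kappa_homo fast]] := dq_fast.
pose g j := dq U (kappa j).
have g2 j : L2loc (g j) by exact: dq_L2loc.
have mg j := (g2 j).1.
(* The series of the f j has a finite integral, and by young_pow it dominates
   the series of the |g j.+1 t - g j t| up to a geometric series. *)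
pose f j t := 2 ^+ j * `|g j.+1 t - g j t| ^+ 2.
have f0 j t : 0 <= f j t by rewrite mulr_ge0 ?exprn_ge0.
have fi j : loc_int (f j) by apply: loc_intZ; apply: loc_int_sqr; exact: L2locB.
pose S t : \bar R := (\sum_(0 <= j <oo) (f j t)%:E)%E.
have mfE j : measurable_fun [set: R] (fun t => (f j t)%:E).
  by apply/measurable_EFinP; case: (fi j).
have mS : measurable_fun [set: measurableTypeR R] S.
  by apply: (@ge0_emeasurable_sum _ (measurableTypeR R) R setT
    (fun j t => (f j t)%:E) xpredT) => [j t _ _|j _]; [rewrite lee_fin|exact: mfE].
have S0 t : (0 <= S t)%E by apply: nneseries_ge0 => j _ _; rewrite lee_fin.
have iS : (\int[mu]_t S t < +oo)%E.
  rewrite integral_nneseries//; last by move=> j t _; rewrite lee_fin.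
  apply: (@le_lt_trans _ _ 2%:E); last exact: ltry.
  apply: le_trans (epsilon_trick0 xpredT (ler0n R 2)).
  apply: lee_nneseries => [j _ _|j _].
    by apply: integral_ge0 => t _; rewrite lee_fin.
  apply: integral_window_le => // [t|N]; first by rewrite lee_fin.
  rewrite -EFin_itg// lee_fin itgZ; last by apply: loc_int_sqr; exact: L2locB.
  apply: (@le_trans _ _ (2 ^+ j * 4^-1 ^+ j)).
    by rewrite ler_wpM2l ?exprn_ge0//; apply: fast.
  rewrite -exprMn natrX exprS invfM mulrA mulfV// mul1r -exprVn.
  by rewrite (_ : 2 * 4^-1 = 2^-1 :> R)//; field.
pose D : set R := [set t | (S t < +oo)%E].
have mD : measurable (D : set (measurableTypeR R)).
  by rewrite -[D]setTI; apply: (@measurable_lte _ (measurableTypeR R)).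
have Dae : {ae mu, forall t, D t}.
  have : mu.-integrable [set: R] S.
    apply/integrableP; split => //; under eq_integral do rewrite gee0_abs//.
    exact: iS.
  move=> Si; have := integrable_ae measurableT Si.
  by apply: filterS => t /(_ I); rewrite ge0_fin_numE.
have Dcvg t : D t -> cvgn (g ^~ t).
  move=> Dt; have Sb : S t = (fine (S t))%:E by rewrite fineK// ge0_fin_numE.
  have fb n : \sum_(0 <= j < n) f j t <= fine (S t).
    rewrite -lee_fin -Sb -sumEFin; apply: nneseries_lim_ge => j _ _.
    by rewrite lee_fin.
  have geo n : \sum_(0 <= j < n) (2^-1 : R) ^+ j <= 2 - 2 * 2^-1 ^+ n.
    elim: n => [|n IH]; first by rewrite big_geq// expr0; lra.
    by rewrite big_nat_recr//= exprS; lra.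
  have -> : g ^~ t = (fun n => g 0 t + series (telescope (g ^~ t)) n).
    by apply/funext => n; exact: eq_sum_telescope.
  apply: is_cvgD; first exact: is_cvg_cst.
  apply: normed_cvg; apply: nondecreasing_is_cvgn.
    by apply: nondecreasing_series => *; exact: normr_ge0.
  exists (2 + fine (S t)) => _ [n _ <-].
  apply: (@le_trans _ _ (\sum_(0 <= j < n) (2^-1 ^+ j + f j t))).
    apply: ler_sum => j _; rewrite /telescope /f.
    exact: young_pow.
  rewrite big_split/= lerD// (le_trans (geo n))// gerBl.
  by rewrite mulr_ge0// exprn_ge0.
(* Strong measurability of the limit asks for convergence at every point, so
   the slopes are set to 0 off D. *)
pose g' j t := (\1_D t : R) *: g j t.
have g'2 j : L2loc (g' j) by exact: L2loc_restrict.
have g'_le j l t : `|g' l t - g' j t| ^+ 2 <= `|g l t - g j t| ^+ 2.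
  rewrite /g' -scalerBr normrZ exprMn indicE; case: (t \in D).
    by rewrite normr1 expr1n mul1r.
  by rewrite normr0 expr0n mul0r sqr_ge0.
have g'_le0 j t : `|g' j t| ^+ 2 <= `|g j t| ^+ 2.
  rewrite /g' normrZ exprMn indicE; case: (t \in D).
    by rewrite normr1 expr1n mul1r.
  by rewrite normr0 expr0n mul0r sqr_ge0.
have g'_ae j : {ae mu, forall t, g' j t = g j t}.
  move: Dae; apply: filterS; first exact: (ae_filter_ringOfSetsType mu).
  by move=> t Dt; rewrite /g' indicE mem_set// scale1r.
pose G t := limn (g' ^~ t).
have g'G t : g' n t @[n --> \oo] --> G t.
  have [Dt|Dt] := pselect (D t).
    have : cvgn (g' ^~ t).
      have -> : g' ^~ t = g ^~ t.
        by apply/funext => n; rewrite /g' indicE mem_set// scale1r.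
      exact: Dcvg.
    by [].
  suff : cvgn (g' ^~ t) by [].
  have -> : g' ^~ t = cst 0.
    by apply/funext => n; rewrite /g' indicE memNset// scale0r.
  exact: is_cvg_cst.
have mG : strongly_measurable (G : measurableTypeR R -> H).
  exists (fun j => [seq (`[a, a + dlen R (kappa j)[%classic `&` D, g j a) |
      a <- dcells R (kappa j)]).
    move=> j p /mapP[a _ ->] /=.
    by apply: measurableI; [exact: measurable_itv|exact: mD].
  move=> t; apply: cvg_trans (g'G t); apply: near_eq_cvg; near=> j.
  rewrite /simple_eval big_map /=.
  have -> : \sum_(a <- dcells R (kappa j))
      (\1_(`[a, a + dlen R (kappa j)[ `&` D) t : R) *: g j a =
    (\1_D t : R) *: \sum_(a <- dcells R (kappa j))
      (\1_(`[a, a + dlen R (kappa j)[%classic) t : R) *: g j a.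
    rewrite scaler_sumr; apply: eq_bigr => a _.
    by rewrite indicI /= scalerA mulrC.
  have : `|t| < (kappa j)%:R.
    apply: (@lt_le_trans _ _ j%:R); last by rewrite ler_nat.
    by near: j; exact: nbhs_infty_gtr.
  rewrite ltr_norml => /andP[/ltW t1 t2].
  by rewrite big_dcells ?t1 ?t2// /g dq_dleft.
have msqr (F : R -> H) : strongly_measurable (F : measurableTypeR R -> H) ->
    measurable_fun [set: R] (fun t => `|F t| ^+ 2).
  exact: strongly_measurable_sqr_norm.
have mitv (N : nat) : measurable (`[- N%:R, N%:R]%classic : set (measurableTypeR R)).
  exact: measurable_itv.
have GC : (\int[mu]_t ((`|G t| ^+ 2)%:E) <= C%:E)%E.
  apply: integral_window_le => [|t|N]; first by apply/measurable_EFinP; exact: msqr.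
    by rewrite lee_fin sqr_ge0.
  apply: (@fatou_le _ _ (fun n t => `|g' n t| ^+ 2)) => // [n|t|n].
  - by apply: msqr; case: (g'2 n).
  - exact: cvg_sqr_norm.
  rewrite -EFin_itg; last exact: loc_int_sqr.
  rewrite lee_fin; apply: le_trans (dqC (kappa n) N).
  by apply: itg_le; [exact: loc_int_sqr|exact: (loc_int_sqr (g2 n))|move=> t _; exact: g'_le0].
have G2 : L2loc G.
  split => // a b; apply: (@le_lt_trans _ _ C%:E); last exact: ltry.
  apply: le_trans GC; apply: ge0_subset_integral => //.
  by apply/measurable_EFinP; exact: msqr.
have Gg' j N : itg (fun t => `|G t - g' j t| ^+ 2) (- N%:R) N%:R <= 4^-1 ^+ j.
  have G2j := L2locB G2 (g'2 j).
  rewrite -lee_fin EFin_itg; last exact: loc_int_sqr.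
  apply: (@fatou_le _ _ (fun n t => `|g' (n + j)%N t - g' j t| ^+ 2)) => // [n|t|n].
  - by apply: msqr; case: (L2locB (g'2 (n + j)%N) (g'2 j)).
  - apply: cvg_sqr_norm; apply: cvgB; last exact: cvg_cst.
    by rewrite (cvg_shiftn j (g' ^~ t)).
  rewrite -EFin_itg; last by apply: loc_int_sqr; exact: L2locB.
  rewrite lee_fin; apply: le_trans (fast j (n + j)%N N (leq_addl _ _)).
  by apply: itg_le; [apply: loc_int_sqr; exact: L2locB
    |exact: (loc_int_sqr (L2locB (g2 (n + j)%N) (g2 j)))
    |move=> t _; exact: g'_le].
exists G => //; split => // a b h ab.
have Gi := loc_int_inner h G2.
(* Between two points of a grid every finer slope has the right integral, and
   the slopes converge to G in L2. *)
have grid n (i1 i2 : int) : i1 <= i2 ->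
    inner (U (gpt R n i2) - U (gpt R n i1)) h =
    itg (fun t => inner (G t) h) (gpt R n i1) (gpt R n i2).
  move=> i12; set x := gpt R n i1; set y := gpt R n i2.
  have xy : x <= y by exact: gpt_le.
  apply/eqP; rewrite -subr_eq0 -normr_le0.
  have lim0 : `|h| * (y - x + 1) * dlen R j @[j --> \oo] --> 0.
    rewrite -[X in _ --> X](mulr0 (`|h| * (y - x + 1))).
    by apply: cvgMl_tmp; exact: dlen_cvg.
  apply: (ler_cvg_to (@cvg_cst _ _ _ \oo _) lim0); near=> j.
  have nj : (n <= kappa j)%N by apply: leq_trans (kappa_ge j); near: j; exact: nbhs_infty_ge.
  have g'i := loc_int_inner h (g'2 j).
  have -> : inner (U y - U x) h = itg (fun t => inner (g' j t) h) x y.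
    rewrite (@itg_ae R (fun t => inner (g' j t) h) (fun t => inner (g j t) h))//.
    - rewrite /x /y !(gpt_widen _ _ nj) dq_inner_grid//.
      by rewrite ler_wpM2r.
    - exact: loc_int_inner.
    - move: (g'_ae j); apply: filterS; first exact: (ae_filter_ringOfSetsType mu).
      by move=> t ->.
  rewrite distrC -itgB//.
  have G2j := L2locB G2 (g'2 j).
  rewrite (le_trans (itg_norm _ _ (loc_intB Gi g'i)))//.
  pose N := (Num.bound `|x| + Num.bound `|y|)%N.
  have xN : - N%:R <= x.
    rewrite /N natrD lerNl (le_trans (ler_norm _))// normrN.
    by rewrite (le_trans (ltW (archi_boundP (normr_ge0 x))))// lerDl.
  have yN : y <= N%:R.
    rewrite /N natrD (le_trans (ler_norm _))//.
    by rewrite (le_trans (ltW (archi_boundP (normr_ge0 y))))// lerDr.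
  have p0 : 0 < (2 : R) ^+ j by rewrite exprn_gt0.
  have pq : (2 : R) ^+ j * 2^-1 ^+ j = 1 by rewrite -exprMn mulfV ?expr1n.
  apply: (@le_trans _ _ (itg (fun t => `|h| *
      (2^-1 ^+ j + 2 ^+ j * `|G t - g' j t| ^+ 2)) x y)).
    apply: itg_le.
    - by apply: loc_int_norm; exact: loc_intB.
    - apply/loc_intZ/loc_intD; first exact: loc_int_cst.
      exact/loc_intZ/loc_int_sqr.
    - move=> t _; rewrite -innerBl (le_trans (abs_inner_le _ _))// mulrC ler_wpM2l//.
      exact: young_pow.
  have i1_ := loc_int_sqr G2j.
  rewrite itgZ; last by apply: loc_intD; [exact: loc_int_cst|exact: loc_intZ].
  rewrite -mulrA ler_wpM2l// itgD; [|exact: loc_int_cst|exact: loc_intZ].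
  rewrite itg_cst// itgZ//.
  have Gxy : itg (fun t => `|G t - g' j t| ^+ 2) x y <= 4^-1 ^+ j.
    by apply: le_trans (Gg' j N); apply: itg_le_sub => // t; exact: sqr_ge0.
  have : 2 ^+ j * itg (fun t => `|G t - g' j t| ^+ 2) x y <= 2^-1 ^+ j.
    have -> : 2^-1 ^+ j = 2 ^+ j * 4^-1 ^+ j :> R.
      by rewrite -exprMn; congr (_ ^+ j); field.
    by rewrite ler_wpM2l// ltW.
  by rewrite /dlen; lra.
have [w cw wE] := primitive_exists Gi.
(* z is continuous and takes the same value at all dyadic points. *)
pose z t := inner (U t) h - w t.
have cz : continuous z.
  by move=> t; apply: cvgB; [apply: innerl_cvg; exact: cU|exact: cw].
have z0 t : z t = z 0.
  have zt : z (dleft n t) @[n --> \oo] --> z t.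
    by apply: continuous_cvg; [exact: cz|exact: dleft_cvg].
  suff h0 : (fun n => z (dleft n t)) = cst (z 0).
    rewrite h0 in zt; apply/esym.
    by apply: (@cvg_unique _ (@Rhausdorff R) _ _ _ _ _ zt); exact: cvg_cst.
  apply/funext => n; rewrite dleft_grid /=.
  have -> : (0 : R) = gpt R n 0 by rewrite /gpt mul0r.
  set i := Num.floor _; rewrite /z; case: (leP 0 i) => [i0|/ltW i0].
    have := grid n _ _ i0; rewrite -wE; last exact: gpt_le.
    rewrite innerBl; lra.
  have := grid n _ _ i0; rewrite -wE; last exact: gpt_le.
  rewrite innerBl; lra.
rewrite -wE// innerBl.
have := z0 a; have := z0 b; rewrite /z; lra.
Unshelve. all: by end_near. Qed.

End radon_nikodym.

(** * Affine changes of variable *)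

Section affine.
Context (R : realType).
Local Notation mu := (@lebesgue_measure R).

Lemma ge0_integral_affine (lam c : R) (f : R -> \bar R) : 0 < lam ->
  measurable_fun [set: R] f -> (forall t, (0 <= f t)%E) ->
  (\int[mu]_t f t = lam%:E * \int[mu]_t f ((lam * t + c)%R))%E.
Proof.
move=> lam0 mf f0; pose theta : measurableTypeR R -> measurableTypeR R :=
  fun t => lam * t + c.
have mtheta : measurable_fun [set: measurableTypeR R] theta.
  apply: measurable_funD; last exact: measurable_cst.
  by apply: measurable_funM => //; exact: measurable_cst.
pose M := measure_function_pushforward__canonical__measure_function_Measure mu mtheta.
have lam_ge0 := ltW lam0.
pose k : {nonneg R} := NngNum lam_ge0.
have muE (A : set (measurableTypeR R)) : measurable A -> mu A = mscale k M A.
  move=> mA; apply: (@lebesgue_measure_unique R (mscale k M)) => // _ [[a b] _ <-].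
  pose J : set R := `](a - c) / lam, (b - c) / lam]%classic.
  transitivity (lam%:E * mu J)%E; last first.
    congr (_ * mu _)%E; apply/seteqP; split => t; rewrite /J /preimage/= !in_itv/= /theta.
      by rewrite ltr_pdivrMr// ler_pdivlMr// [t * _]mulrC ltrBlDr lerBrDr.
    by rewrite ltr_pdivrMr// ler_pdivlMr// [t * _]mulrC ltrBlDr lerBrDr.
  rewrite /J !lebesgue_measure_itv/= !lte_fin ltr_pM2r ?invr_gt0// ltrD2r.
  case: ifPn => _; last by rewrite mule0.
  rewrite -!EFinD -EFinM; congr EFin; field; exact: lt0r_neq0.
rewrite (eq_measure_integral (mscale k M)) => [|A mA _]; last exact: muE.
rewrite ge0_integral_mscale//; congr (_ * _)%E.
by rewrite ge0_integral_pushforward.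
Qed.

End affine.

(** * The action and its coercivity *)

Section action.
Context (R : realType) (H : hilbertType R) (W : H -> \bar R).
Local Notation mu := (@lebesgue_measure R).
Hypothesis W_ge0 : forall u, (0 <= W u)%E.
Hypothesis W_lsc : weakly_lsc W.
Implicit Types (V D U : R -> H) (a b c x y z t : R) (h : H).

Definition kin D : \bar R := (\int[mu]_t ((2^-1 * `|D t| ^+ 2)%:E))%E.
Definition pot V : \bar R := (\int[mu]_t W (V t))%E.

Lemma measurable_pot V : continuous V ->
  measurable_fun [set: R] (fun t => W (V t)).
Proof.
move=> cV; apply: lower_semicontinuous_measurable => t a aW.
have Wn : \forall s \near t, (a%:E < W (V s))%E.
  apply: (weakly_lsc_cvg (nbhs_filter t) W_lsc _ aW) => h.
  by apply: innerl_cvg; exact: cV.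
by exists [set s | (a%:E < W (V s))%E] => [|s].
Qed.

Lemma measurable_kin D : L2loc D ->
  measurable_fun [set: R] (fun t => (2^-1 * `|D t| ^+ 2)%:E).
Proof.
move=> [mD _]; apply/measurable_EFinP; apply: measurable_funM => //.
exact: strongly_measurable_sqr_norm.
Qed.

Lemma kin_ge0 D : (0 <= kin D)%E.
Proof. by apply: integral_ge0 => t _; rewrite lee_fin mulr_ge0 ?invr_ge0. Qed.

Lemma pot_ge0 V : (0 <= pot V)%E.
Proof. by apply: integral_ge0 => t _. Qed.

Lemma kin_ae D D' : L2loc D -> L2loc D' -> {ae mu, forall t, D t = D' t} ->
  kin D = kin D'.
Proof.
move=> D2 D2' DD'; apply: ae_eq_integral.
- exact: measurableT.
- exact: measurable_kin.
- exact: measurable_kin.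
- move: DD'; apply: filterS; first exact: (ae_filter_ringOfSetsType mu).
  by move=> t -> _.
Qed.

Lemma action_prim V D : prim V D -> action W V = (kin D + pot V)%E.
Proof.
move=> VD; have [cV D2 _] := VD.
have VW := weak_derivP (prim_H1loc VD); have [_ W2 _] := VW.
rewrite /action ge0_integralD//.
- by congr (_ + _)%E; apply: kin_ae => //; exact: weak_deriv_ae.
- exact: measurable_kin.
- exact: measurable_pot.
Qed.

Lemma action_le V D c : prim V D -> (action W V <= c%:E)%E ->
  (kin D <= c%:E)%E /\ (pot V <= c%:E)%E.
Proof.
move=> VD; rewrite (action_prim VD) => Vc.
by split; apply: le_trans Vc; [rewrite leeDl ?pot_ge0|rewrite leeDr ?kin_ge0].
Qed.

Lemma kin_itg D c a b : L2loc D -> (kin D <= c%:E)%E ->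
  itg (fun t => `|D t| ^+ 2) a b <= 2 * c.
Proof.
move=> D2 Dc; have Di := loc_int_sqr D2.
rewrite -ler_pdivrMl// -itgZ// -lee_fin EFin_itg; last exact: loc_intZ.
apply: le_trans Dc; apply: ge0_subset_integral => //.
exact: measurable_kin.
Qed.

(** Cauchy-Schwarz on the segment between a and b. *)
Lemma action_holder V D c a b : prim V D -> (kin D <= c%:E)%E ->
  `|V b - V a| ^+ 2 <= `|b - a| * (2 * c).
Proof.
move=> VD Dc; have [_ D2 _] := VD.
wlog ab : a b / a <= b.
  move=> h; case: (leP a b) => [/h//|/ltW/h].
  by rewrite distrC [X in _ <= X * _ -> _]distrC.
rewrite (le_trans (prim_chord VD ab))// ger0_norm ?subr_ge0//.
by rewrite ler_wpM2l ?subr_ge0//; exact: kin_itg.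
Qed.

Lemma pot_lower V a b c : continuous V -> a <= b -> 0 <= c ->
  (forall t, a <= t <= b -> (c%:E <= W (V t))%E) ->
  ((c * (b - a))%:E <= \int[mu]_(t in `[a, b]) W (V t))%E.
Proof.
move=> cV ab c0 cW; rewrite -itg_cst// EFin_itg; last exact: loc_int_cst.
apply: ge0_le_integral => //.
by apply: measurable_funTS; exact: measurable_pot.
Qed.

Lemma pot_sub V (A : set R) : continuous V -> measurable (A : set (measurableTypeR R)) ->
  (\int[mu]_(t in A) W (V t) <= pot V)%E.
Proof.
by move=> cV mA; apply: ge0_subset_integral => //; exact: measurable_pot.
Qed.

(** ** Coercivity *)

Hypothesis W_infty : (0 < limf_einf W (norm_infty H))%E.

Lemma W_infty_bound : exists2 c : R, 0 < c &
  exists M : R, forall v, M < `|v| -> (c%:E <= W v)%E.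
Proof.
move: W_infty; rewrite limf_einfE => /ereal_sup_gt[_ [A [M MA] <-]] A0.
have [c c0 cA] : exists2 c : R, 0 < c & (c%:E <= ereal_inf (W @` A))%E.
  move: A0; case: (ereal_inf _) => [r| |//]; last by exists 1; rewrite ?leey.
  by rewrite lte_fin => r0; exists r.
exists c => //; exists M => v /MA Av.
by apply: le_trans cA _; apply: ereal_inf_lbound; exists v.
Qed.

(** Weak sequential closedness, with ultrafilters in place of subsequences: the
    form in which ultra_weak_limit applies. *)
Definition ultra_closed (S : set H) := forall (G : set_system nat) (v : nat -> H) u,
  UltraFilter G -> (forall n, S (v n)) ->
  (forall h, inner (v n) h @[n --> G] --> inner u h) -> S u.

Lemma ultra_closed_ge h (b : R) : ultra_closed [set u | b <= inner u h].
Proof.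
move=> G v u GU Sv vu /=; have GP : ProperFilter G by exact: ultra_proper.
apply: (@ler_cvg_to _ _ _ _ (cst b) _ b _ (cvg_cst _) (vu h)).
by apply: nearW => n; exact: Sv.
Qed.

Lemma ultra_closed_le h (b : R) : ultra_closed [set u | inner u h <= b].
Proof.
move=> G v u GU Sv vu /=; have GP : ProperFilter G by exact: ultra_proper.
apply: (@ler_cvg_to _ _ _ _ _ (cst b) _ b (vu h) (cvg_cst _)).
by apply: nearW => n; exact: Sv.
Qed.

Lemma ultra_closedI (S S' : set H) : ultra_closed S -> ultra_closed S' ->
  ultra_closed (S `&` S').
Proof.
move=> cS cS' G v u GU Sv vu; split.
  by apply: (cS G v) => // n; case: (Sv n).
by apply: (cS' G v) => // n; case: (Sv n).
Qed.

Lemma ultra_closedU (S S' : set H) : ultra_closed S -> ultra_closed S' ->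
  ultra_closed (S `|` S').
Proof.
move=> cS cS' G v u GU Sv vu; have GP : ProperFilter G by exact: ultra_proper.
have key (P : set H) : (\forall n \near G, P (v n)) -> ultra_closed P -> P u.
  move=> GPv cP.
  have [n0 Pn0] : exists n, P (v n) by apply: filter_ex GPv.
  apply: (cP G (fun n => if pselect (P (v n)) then v n else v n0)) => //.
    by move=> n; case: pselect.
  move=> h; apply: cvg_trans (vu h); apply: near_eq_cvg.
  by apply: filterS GPv => n; case: pselect.
have [GS|GS] := in_ultra_setVsetC [set n | S (v n)] GU.
  by left; exact: key.
right; apply: key => //; apply: filterS GS => n /= nS.
by case: (Sv n).
Qed.

Lemma ultra_nat : exists G : set_system nat, UltraFilter G /\ \oo `<=` G.
Proof. exact: ultraFilterLemma. Qed.

(** Points of S where W tends to 0 are bounded, since W is bounded below near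
    infinity; a weak limit of them is in S, and it is a zero of W by lower
    semicontinuity. *)
Lemma W_coercive (S : set H) : ultra_closed S -> (forall u, S u -> W u <> 0%E) ->
  exists2 c : R, 0 < c & forall v, S v -> (c%:E <= W v)%E.
Proof.
move=> cS S0; apply: contrapT => noc.
have [G [GU ooG]] := ultra_nat.
have GP : ProperFilter G by exact: ultra_proper.
have /choice[v vP] : forall n : nat, exists v, S v /\ (W v < (n.+1%:R^-1)%:E)%E.
  move=> n; apply: contrapT => nov; apply: noc; exists n.+1%:R^-1 => // v Sv.
  by rewrite leNgt; apply/negP => Wv; apply: nov; exists v.
have [c c0 [M MW]] := W_infty_bound.
have small (e : R) : 0 < e -> \forall n \near G, (W (v n) < e%:E)%E.
  move=> e0; apply: ooG; have /cvgrPdist_lt/(_ _ e0) := @cvg_harmonic R.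
  apply: filterS => n /=; rewrite sub0r normrN ger0_norm ?invr_ge0// => ne.
  by apply: (lt_trans (vP n).2); rewrite lte_fin.
have vM : \forall n \near G, `|v n| <= M.
  apply: filterS (small c c0) => n Wc; rewrite leNgt; apply/negP => /MW.
  by rewrite leNgt Wc.
have [u vu] := ultra_weak_limit GU vM.
have Su : S u by apply: cS vu => n; case: (vP n).
have : (0 < W u)%E by rewrite lt0e W_ge0 andbT; apply/eqP; exact: S0.
have [e e0 eW] : exists2 e : R, 0 < e & (W u <= 0)%E \/ (e%:E < W u)%E.
  move: (W_ge0 u); case: (W u) => [r| |//] _; last by exists 1 => //; right; rewrite ltry.
  have [r0|r0] := leP r 0; first by exists 1 => //; left; rewrite lee_fin.
  by exists (r / 2); [rewrite divr_gt0|right; rewrite lte_fin ltr_pdivrMr// ltr_pMr// ltr1n].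
case: eW => [|eW _]; first by rewrite leNgt => /negP.
have := weakly_lsc_cvg (@filter_filter _ _ GP) W_lsc vu eW; move: (small e e0).
move=> h1 h2; have [n [n1 n2]] := filter_ex (filterI h1 h2).
by move: (lt_trans n1 n2); rewrite ltxx.
Qed.

(** The path cannot stay far out for long, by the cost in potential energy, and
    it is Hoelder continuous. *)
Lemma action_bounded (C : R) : 0 <= C -> exists M : R, forall V D, prim V D ->
  (action W V <= C%:E)%E -> forall t, `|V t| <= M.
Proof.
move=> C0; have [c c0 [M MW]] := W_infty_bound.
pose T := C / c + 1.
have T0 : 0 < T by rewrite ltr_wpDl// divr_ge0// ltW.
exists (`|M| + (1 + T * (2 * C))) => V D VD VC t; have [cV _ _] := VD.
have [Dc Vc] := action_le VD VC.
have [s /andP[ts st] Vs] : exists2 s, t <= s <= t + T & `|V s| <= M.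
  apply: contrapT => nos.
  have tT : t <= t + T by rewrite lerDl ltW.
  have := @pot_lower V t (t + T) c cV tT (ltW c0).
  have -> : t + T - t = T by ring.
  have inS s : t <= s <= t + T -> (c%:E <= W (V s))%E.
    move=> sT; apply: MW; rewrite ltNge; apply/negP => Ms.
    by apply: nos; exists s.
  move=> /(_ inS).
  rewrite leNgt => /negP; apply.
  have mI : measurable (`[t, t + T]%classic : set (measurableTypeR R)).
    exact: measurable_itv.
  apply: (le_lt_trans (le_trans (pot_sub cV mI) Vc)).
  rewrite lte_fin /T mulrDr mulr1 mulrCA mulfV ?gt_eqF// mulr1 ltrDl//.
have := action_holder s t VD Dc; set d := `|V t - V s| => d2.
have dT : d ^+ 2 <= T * (2 * C).
  apply: le_trans d2 _; rewrite ler_wpM2r ?mulr_ge0//.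
  by rewrite ler_norml; apply/andP; split; lra.
have d_le : d <= 1 + T * (2 * C).
  have := sqr_ge0 (d - 1); have : 0 <= d by exact: normr_ge0.
  nra.
rewrite -(subrK (V s) (V t)) (le_trans (ler_normD _ _))// addrC lerD//.
by rewrite (le_trans Vs)// ler_norm.
Qed.

End action.

(** * Lower semicontinuity of the action along an ultrafilter *)

Lemma ereal_le_real (R : realType) (x y : \bar R) :
  (forall a : R, (a%:E < x)%E -> (a%:E <= y)%E) -> (x <= y)%E.
Proof.
move=> xy; rewrite leNgt; apply/negP; case: x xy => [x| |//] xy; case: y xy => [y| |] //= xy.
- rewrite lte_fin => yx; have := xy ((x + y) / 2).
  rewrite lte_fin lee_fin; lra.
- by move=> _; have := xy (x - 1); rewrite lte_fin ltrBlDr ltrDl ltr01 => /(_ isT).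
- by move=> _; have := xy (y + 1); rewrite ltry lee_fin => /(_ isT); lra.
- by move=> _; have := xy 0; rewrite ltry => /(_ isT).
Qed.

Lemma ereal_split (R : realType) (k p : \bar R) (a C : R) : (0 <= k)%E ->
  (a%:E < p)%E -> (k + p <= C%:E)%E -> (k <= (C - a)%:E)%E.
Proof.
case: k => [k| |] //; case: p => [p| |] //=.
by rewrite lte_fin -EFinD !lee_fin; lra.
Qed.

Lemma weak_lim_norm (R : realType) (H : hilbertType R)
    (F : set_system nat) (FP : ProperFilter F) (v : nat -> H) u (K : R) :
  (forall h, inner (v n) h @[n --> F] --> inner u h) ->
  (\forall n \near F, `|v n| ^+ 2 <= K) -> `|u| ^+ 2 <= K.
Proof.
move=> vu vK.
have lim : 2 * inner (v n) u - `|u| ^+ 2 @[n --> F] --> 2 * inner u u - `|u| ^+ 2.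
  by apply: cvgB; [apply: cvgMl_tmp; exact: vu|exact: cvg_cst].
have -> : `|u| ^+ 2 = 2 * inner u u - `|u| ^+ 2 by rewrite inner_norm; ring.
apply: (ler_cvg_to lim (cvg_cst K)); apply: filterS vK => n; apply: le_trans.
by have := sqr_ge0 `|v n - u|; rewrite normB_sqr; lra.
Qed.

Section lsc.
Context (R : realType) (H : hilbertType R) (W : H -> \bar R).
Local Notation mu := (@lebesgue_measure R).
Hypothesis W_ge0 : forall u, (0 <= W u)%E.
Hypothesis W_lsc : weakly_lsc W.
Variables (G : set_system nat) (V D : nat -> R -> H) (s : nat -> R) (U : R -> H).
Hypothesis GU : UltraFilter G.
Hypothesis VD : forall n, prim (V n) (D n).
Hypothesis VU : forall t h, inner (V n (t + s n)) h @[n --> G] --> inner (U t) h.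

Let GP : ProperFilter G. Proof. exact: ultra_proper. Qed.

Lemma limit_holder (C : R) a b : (\forall n \near G, (kin (D n) <= C%:E)%E) ->
  `|U b - U a| ^+ 2 <= `|b - a| * (2 * C).
Proof.
move=> kC; apply: (@weak_lim_norm _ _ _ GP (fun n => V n (b + s n) - V n (a + s n))).
  move=> h; have -> : (fun n => inner (V n (b + s n) - V n (a + s n)) h) =
      (fun n => inner (V n (b + s n)) h - inner (V n (a + s n)) h).
    by apply/funext => n; rewrite innerBl.
  by rewrite innerBl; apply: cvgB; exact: VU.
apply: filterS kC => n kn.
have -> : b - a = (b + s n) - (a + s n) by ring.
exact: action_holder (VD n) kn.
Qed.

Lemma limit_continuous (C : R) : (\forall n \near G, (kin (D n) <= C%:E)%E) ->
  continuous U.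
Proof.
move=> kC t; apply/cvgrPdist_le => e e0.
have e2 : 0 < e ^+ 2 / (2 * `|C| + 1).
  by rewrite divr_gt0 ?exprn_gt0// ltr_wpDl// mulr_ge0.
near=> r.
have rt : `|t - r| <= e ^+ 2 / (2 * `|C| + 1).
  by near: r; exact: cvgr_dist_le.
have := @limit_holder C r t kC => h.
rewrite -(@ler_pXn2r _ 2)// ?nnegrE ?(ltW e0)//.
apply: (le_trans h).
apply: (@le_trans _ _ (`|t - r| * (2 * `|C| + 1))).
  by rewrite ler_wpM2l//; have := ler_norm C; lra.
by rewrite -ler_pdivlMr// ltr_wpDl// mulr_ge0.
Unshelve. all: by end_near. Qed.

(** The uniform Hoelder bound makes the convergence locally uniform in time. *)
Lemma joint_limit (C : R) t h : (\forall n \near G, (kin (D n) <= C%:E)%E) ->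
  inner (V p.2 (p.1 + s p.2)) h @[p --> (nbhs t, G)] --> inner (U t) h.
Proof.
move=> kC; apply/cvgrPdist_le => e e0.
have h1 : 0 < 2 * (`|h| + 1) by rewrite mulr_gt0// ltr_wpDl.
pose d := e / (2 * (`|h| + 1)).
have d0 : 0 < d by rewrite divr_gt0.
have C1 : 0 < 2 * `|C| + 1 by rewrite ltr_wpDl// mulr_ge0.
have e2 : 0 < d ^+ 2 / (2 * `|C| + 1) by rewrite divr_gt0 ?exprn_gt0.
have ee : 0 < e / 2 by rewrite divr_gt0.
have VUt : \forall n \near G, `|inner (U t) h - inner (V n (t + s n)) h| <= e / 2.
  by move/cvgrPdist_le : (@VU t h) => /(_ _ ee).
have rt : \forall r \near t, `|t - r| <= d ^+ 2 / (2 * `|C| + 1).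
  apply/nbhs_ballP; exists (d ^+ 2 / (2 * `|C| + 1)) => //= r.
  by rewrite -ball_normE /= => /ltW.
exists ([set r | `|t - r| <= d ^+ 2 / (2 * `|C| + 1)],
  [set n | (kin (D n) <= C%:E)%E /\
    `|inner (U t) h - inner (V n (t + s n)) h| <= e / 2]).
  by split => //=; exact: filterI.
move=> [r n] /= [rt_ [kn hn]].
have hold : `|V n (t + s n) - V n (r + s n)| <= d.
  rewrite -(@ler_pXn2r _ 2)// ?nnegrE ?(ltW d0)//.
  apply: (le_trans (action_holder (r + s n) (t + s n) (VD n) kn)).
  have -> : t + s n - (r + s n) = t - r by ring.
  apply: (@le_trans _ _ (`|t - r| * (2 * `|C| + 1))).
    by rewrite ler_wpM2l//; have := ler_norm C; lra.
  by rewrite -ler_pdivlMr.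
have -> : inner (U t) h - inner (V n (r + s n)) h =
    (inner (U t) h - inner (V n (t + s n)) h) +
    inner (V n (t + s n) - V n (r + s n)) h by rewrite innerBl; ring.
rewrite (le_trans (ler_normD _ _))// [leRHS]splitr lerD//.
rewrite (le_trans (abs_inner_le _ _))//.
apply: (@le_trans _ _ (d * `|h|)); first by rewrite ler_wpM2r.
apply: (@le_trans _ _ (d * (`|h| + 1))); first by rewrite ler_wpM2l ?ltW// ltrDl.
rewrite /d le_eqVlt; apply/orP; left; apply/eqP; field.
by rewrite gt_eqF// ltr_wpDl.
Qed.

(** Infima of W o U over shrinking balls increase to W o U.  They leave room in
    time, which near_trunc needs, and they are measurable because their strict
    sublevel sets are open. *)
Let ballinf k t : \bar R :=
  ereal_inf [set W (U r) | r in ball t (k.+1%:R^-1 : R)].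

(** Truncation at k keeps the bounds below finite where W is infinite. *)
Let trunc k t : \bar R := mine (ballinf k t) (k%:R)%:E.

Let ballinf_le k t r : ball t (k.+1%:R^-1 : R) r -> (ballinf k t <= W (U r))%E.
Proof. by move=> tr; apply: ereal_inf_lbound; exists r. Qed.

Let ballinf_ge0 k t : (0 <= ballinf k t)%E.
Proof. by apply: le_ereal_inf_tmp => _ [r _ <-]. Qed.

Let trunc_ge0 k t : (0 <= trunc k t)%E.
Proof. by rewrite /trunc le_min ballinf_ge0 lee_fin ler0n. Qed.

Let measurable_trunc k : measurable_fun [set: R] (trunc k).
Proof.
apply: measurable_mine; last exact: measurable_cst.
have -> : ballinf k = (fun t => - (- ballinf k t))%E.
  by apply/funext => t; rewrite oppeK.
apply: measurableT_comp; first exact: oppe_measurable.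
apply: lower_semicontinuous_measurable => t a.
rewrite lteNr => /ereal_inf_ltP[_ [r tr <-] Wr].
exists (ball r (k.+1%:R^-1 : R)) => [|t' rt'].
  apply: open_nbhs_nbhs; split; first exact: ball_open.
  exact: ball_sym.
rewrite lteNr; apply: le_lt_trans Wr.
by apply: ballinf_le; exact: ball_sym.
Qed.

Let trunc_le k t : (trunc k t <= W (U t))%E.
Proof.
by rewrite /trunc ge_min; apply/orP; left; apply: ballinf_le; exact: ballxx.
Qed.

Let trunc_homo t : {homo trunc ^~ t : k l / (k <= l)%N >-> (k <= l)%E}.
Proof.
move=> k l kl; rewrite /trunc le_min; apply/andP; split; rewrite ge_min.
  apply/orP; left; apply: le_ereal_inf => _ [r tr <-]; exists r => //.
  by apply: le_ball tr; rewrite lef_pV2 ?posrE// ler_nat.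
by apply/orP; right; rewrite lee_fin ler_nat.
Qed.

Let trunc_cvg t : continuous U -> trunc k t @[k --> \oo] --> W (U t).
Proof.
move=> cU; have := ereal_nondecreasing_cvgn (trunc_homo t).
suff -> : ereal_sup (range (trunc ^~ t)) = W (U t) by [].
apply/eqP; rewrite eq_le; apply/andP; split.
  by apply: ge_ereal_sup => _ [k _ <-]; exact: trunc_le.
apply: ereal_le_real => a aW.
have : \forall r \near t, (a%:E < W (U r))%E.
  apply: (weakly_lsc_cvg (nbhs_filter t) W_lsc _ aW) => h.
  by apply: innerl_cvg; exact: cU.
move=> /nbhs_ballP[e /= e0 eW].
have [k [ke ka]] : exists k : nat, (k.+1%:R^-1 : R) <= e /\ a <= k%:R.
  exists (Num.bound e^-1 + Num.bound `|a|)%N; split.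
    rewrite invf_ple ?posrE// (le_trans (ltW (archi_boundP _)))//.
      by rewrite invr_ge0 ltW.
    by rewrite ler_nat -addSn leqW// leq_addr.
  rewrite (le_trans (ler_norm _))// (le_trans (ltW (archi_boundP _)))//.
  by rewrite ler_nat leq_addl.
apply: (@le_trans _ _ (trunc k t)); last by apply: ereal_sup_ubound; exists k.
rewrite /trunc le_min lee_fin ka andbT; apply: le_ereal_inf_tmp => _ [r tr <-].
by apply/ltW/eW; exact: le_ball tr.
Qed.

(** Weak lower semicontinuity of W along the joint limit in (t, n), with the
    compactness of [- N, N]. *)
Let near_trunc k N (e C : R) : 0 < e -> (\forall n \near G, (kin (D n) <= C%:E)%E) ->
  \forall n \near G, forall t, `[- N, N]%classic t ->
    (trunc k t <= W (V n (t + s n)) + e%:E)%E.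
Proof.
move=> e0 kC.
have /compact_near_coveringP/(_ nat G (fun n t =>
    (trunc k t <= W (V n (t + s n)) + e%:E)%E)) : compact `[- N, N].
  exact: segment_compact.
apply => t _.
pose b := fine (mine (W (U t)) (k%:R)%:E).
have bE : b%:E = mine (W (U t)) (k%:R)%:E.
  rewrite /b fineK// ge0_fin_numE; last by rewrite le_min W_ge0 lee_fin ler0n.
  by rewrite gt_min ltry orbT.
have bW : ((b - e)%:E < W (U t))%E.
  apply: (@lt_le_trans _ _ b%:E); first by rewrite lte_fin ltrBlDr ltrDl.
  by rewrite bE ge_min lexx.
have joint := weakly_lsc_cvg _ W_lsc (fun h => @joint_limit C t h kC) bW.
have tk : \forall r \near t, ball t (k.+1%:R^-1 : R) r.
  by apply: nbhsx_ballx; rewrite invr_gt0.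
have [[A B] /= [At BG] AB] := joint.
exists (A `&` ball t (k.+1%:R^-1 : R), B) => /=.
  by split => //; exact: filterI.
move=> [r n] /= [[Ar tr] Bn].
have := AB (r, n) (conj Ar Bn) => /= bWr.
apply: (@le_trans _ _ b%:E).
  rewrite bE /trunc le_min; apply/andP; split; rewrite ge_min.
    by apply/orP; left; apply: ballinf_le; exact: ball_sym.
  by rewrite lexx orbT.
by rewrite -leeBlDr// -EFinB ltW.
Qed.

(** On each window compare through near_trunc, where the error is a constant,
    and let k tend to infinity by monotone convergence. *)
Lemma pot_lsc (c C : R) : (\forall n \near G, (kin (D n) <= C%:E)%E) ->
  (\forall n \near G, (pot W (V n) <= c%:E)%E) -> (pot W U <= c%:E)%E.
Proof.
move=> kC pc; have cU := limit_continuous kC.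
apply: integral_window_le => [||N]; [exact: measurable_pot|by []|].
set I := `[(- N%:R), N%:R]%classic : set R.
have mI : measurable (I : set (measurableTypeR R)) by exact: measurable_itv.
have mtr k : measurable_fun I (trunc k).
  by apply: measurable_funTS; exact: measurable_trunc.
have key k : (\int[mu]_(t in I) trunc k t <= c%:E)%E.
  apply/lee_addgt0Pr => e e0.
  pose d := e / (2 * N%:R + 1).
  have N1 : 0 < 2 * N%:R + 1 :> R by rewrite ltr_wpDl.
  have d0 : 0 < d by rewrite divr_gt0.
  have := near_trunc k N%:R d0 kC => nt.
  have [n [ntn pcn]] := filter_ex (filterI nt pc).
  have [cVn _ _] := VD n.
  have mV : measurable_fun [set: R] (fun t => W (V n (t + s n))).
    have cVs : continuous (fun t => V n (t + s n)).
      move=> t; apply: continuous_comp; last exact: cVn.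
      by apply: cvgD; [exact: cvg_id|exact: cvg_cst].
    exact: (@measurable_pot _ _ W W_lsc _ cVs).
  apply: (@le_trans _ _ (\int[mu]_(t in I) (W (V n (t + s n)) + d%:E))%E).
    apply: ge0_le_integral => //.
    - exact: mtr.
    - by apply: emeasurable_funD; [exact: measurable_funTS|exact: measurable_cst].
  rewrite ge0_integralD//; [|exact: measurable_funTS|by move=> t _; rewrite lee_fin ltW].
  apply: leeD.
    apply: le_trans pcn; rewrite /pot.
    rewrite (@ge0_integral_affine R 1 (s n) (fun t => W (V n t)))//; last first.
      exact: measurable_pot.
    rewrite mul1e; under [leRHS]eq_integral do rewrite mul1r.
    exact: ge0_subset_integral.
  have NN : - N%:R <= N%:R :> R by have : 0 <= (N%:R : R) by []; lra.
  rewrite -(EFin_itg _ _ (loc_int_cst d)) itg_cst// lee_fin /d.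
  by rewrite mulrAC ler_pdivrMr// ler_pM2l//; lra.
have : (\int[mu]_(t in I) trunc k t)%E @[k --> \oo] -->
    (\int[mu]_(t in I) W (U t))%E.
  have -> : (\int[mu]_(t in I) W (U t))%E =
      (\int[mu]_(t in I) limn (fun k => trunc k t))%E.
    by apply: eq_integral => t _; apply/esym/cvg_lim => //; exact: trunc_cvg.
  apply: cvg_monotone_convergence; first exact: mI.
  - exact: mtr.
  - by move=> k t _; exact: trunc_ge0.
  - by move=> t _ k l kl; exact: trunc_homo.
move=> lim; rewrite -(cvg_lim _ lim)//; apply: lime_le; first exact: (cvgP _ lim).
by apply: nearW => k; exact: key.
Qed.

(** The energy of the difference quotients of U is approximated, cell by
    cell, by that of the difference quotients of V n. *)
Lemma kin_lsc (C : R) : (\forall n \near G, (kin (D n) <= C%:E)%E) ->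
  exists2 D', prim U D' & (kin D' <= C%:E)%E.
Proof.
move=> kC; have cU := limit_continuous kC.
have cell m (i : int) (k : nat) (e : R) : 0 < e -> \forall n \near G,
    itg (fun t => `|dq U m t| ^+ 2) (gpt R m i) (gpt R m (i + k%:Z)) <=
    itg (fun t => `|D n t| ^+ 2) (gpt R m i + s n) (gpt R m (i + k%:Z) + s n) + e.
  elim: k e => [|k IH] e e0.
    by apply: nearW => n; rewrite addr0 !itgxx add0r ltW.
  have e2 : 0 < e / 2 by rewrite divr_gt0.
  have m0 := dlen_gt0 R m.
  have -> : i + k.+1%:Z = i + k%:Z + 1 by rewrite -addn1 PoszD addrA.
  rewrite gptS; set a := gpt R m (i + k%:Z).
  have ia : gpt R m i <= a by apply: gpt_le; rewrite lerDl.
  have ad : a <= a + dlen R m by rewrite lerDl dlen_ge0.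
  rewrite (itg_split (loc_int_sqr (dq_L2loc cU m)) ia ad) dq_sqr_cell//.
  set d := U (a + dlen R m) - U a.
  have lim : inner (V n (a + dlen R m + s n) - V n (a + s n)) d @[n --> G] -->
      inner d d.
    have -> : (fun n => inner (V n (a + dlen R m + s n) - V n (a + s n)) d) =
      (fun n => inner (V n (a + dlen R m + s n)) d - inner (V n (a + s n)) d).
      by apply/funext => n; rewrite innerBl.
    have -> : inner d d = inner (U (a + dlen R m)) d - inner (U a) d.
      by rewrite -innerBl.
    by apply: cvgB; exact: VU.
  have ed : 0 < dlen R m * (e / 4) by rewrite mulr_gt0 ?divr_gt0.
  have close : \forall n \near G, `|inner d d -
      inner (V n (a + dlen R m + s n) - V n (a + s n)) d| <= dlen R m * (e / 4).
    by move/cvgrPdist_le : lim => /(_ _ ed).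
  apply: (@filterS2 _ G (@filter_filter _ _ GP) _ _ _ _ (IH _ e2) close) => n h1 h2.
  have [cVn D2 _] := VD n.
  have iDn := loc_int_sqr D2.
  have ias : gpt R m i + s n <= a + s n by rewrite lerD2r.
  have ads : a + s n <= a + dlen R m + s n by rewrite lerD2r.
  rewrite (itg_split iDn ias ads).
  suff : (dlen R m)^-1 * `|d| ^+ 2 <=
    itg (fun t => `|D n t| ^+ 2) (a + s n) (a + dlen R m + s n) + e / 2.
    by move: h1; lra.
  have := prim_chord (VD n) ads.
  have -> : a + dlen R m + s n - (a + s n) = dlen R m by ring.
  set v := V n _ - V n _ => vD.
  rewrite -(ler_pM2l m0) mulrA mulfV ?gt_eqF// mul1r mulrDr.
  move: h2; rewrite -/v inner_norm ler_norml => /andP[_ h2].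
  have := sqr_ge0 `|v - d|; rewrite normB_sqr; move: vD h2.
  by move: (dlen R m * itg _ _ _) => X; lra.
have bound m (N : nat) : itg (fun t => `|dq U m t| ^+ 2) (- N%:R) N%:R <= 2 * C.
  apply/ler_addgt0Pr => e e0.
  have NE : (N%:R : R) = gpt R m (- N%:Z * (2 ^ m)%:Z + (2 * N * 2 ^ m)%N%:Z).
    have -> : - N%:Z * (2 ^ m)%:Z + (2 * N * 2 ^ m)%N%:Z = N%:Z * (2 ^ m)%:Z.
      by rewrite !PoszM; ring.
    by rewrite -gpt_nat.
  have NNE : - (N%:R : R) = gpt R m (- N%:Z * (2 ^ m)%:Z) by rewrite -gpt_nat intrN.
  have GF : Filter G := @filter_filter _ _ GP.
  have [n [h kn]] := @filter_ex _ G GP _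
    (@filterI _ G GF _ _ (@cell m (- N%:Z * (2 ^ m)%:Z) (2 * N * 2 ^ m)%N e e0) kC).
  rewrite NNE NE (le_trans h)// lerD2r.
  by apply: kin_itg => //; case: (VD n).
have [D' UD' D'C] := prim_of_dq_bound cU bound.
exists D' => //; have [_ D2 _] := UD'.
rewrite /kin; under eq_integral do rewrite EFinM.
rewrite ge0_integralZl//; last first.
  by apply/measurable_EFinP; apply: strongly_measurable_sqr_norm; case: D2.
apply: (@le_trans _ _ (2^-1%:E * (2 * C)%:E)%E).
  by apply: lee_wpmul2l => //; rewrite lee_fin.
by rewrite -EFinM lee_fin mulrA mulVf// mul1r.
Qed.

(** Along an ultrafilter the potential energies are eventually above
    pot W U - e: otherwise they would be eventually below, against pot_lsc.
    What remains of C bounds the kinetic energies. *)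
Lemma action_lsc (C : R) : (\forall n \near G, (action W (V n) <= C%:E)%E) ->
  exists2 D', prim U D' & (action W U <= C%:E)%E.
Proof.
move=> aC.
have kC : \forall n \near G, (kin (D n) <= C%:E)%E.
  by apply: filterS aC => n /(action_le W_ge0 W_lsc (VD n))[].
have pC : \forall n \near G, (pot W (V n) <= C%:E)%E.
  by apply: filterS aC => n /(action_le W_ge0 W_lsc (VD n))[].
have pU := pot_lsc kC pC.
have [D' UD' _] := kin_lsc kC; exists D' => //.
rewrite (action_prim W_ge0 W_lsc UD').
pose A := fine (pot W U).
have AE : pot W U = A%:E.
  by rewrite /A fineK// ge0_fin_numE ?pot_ge0// (le_lt_trans pU)// ltry.
apply/lee_addgt0Pr => e e0; rewrite AE.
have near_pot : \forall n \near G, ((A - e)%:E < pot W (V n))%E.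
  have [//|nG] := in_ultra_setVsetC [set n | ((A - e)%:E < pot W (V n))%E] GU.
  have : \forall n \near G, (pot W (V n) <= (A - e)%:E)%E.
    by apply: filterS nG => n /negP; rewrite -leNgt.
  by move=> /(pot_lsc kC); rewrite AE lee_fin; lra.
have : \forall n \near G, (kin (D n) <= (C - (A - e))%:E)%E.
  apply: (@filterS2 _ G (@filter_filter _ _ GP) _ _ _ _ near_pot aC) => n /= pn.
  rewrite (action_prim W_ge0 W_lsc (VD n)).
  exact: ereal_split (kin_ge0 _) pn.
move=> /kin_lsc[D'' UD'' kD''].
have [_ D2 _] := UD'; have [_ D2'' _] := UD''.
rewrite (kin_ae D2 D2'' (prim_unique UD' UD'')).
apply: (@le_trans _ _ ((C - (A - e))%:E + A%:E)%E); first exact: leeD2r.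
by rewrite -!EFinD lee_fin; lra.
Qed.

End lsc.

(** * Behaviour at infinity *)

(** s is the first time in [a, b] at which g reaches the level l. *)
Lemma first_hit (R : realType) (g : R -> R) a b l : continuous g -> a <= b ->
  g a <= l -> l <= g b ->
  exists2 s, a <= s <= b & g s = l /\ forall t, a <= t <= s -> g t <= l.
Proof.
move=> cg ab gal lgb; pose S := [set t | a <= t <= b /\ l <= g t].
have Sb : S b by split => //; rewrite ab lexx.
have infS : has_inf S by split; [exists b|exists a => t [/andP[]]].
have sb : inf S <= b by apply: ge_inf; [case: infS|].
have as_ : a <= inf S by apply: lb_le_inf; [exists b|move=> t [/andP[]]].
have before t : a <= t -> t < inf S -> g t < l.
  move=> at_ ts; rewrite ltNge; apply/negP => lgt.
  suff : inf S <= t by rewrite leNgt ts.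
  apply: ge_inf; [by case: infS|split => //].
  by rewrite at_/= (le_trans (ltW ts)).
have gs : g (inf S) = l.
  apply/eqP; rewrite eq_le; apply/andP; split; rewrite leNgt; apply/negP => h.
    have sa : a < inf S.
      by rewrite lt_neqAle as_ andbT; apply/eqP => sE; move: h; rewrite -sE ltNge gal.
    have /nbhs_ballP[d /= d0 dP] : \forall t \near inf S, l < g t.
      exact: (cvgr_gt _ (cg (inf S)) _ h).
    pose t := Num.max a (inf S - d / 2).
    have ts : t < inf S by rewrite /t gt_max sa; lra.
    have at_ : a <= t by rewrite /t le_max lexx.
    have := before t at_ ts; apply/negP; rewrite -leNgt ltW//; apply: dP.
    have : inf S - d / 2 <= t by rewrite /t le_max lexx orbT.
    by rewrite -ball_normE /= ger0_norm; lra.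
  have /nbhs_ballP[d /= d0 dP] : \forall t \near inf S, g t < l.
    exact: (cvgr_lt _ (cg (inf S)) _ h).
  have [t [/andP[at_ tb] lgt] td] := inf_adherent d0 infS.
  have st : inf S <= t by apply: ge_inf; [case: infS|split; [rewrite at_ tb|]].
  have := dP t; rewrite -ball_normE /= ler0_norm; last lra.
  by move=> /(_ ltac:(lra)); rewrite ltNge lgt.
exists (inf S); first by rewrite as_.
split => // t /andP[at_]; rewrite le_eqVlt => /predU1P[->|ts]; first by rewrite gs.
exact/ltW/before.
Qed.

Section infinity.
Context (R : realType) (H : hilbertType R) (W : H -> \bar R).
Local Notation mu := (@lebesgue_measure R).
Hypothesis W_ge0 : forall u, (0 <= W u)%E.
Hypothesis W_lsc : weakly_lsc W.
Hypothesis W_infty : (0 < limf_einf W (norm_infty H))%E.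
Implicit Types (V D U : R -> H) (a b c x y z t : R) (h : H).

Lemma pot_tail V (C e : R) : continuous V -> (pot W V <= C%:E)%E -> 0 < e ->
  exists N : nat, forall a b, a <= b -> N%:R < a \/ b < - N%:R ->
    (\int[mu]_(t in `[a, b]) W (V t) < e%:E)%E.
Proof.
move=> cV VC e0; apply: contrapT => noN.
have mW := measurable_pot W_lsc cV.
pose P := fine (pot W V).
have PE : pot W V = P%:E.
  by rewrite /P fineK// ge0_fin_numE ?pot_ge0// (le_lt_trans VC)// ltry.
have : (pot W V <= (P - e)%:E)%E.
  apply: integral_window_le => // N.
  have [a [b [ab abN eab]]] : exists a b, [/\ a <= b, N%:R < a \/ b < - N%:R &
      (e%:E <= \int[mu]_(t in `[a, b]) W (V t))%E].
    apply: contrapT => nab; apply: noN; exists N => a b ab abN.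
    by rewrite ltNge; apply/negP => eab; apply: nab; exists a, b.
  set I := `[(- N%:R), N%:R]%classic : set R.
  set J := `[a, b]%classic : set R.
  have mI : measurable (I : set (measurableTypeR R)) by exact: measurable_itv.
  have mJ : measurable (J : set (measurableTypeR R)) by exact: measurable_itv.
  have IJ : [disjoint I & J].
    apply/disj_setPS => t []; rewrite /I /J /= !in_itv/= => /andP[t1 t2] /andP[t3 t4].
    by case: abN; lra.
  have := pot_sub W_ge0 W_lsc cV (measurableU _ _ mI mJ).
  rewrite ge0_integral_setU//; last exact: measurable_funTS.
  move=> h; rewrite -(@leeD2rE _ e%:E)// -EFinD subrK -PE.
  by apply: le_trans h; exact: leeD2l.
by rewrite PE lee_fin; lra.
Qed.

(** W is bounded below on S, and by the Hoelder bound each visit to S' keeps the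
    path in S for a fixed time: a fixed cost, which the tail of the potential
    energy cannot pay. *)
Lemma eventually_leaves (S S' : set H) (r : R) : ultra_closed S ->
  (forall u, S u -> W u <> 0%E) -> 0 < r ->
  (forall u v, S' u -> `|v - u| <= r -> S v) ->
  forall V D (C : R), prim V D -> (kin D <= C%:E)%E -> (pot W V <= C%:E)%E ->
  exists N : nat, forall t, N%:R < `|t| -> ~ S' (V t).
Proof.
move=> cS S0 r0 SS' V D C VD kC pC; have [cV _ _] := VD.
have [c c0 cW] := W_coercive W_ge0 W_lsc W_infty cS S0.
pose eta := r ^+ 2 / (2 * `|C| + 1).
have C1 : 0 < 2 * `|C| + 1 by rewrite ltr_wpDl// mulr_ge0.
have eta0 : 0 < eta by rewrite divr_gt0// exprn_gt0.
have stay t t' : S' (V t) -> `|t' - t| <= eta -> S (V t').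
  move=> S't tt'; apply: SS' S't _.
  rewrite -(@ler_pXn2r _ 2)// ?nnegrE ?(ltW r0)//.
  apply: (le_trans (action_holder t t' VD kC)).
  apply: (@le_trans _ _ (`|t' - t| * (2 * `|C| + 1))).
    by rewrite ler_wpM2l//; have := ler_norm C; lra.
  by rewrite -ler_pdivlMr.
have ce : 0 < c * eta by rewrite mulr_gt0.
have [N NP] := pot_tail cV pC ce; exists N => t Nt S't.
have [t0|t0] := leP 0 t.
  have tt : t <= t + eta by lra.
  have := NP t (t + eta) tt; rewrite ger0_norm// in Nt.
  move=> /(_ (or_introl Nt)); apply/negP; rewrite -leNgt.
  have := @pot_lower _ _ _ W_lsc V t (t + eta) c cV tt (ltW c0).
  rewrite (_ : t + eta - t = eta); last by ring.
  by apply => s /andP[ts st]; apply/cW/(stay t) => //; rewrite ger0_norm; lra.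
have tt : t - eta <= t by lra.
have := NP (t - eta) t tt; rewrite ltr0_norm// in Nt.
have Nt' : t < - N%:R by lra.
move=> /(_ (or_intror Nt')); apply/negP; rewrite -leNgt.
have := @pot_lower _ _ _ W_lsc V (t - eta) t c cV tt (ltW c0).
rewrite (_ : t - (t - eta) = eta); last by ring.
by apply => s /andP[ts st]; apply/cW/(stay t) => //; rewrite ler0_norm; lra.
Qed.

(** The part of A where <u, h> differs from <e, h> by at least eps / 2 is weakly
    closed and avoids the zeros of W, so it is left for good. *)
Lemma eventually_weakly_close (A A' : set H) (r : R) (e : H) : ultra_closed A ->
  (forall u, A u -> W u = 0%E -> u = e) -> 0 < r ->
  (forall u v, A' u -> `|v - u| <= r -> A v) ->
  forall V D (C : R), prim V D -> (kin D <= C%:E)%E -> (pot W V <= C%:E)%E ->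
  forall h (eps : R), 0 < eps ->
  exists N : nat, forall t, N%:R < `|t| -> A' (V t) ->
    `|inner (V t) h - inner e h| < eps.
Proof.
move=> cA A0 r0 AA' V D C VD kC pC h eps eps0.
pose B (d : R) := [set u | inner e h + d <= inner u h] `|`
                  [set u | inner u h <= inner e h - d].
pose rho := Num.min r (eps / (2 * (`|h| + 1))).
have h1 : 0 < `|h| + 1 by rewrite ltr_wpDl.
have rho0 : 0 < rho by rewrite /rho lt_min r0 divr_gt0// mulr_gt0.
have cS : ultra_closed (A `&` B (eps / 2)).
  apply: ultra_closedI => //; apply: ultra_closedU.
    exact: ultra_closed_ge.
  exact: ultra_closed_le.
have S0 u : (A `&` B (eps / 2)) u -> W u <> 0%E.
  by move=> [Au Bu] /(A0 _ Au) ue; case: Bu => /=; rewrite ue; lra.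
have SS' u v : (A' `&` B eps) u -> `|v - u| <= rho -> (A `&` B (eps / 2)) v.
  move=> [A'u Bu] vu; split.
    by apply: AA' A'u _; apply: le_trans vu _; rewrite /rho ge_min lexx.
  have : `|inner v h - inner u h| <= eps / 2.
    rewrite -innerBl (le_trans (abs_inner_le _ _))//.
    apply: (@le_trans _ _ (rho * (`|h| + 1))).
      by rewrite ler_pM// lerDl.
    apply: (@le_trans _ _ (eps / (2 * (`|h| + 1)) * (`|h| + 1))).
      by rewrite ler_wpM2r ?(ltW h1)// /rho ge_min lexx orbT.
    rewrite le_eqVlt; apply/orP; left; apply/eqP; field.
    by rewrite gt_eqF.
  rewrite ler_norml => /andP[v1 v2].
  by case: Bu => /= Bu; [left|right] => /=; lra.
have [N NP] := eventually_leaves cS S0 rho0 SS' VD kC pC.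
exists N => t Nt A't; rewrite ltNge; apply/negP => epst.
apply: (NP t Nt); split => //; move: epst; rewrite ler_normr => /orP[]; [left|right] => /=; lra.
Qed.

End infinity.

(** * Existence of a minimizer *)

Section existence.
Context (R : realType) (H : hilbertType R) (W : H -> \bar R) (em ep : H).
Local Notation mu := (@lebesgue_measure R).
Hypothesis W_ge0 : forall u, (0 <= W u)%E.
Hypothesis W_lsc : weakly_lsc W.
Hypothesis em_neq_ep : em <> ep.
Hypothesis W_zeros : forall u, W u = 0%E <-> u = em \/ u = ep.
Hypothesis W_infty : (0 < limf_einf W (norm_infty H))%E.
Implicit Types (V D U : R -> H) (a b c x y z t : R) (h : H).

Let l0 := `|ep - em|.
Let nn := l0^-1 *: (ep - em).

Definition height u : R := inner (u - em) nn.

Let l0_gt0 : 0 < l0.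
Proof. by rewrite /l0 normr_gt0 subr_eq0; apply/eqP => /esym. Qed.

Let nn_norm : `|nn| = 1.
Proof. by rewrite /nn normrZ gtr0_norm ?invr_gt0// mulVf ?gt_eqF. Qed.

Lemma height_em : height em = 0.
Proof. by rewrite /height subrr inner0l. Qed.

Lemma height_ep : height ep = l0.
Proof.
by rewrite /height innerZr inner_norm -/l0 expr2 mulrA mulVf ?gt_eqF// mul1r.
Qed.

Lemma heightB u v : height u - height v = inner (u - v) nn.
Proof. by rewrite /height !innerBl; ring. Qed.

Lemma height_dist u v : `|height u - height v| <= `|u - v|.
Proof. by rewrite heightB (le_trans (abs_inner_le _ _))// nn_norm mulr1. Qed.

Lemma height_continuous V : continuous V -> continuous (fun t => height (V t)).
Proof.
move=> cV t; rewrite /height; apply: innerl_cvg.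
by apply: cvgB; [exact: cV|exact: cvg_cst].
Qed.

Lemma ultra_closed_height_ge a : ultra_closed [set u | a <= height u].
Proof.
have -> : [set u | a <= height u] = [set u | a + inner em nn <= inner u nn].
  by apply/seteqP; split => u; rewrite /height /= innerBl lerBrDr.
exact: ultra_closed_ge.
Qed.

Lemma ultra_closed_height_le a : ultra_closed [set u | height u <= a].
Proof.
have -> : [set u | height u <= a] = [set u | inner u nn <= a + inner em nn].
  by apply/seteqP; split => u; rewrite /height /= innerBl lerBlDr.
exact: ultra_closed_le.
Qed.

Let slab (d : R) := [set u | d <= height u] `&` [set u | height u <= l0 - d].

Let slab_closed d : ultra_closed (slab d).
Proof.
apply: ultra_closedI; [exact: ultra_closed_height_ge|exact: ultra_closed_height_le].
Qed.

Let slab_W d u : 0 < d -> slab d u -> W u <> 0%E.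
Proof.
move=> d0 [/= h1 h2] /W_zeros[uE|uE]; move: h1 h2; rewrite uE.
  by rewrite height_em; lra.
by rewrite height_ep; lra.
Qed.

Let slab_near u v : slab (l0 / 4) u -> `|v - u| <= l0 / 8 -> slab (l0 / 8) v.
Proof.
move=> [/= h1 h2] vu; have := le_trans (height_dist v u) vu.
by rewrite ler_norml => /andP[v1 v2]; split => /=; lra.
Qed.

Lemma admissibleP V : admissible em ep V <->
  H1loc V /\ exists tm tp : R, [/\ tm < tp,
    forall t, t <= tm -> height (V t) <= 3 * l0 / 4 &
    forall t, tp <= t -> l0 / 4 <= height (V t)].
Proof. by []. Qed.

(** ** Limits at infinity *)

Section limits.
Variables (V D : R -> H) (C : R).
Hypothesis VD : prim V D.
Hypothesis kC : (kin D <= C%:E)%E.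
Hypothesis pC : (pot W V <= C%:E)%E.

Lemma eventually_off_slab : exists N : nat, forall t, N%:R < `|t| ->
  ~ slab (l0 / 4) (V t).
Proof.
have l4 : 0 < l0 / 4 by rewrite divr_gt0.
have l8 : 0 < l0 / 8 by rewrite divr_gt0.
exact: (eventually_leaves W_ge0 W_lsc W_infty (@slab_closed (l0 / 8))
  (fun u => @slab_W _ u l8) l8 slab_near VD kC pC).
Qed.

Lemma weakly_to_ep h (eps : R) : 0 < eps -> exists N : nat, forall t,
  N%:R < `|t| -> l0 / 4 <= height (V t) -> `|inner (V t) h - inner ep h| < eps.
Proof.
move=> eps0; have l8 : 0 < l0 / 8 by rewrite divr_gt0.
have A0 u : [set u | l0 / 8 <= height u] u -> W u = 0%E -> u = ep.
  by move=> /= hu /W_zeros[uE|//]; exfalso; move: hu; rewrite uE height_em; lra.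
have AA' u v : [set u | l0 / 4 <= height u] u -> `|v - u| <= l0 / 8 ->
    [set u | l0 / 8 <= height u] v.
  move=> /= hu vu; have := le_trans (height_dist v u) vu.
  by rewrite ler_norml => /andP[v1 v2]; lra.
exact: (eventually_weakly_close W_ge0 W_lsc W_infty
  (@ultra_closed_height_ge _) A0 l8 AA' VD kC pC h eps0).
Qed.

Lemma weakly_to_em h (eps : R) : 0 < eps -> exists N : nat, forall t,
  N%:R < `|t| -> height (V t) <= 3 * l0 / 4 -> `|inner (V t) h - inner em h| < eps.
Proof.
move=> eps0; have l8 : 0 < l0 / 8 by rewrite divr_gt0.
have A0 u : [set u | height u <= 7 * l0 / 8] u -> W u = 0%E -> u = em.
  by move=> /= hu /W_zeros[//|uE]; exfalso; move: hu; rewrite uE height_ep; lra.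
have AA' u v : [set u | height u <= 3 * l0 / 4] u -> `|v - u| <= l0 / 8 ->
    [set u | height u <= 7 * l0 / 8] v.
  move=> /= hu vu; have := le_trans (height_dist v u) vu.
  by rewrite ler_norml => /andP[v1 v2]; lra.
exact: (eventually_weakly_close W_ge0 W_lsc W_infty
  (@ultra_closed_height_le _) A0 l8 AA' VD kC pC h eps0).
Qed.

Lemma weak_cvg_pinfty tp : (forall t, tp <= t -> l0 / 4 <= height (V t)) ->
  weak_cvg V +oo ep.
Proof.
move=> Vp; apply: weak_cvgP => h; apply/cvgrPdist_lt => e e0.
have [N NP] := weakly_to_ep h e0.
near=> t.
have Nt : N%:R < t by near: t; apply: nbhs_pinfty_gt; exact: num_real.
have tpt : tp <= t by near: t; apply: nbhs_pinfty_ge; exact: num_real.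
by rewrite distrC; apply: NP; [exact: lt_le_trans Nt (ler_norm _)|exact: Vp].
Unshelve. all: by end_near. Qed.

Lemma weak_cvg_ninfty tm : (forall t, t <= tm -> height (V t) <= 3 * l0 / 4) ->
  weak_cvg V -oo em.
Proof.
move=> Vm; apply: weak_cvgP => h; apply/cvgrPdist_lt => e e0.
have [N NP] := weakly_to_em h e0.
near=> t.
have Nt : t < - N%:R by near: t; apply: nbhs_ninfty_lt; exact: num_real.
have tmt : t <= tm by near: t; apply: nbhs_ninfty_le; exact: num_real.
rewrite distrC; apply: NP; last exact: Vm.
by rewrite -normrN (lt_le_trans _ (ler_norm _))// ltrNr.
Unshelve. all: by end_near. Qed.

(** A path that stays above l0 / 4 and eventually leaves the slab is above it. *)
Lemma eventually_high tp t0 : (forall t, tp <= t -> l0 / 4 <= height (V t)) ->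
  exists2 b, t0 <= b & 3 * l0 / 4 <= height (V b).
Proof.
move=> Vp; have l4 : 0 < l0 / 4 by rewrite divr_gt0.
have [N NP] := weakly_to_ep nn l4.
pose b := Num.max (Num.max t0 tp) (N%:R + 1).
have bN : N%:R + 1 <= b by rewrite le_max lexx orbT.
have btp : tp <= b by rewrite !le_max lexx orbT.
exists b; first by rewrite !le_max lexx.
have Nb : N%:R < `|b| by have := ler_norm b; lra.
have := NP b Nb (Vp b btp); rewrite -innerBl -heightB height_ep.
by rewrite ltr_norml => /andP[h1 h2]; lra.
Qed.

(** Beyond some time the path does not meet the slab, so by continuity it stays
    on one side of it. *)
Lemma eventually_low :
  ~ (exists tp, forall t, tp <= t -> l0 / 4 <= height (V t)) ->
  exists tp, forall t, tp <= t -> height (V t) < l0 / 4.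
Proof.
move=> noT; have [cV _ _] := VD; have [N NP] := eventually_off_slab.
have [t1 [Nt1 t1l]] : exists t1, N%:R + 1 <= t1 /\ height (V t1) < l0 / 4.
  apply: contrapT => no; apply: noT; exists (N%:R + 1) => t Nt.
  by rewrite leNgt; apply/negP => tl; apply: no; exists t.
exists t1 => t t1t; rewrite ltNge; apply/negP => ht.
have [s /andP[t1s st] [sE _]] := first_hit (height_continuous cV) t1t (ltW t1l) ht.
have Ns : N%:R < `|s| by have := ler_norm s; lra.
by apply: (NP s Ns); split; rewrite /= sE//; have := l0_gt0; lra.
Qed.

End limits.

(** ** Selection of a minimizing profile *)

Section selection.
Variables (G : set_system nat) (V : nat -> R -> H) (m : R).
Hypothesis GU : UltraFilter G.
Hypothesis ooG : \oo `<=` G.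
Hypothesis Vadm : forall n, admissible em ep (V n).
Hypothesis Vm : forall n, (action W (V n) <= (m + n.+1%:R^-1)%:E)%E.

Let GP : ProperFilter G. Proof. exact: ultra_proper. Qed.
Let GF : Filter G := @filter_filter _ _ GP.
Let D n := weak_deriv (V n).
Let C := m + 1.

Let VD n : prim (V n) (D n).
Proof. by apply: weak_derivP; case: (Vadm n). Qed.

Let VC n : (action W (V n) <= C%:E)%E.
Proof.
by apply: le_trans (Vm n) _; rewrite lee_fin lerD2l invf_le1 ?ler1n.
Qed.

Let kC n : (kin (D n) <= C%:E)%E.
Proof. by have [] := action_le W_ge0 W_lsc (VD n) (VC n). Qed.

Let pC n : (pot W (V n) <= C%:E)%E.
Proof. by have [] := action_le W_ge0 W_lsc (VD n) (VC n). Qed.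

Let C0 : 0 <= C.
Proof. by rewrite -lee_fin; apply: le_trans (kC 0); exact: kin_ge0. Qed.

Let is_limit (s : nat -> R) U :=
  forall t h, inner (V n (t + s n)) h @[n --> G] --> inner (U t) h.

Let limit_exists (s : nat -> R) : exists U, is_limit s U.
Proof.
have [M MP] := action_bounded W_ge0 W_lsc W_infty C0.
have /choice[U UP] : forall t, exists u, forall h,
    inner (V n (t + s n)) h @[n --> G] --> inner u h.
  move=> t; apply: (@ultra_weak_limit _ _ _ _ GU _ M).
  by apply: nearW => n; exact: MP (VD n) (VC n) _.
by exists U => t h; exact: UP.
Qed.

Let height_lim s U t : is_limit s U ->
  height (V n (t + s n)) @[n --> G] --> height (U t).
Proof.
move=> sU; rewrite /height innerBl.
have -> : (fun n => inner (V n (t + s n) - em) nn) =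
    (fun n => inner (V n (t + s n)) nn - inner em nn).
  by apply/funext => n; rewrite innerBl.
by apply: cvgB; [exact: sU|exact: cvg_cst].
Qed.

Let limit_action s U : is_limit s U -> exists2 D', prim U D' & (action W U <= m%:E)%E.
Proof.
move=> sU.
have key e : 0 < e -> exists2 D', prim U D' & (action W U <= (m + e)%:E)%E.
  move=> e0; apply: (action_lsc W_ge0 W_lsc GU VD sU).
  apply: ooG; have /cvgrPdist_lt/(_ _ e0) := @cvg_harmonic R.
  apply: filterS => n /=; rewrite sub0r normrN ger0_norm ?invr_ge0// => ne.
  by apply: le_trans (Vm n) _; rewrite lee_fin lerD2l ltW.
have [D' UD' _] := key 1 ltr01; exists D' => //.
by apply/lee_addgt0Pr => e e0; have [_ _] := key e e0; rewrite EFinD.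
Qed.

Let good U := [/\ exists D', prim U D', (action W U <= m%:E)%E &
  exists tm tp : R, [/\ tm < tp,
    forall t, t <= tm -> height (U t) <= 3 * l0 / 4 &
    forall t, tp <= t -> l0 / 4 <= height (U t)]].

(** By the Hoelder bound, a profile at height 3 l0 / 4 has been in the slab
    between the heights l0 / 8 and 7 l0 / 8 for a time eta. *)
Let crossing_cost : exists eta kappa : R, [/\ 0 < eta, 0 < kappa &
  forall n t, height (V n t) = 3 * l0 / 4 ->
    (kappa%:E <= \int[mu]_(r in `[(t - eta)%R, t]) W (V n r))%E].
Proof.
have l8 : 0 < l0 / 8 by rewrite divr_gt0.
have [c c0 cW] := W_coercive W_ge0 W_lsc W_infty (@slab_closed (l0 / 8))
  (fun u => @slab_W _ u l8).
have C1 : 0 < 2 * C + 1 by rewrite ltr_wpDl// mulr_ge0.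
pose eta := (l0 / 8) ^+ 2 / (2 * C + 1).
have eta0 : 0 < eta by rewrite divr_gt0// exprn_gt0.
exists eta, (c * eta); split => // [|n t tE]; first by rewrite mulr_gt0.
have [cV _ _] := VD n.
have tt : t - eta <= t by lra.
have := @pot_lower _ _ _ W_lsc (V n) (t - eta) t c cV tt (ltW c0).
rewrite (_ : t - (t - eta) = eta); last by ring.
apply => r /andP[r1 r2]; apply: cW.
apply: (@slab_near (V n t)); first by split; rewrite /= tE; have := l0_gt0; lra.
rewrite -(@ler_pXn2r _ 2)// ?nnegrE ?(ltW l8)//.
apply: (le_trans (action_holder t r (VD n) (kC n))).
apply: (@le_trans _ _ (eta * (2 * C + 1))).
  apply: ler_pM => //; first by rewrite mulr_ge0.
    by rewrite ler0_norm; lra.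
  by rewrite lerDl.
by rewrite /eta -mulrA mulVf ?mulr1// gt_eqF.
Qed.

(** The profiles are seen from the times s n, where they cross the height
    3 l0 / 4 with at least j kappa of potential energy behind them.  The bound
    on the past of the limit makes the first condition of admissibility
    automatic. *)
Let stage (kappa : R) (j : nat) := exists s U, [/\ is_limit s U,
  \forall n \near G, height (V n (s n)) = 3 * l0 / 4 /\
    ((j%:R * kappa)%:E <= \int[mu]_(r in `]-oo, s n]) W (V n r))%E &
  forall t, t <= 0 -> height (U t) <= 3 * l0 / 4].

Let stage0 kappa : stage kappa 0.
Proof.
have /choice[s sP] : forall n, exists s, height (V n s) = 3 * l0 / 4 /\
    forall t, t <= s -> height (V n t) <= 3 * l0 / 4.
  move=> n; have [_ [tm [tp [_ Vtm Vtp]]]] := Vadm n; have [cV _ _] := VD n.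
  have [b tmb bh] := eventually_high (VD n) (kC n) (pC n) tm Vtp.
  have [s /andP[tms _] [sE sP]] :=
    first_hit (height_continuous cV) tmb (Vtm tm (lexx _)) bh.
  exists s; split => // t ts; have [ttm|tmt] := leP t tm; first exact: Vtm.
  by apply: sP; rewrite (ltW tmt).
have [U sU] := limit_exists s; exists s, U; split => //.
  apply: nearW => n; split; first by case: (sP n).
  by rewrite mul0r; apply: integral_ge0 => r _.
move=> t t0; have h2 : (fun=> 3 * l0 / 4) @ G --> 3 * l0 / 4 by exact: cvg_cst.
apply: (ler_cvg_to (height_lim (t := t) sU) h2).
by apply: nearW => n; apply: (sP n).2; lra.
Qed.

(** If the limit does not end up above the slab it ends up below, and the next
    crossings of the profiles occur infinitely later.  The energy spent just
    before them is disjoint from the energy counted so far. *)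
Let stageS eta kappa j : 0 < eta -> 0 < kappa ->
  (forall n t, height (V n t) = 3 * l0 / 4 ->
    (kappa%:E <= \int[mu]_(r in `[(t - eta)%R, t]) W (V n r))%E) ->
  stage kappa j -> (exists U, good U) \/ stage kappa j.+1.
Proof.
move=> eta0 kappa0 cost [s [U [sU sP U0]]].
have [D' UD' aU] := limit_action sU.
have [kU pU] := action_le W_ge0 W_lsc UD' aU.
have [[tp Utp]|noT] := pselect
    (exists tp, forall t, tp <= t -> l0 / 4 <= height (U t)).
  left; exists U; split => //; first by exists D'.
  exists 0, (Num.max tp 1); split => //; first by rewrite lt_max ltr01 orbT.
  by move=> t; rewrite ge_max => /andP[tpt _]; exact: Utp.
right; have [T UT0] := eventually_low UD' kU pU noT.
(* s' n is the next crossing of V n after T + s n, when V n is back below. *)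
have /choice[s' s'P] : forall n, exists s', height (V n (T + s n)) <= 3 * l0 / 4 ->
    [/\ T + s n <= s', height (V n s') = 3 * l0 / 4 &
      forall t, T + s n <= t -> t <= s' -> height (V n t) <= 3 * l0 / 4].
  move=> n; have [_ [tm [tp [_ Vtm Vtp]]]] := Vadm n; have [cV _ _] := VD n.
  have [b tb bh] := eventually_high (VD n) (kC n) (pC n) (T + s n) Vtp.
  have [hT|hT] := leP (height (V n (T + s n))) (3 * l0 / 4); last by exists 0.
  have [s' /andP[ts' _] [s'E s'P]] :=
    first_hit (height_continuous cV) tb hT bh.
  by exists s' => _; split => // t t1 t2; apply: s'P; rewrite t1.
have l0p := l0_gt0.
have nearT : \forall n \near G, height (V n (T + s n)) <= 3 * l0 / 4.
  have UT : height (U T) < 3 * l0 / 4 by have := UT0 T (lexx _); lra.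
  have hn : \forall n \near G, height (V n (T + s n)) < 3 * l0 / 4.
    exact: (cvgr_lt _ (height_lim (t := T) sU) _ UT).
  by apply: filterS hn => n /ltW.
(* On [T, K] the limit is strictly below the crossing height, hence so are the
   profiles, uniformly. *)
have far K : \forall n \near G, s n + K < s' n.
  have : \forall n \near G, forall t, `[T, K]%classic t ->
      height (V n (t + s n)) < 3 * l0 / 4.
    have /compact_near_coveringP/(_ nat G (fun n t =>
      height (V n (t + s n)) < 3 * l0 / 4)) : compact `[T, K].
      exact: segment_compact.
    apply => t; rewrite /= in_itv/= => /andP[Tt _].
    have hU : height (U t) < 3 * l0 / 4 by have := UT0 t Tt; lra.
    have kCn : \forall n \near G, (kin (D n) <= C%:E)%E by exact: nearW.
    have lim := joint_limit GU VD sU (t := t) (h := nn) kCn.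
    have : inner (U t) nn < 3 * l0 / 4 + inner em nn.
      by move: hU; rewrite /height innerBl; lra.
    move=> hU'.
    have hn : \forall p \near (nbhs t, G),
        inner (V p.2 (p.1 + s p.2)) nn < 3 * l0 / 4 + inner em nn.
      exact: (cvgr_lt _ lim _ hU').
    by apply: filterS hn => -[r n] /=; rewrite /height innerBl; lra.
  move=> nearK; apply: (@filterS2 _ G GF _ _ _ _ nearT nearK) => n hT hK.
  have [s'1 s'2 _] := s'P n hT; rewrite ltNge; apply/negP => s'K.
  have := hK (s' n - s n); rewrite /= in_itv/= subrK s'2 ltxx.
  by move=> /(_ ltac:(apply/andP; split; lra)).
have [U' s'U'] := limit_exists s'; exists s', U'; split => //.
  apply: (@filterS3 _ G GF _ _ _ _ _ nearT sP (far eta)) => n hT [sE sI] fe.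
  have [s'1 s'2 _] := s'P n hT; split => //.
  have [cV _ _] := VD n; have mV := measurable_pot W_lsc cV.
  set I := `]-oo, s n]%classic : set R.
  set J := `[s' n - eta, s' n]%classic : set R.
  have mI : measurable (I : set (measurableTypeR R)) by exact: measurable_itv.
  have mJ : measurable (J : set (measurableTypeR R)) by exact: measurable_itv.
  have IJ : [disjoint I & J].
    apply/disj_setPS => t []; rewrite /I /J /= !in_itv/= => t1 /andP[t3 t4].
    lra.
  apply: (@le_trans _ _ (\int[mu]_(r in I `|` J) W (V n r))%E).
    rewrite ge0_integral_setU//; last exact: measurable_funTS.
    by rewrite -natr1 mulrDl mul1r EFinD; apply: leeD => //; exact: cost.
  apply: ge0_subset_integral => //.
  - exact: measurableU.
  - exact: measurable_funTS.
  - move=> t []; rewrite /I /J /= !in_itv/=; lra.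
move=> t t0; have h2 : (fun=> 3 * l0 / 4) @ G --> 3 * l0 / 4 by exact: cvg_cst.
apply: (ler_cvg_to (height_lim (t := t) s'U') h2).
apply: (@filterS2 _ G GF _ _ _ _ nearT (far (T - t))) => n hT fT.
by have [_ _] := s'P n hT; apply; lra.
Qed.

(** The total potential energy is at most C, so only finitely many stages exist. *)
Lemma good_limit : exists U, good U.
Proof.
have [eta [kappa [eta0 kappa0 cost]]] := crossing_cost.
have stages j : (exists U, good U) \/ stage kappa j.
  elim: j => [|j [|]]; [by right; exact: stage0|by left|].
  exact: stageS eta0 kappa0 cost.
pose j := (Num.bound (C / kappa)).
have [//|[s [U [_ sP _]]]] := stages j.
have [n [_ hn]] := filter_ex sP; exfalso.
have [cV _ _] := VD n.
have mI : measurable (`]-oo, s n]%classic : set (measurableTypeR R)).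
  exact: measurable_itv.
have := le_trans (le_trans hn (pot_sub W_ge0 W_lsc cV mI)) (pC n).
rewrite lee_fin -ler_pdivlMr// leNgt archi_boundP//.
by rewrite divr_ge0// ltW.
Qed.

End selection.

Theorem minimizer_exists :
  (ereal_inf [set action W V | V in admissible em ep] < +oo)%E ->
  exists2 U, admissible em ep U &
    (action W U < +oo)%E /\
    forall V, admissible em ep V -> (action W U <= action W V)%E.
Proof.
move=> inf_fin; set S := [set action W V | V in admissible em ep] in inf_fin *.
have S0 : (0 <= ereal_inf S)%E.
  apply: le_ereal_inf_tmp => _ [V [V1 _] <-].
  rewrite (action_prim W_ge0 W_lsc (weak_derivP V1)).
  by rewrite adde_ge0 ?kin_ge0 ?pot_ge0.
pose m := fine (ereal_inf S).
have mE : ereal_inf S = m%:E by rewrite /m fineK// ge0_fin_numE.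
have /choice[V VP] : forall n : nat, exists V, admissible em ep V /\
    (action W V <= (m + n.+1%:R^-1)%:E)%E.
  move=> n; have n0 : 0 < (n.+1%:R^-1 : R) by rewrite invr_gt0.
  have fS : ereal_inf S \is a fin_num by rewrite mE.
  have [_ [V VA <-] Vn] := lb_ereal_inf_adherent n0 fS.
  by exists V; split => //; rewrite ltW// EFinD -mE.
have [G [GU ooG]] := ultra_nat.
have [U [[D' UD'] aU cU]] := good_limit GU ooG (fun n => (VP n).1) (fun n => (VP n).2).
exists U; first by split => //; exact: prim_H1loc UD'.
split; first by apply: le_lt_trans aU _; exact: ltry.
move=> V' V'A; apply: le_trans aU _; rewrite -mE.
by apply: ereal_inf_lbound; exists V'.
Qed.

End existence.

(** * Equipartition of the energy *)

Section affine_itg.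
Context (R : realType).
Local Notation mu := (@lebesgue_measure R).
Variables (lam c : R).
Hypothesis lam0 : 0 < lam.
Let theta (t : R) := lam * t + c.

Let mtheta : @measurable_fun _ _ (measurableTypeR R) (measurableTypeR R) setT theta.
Proof.
apply: measurable_funD; last exact: measurable_cst.
by apply: measurable_funM => //; exact: measurable_cst.
Qed.

Lemma ge0_integral_affine_set (A : set R) (f : R -> \bar R) :
  measurable (A : set (measurableTypeR R)) ->
  measurable_fun [set: R] f -> (forall t, (0 <= f t)%E) ->
  (\int[mu]_(t in A) f t = lam%:E * \int[mu]_(t in theta @^-1` A) f (theta t))%E.
Proof.
move=> mA mf f0.
rewrite integral_mkcond (ge0_integral_affine c lam0); last 2 first.
- by apply: (iffLR (measurable_restrictT f mA)); exact: measurable_funTS.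
- by move=> t; rewrite patchE; case: ifPn.
by rewrite [in RHS]integral_mkcond.
Qed.

Let theta_itv x y : theta @^-1` `[lam * x + c, lam * y + c] = `[x, y]%classic.
Proof.
by apply/seteqP; split => t /=; rewrite !in_itv/= /theta !lerD2r !ler_pM2l.
Qed.

Lemma loc_int_affine (f : R -> R) : loc_int f -> loc_int (fun t => f (lam * t + c)).
Proof.
move=> [mf fi]; have mft : measurable_fun [set: R] (fun t => f (lam * t + c)).
  exact: (measurableT_comp mf mtheta).
split => // x y; apply/integrableP; split.
  by apply/measurable_EFinP; exact: measurable_funTS.
have /integrableP[_] := fi (lam * x + c) (lam * y + c).
have mn : measurable_fun [set: R] (fun t => `|(EFin \o f) t|%E).
  by do 2 apply: measurableT_comp => //.
rewrite (ge0_integral_affine_set (measurable_itv _) mn)// theta_itv => h; have {h} : (lam^-1%:E * (lam%:E *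
    \int[mu]_(t in `[x, y]) `|(EFin \o f) (theta t)|) < +oo)%E.
  by apply: lte_mul_pinfty => //; rewrite ?lee_fin ?invr_ge0 ?ltW.
by rewrite muleA -EFinM mulVf ?gt_eqF// mul1e.
Qed.

Lemma itg_affine (f : R -> R) x y : loc_int f ->
  itg f (lam * x + c) (lam * y + c) = lam * itg (fun t => f (lam * t + c)) x y.
Proof.
move=> fi; have ge0 (g : R -> R) : loc_int g -> (forall t, 0 <= g t) ->
    itg g (lam * x + c) (lam * y + c) = lam * itg (fun t => g (lam * t + c)) x y.
  move=> gi g0; apply: EFin_inj.
  rewrite EFinM (EFin_itg _ _ gi) (EFin_itg _ _ (loc_int_affine gi)).
  have mg : measurable_fun [set: R] (EFin \o g) by apply/measurable_EFinP; case: gi.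
  by rewrite (ge0_integral_affine_set (measurable_itv _) mg) ?theta_itv.
have ni := loc_int_norm fi; have pi_ := loc_intD ni fi.
have fE a b (g : R -> R) : loc_int g ->
    itg g a b = itg (fun t => `|g t| + g t) a b - itg (fun t => `|g t|) a b.
  by move=> gi; rewrite itgD//; [ring|exact: loc_int_norm].
rewrite fE// (fE x y); last exact: loc_int_affine.
by rewrite !ge0// => [|t]; [ring|have := ler_norm (- f t); rewrite normrN; lra].
Qed.

End affine_itg.

Section equipartition.
Context (R : realType) (H : hilbertType R) (W : H -> \bar R).
Local Notation mu := (@lebesgue_measure R).
Hypothesis W_ge0 : forall u, (0 <= W u)%E.
Hypothesis W_lsc : weakly_lsc W.
Implicit Types (V D U : R -> H) (x y z t : R) (h : H).

(** Time runs at speed 1 before a and lam after a. *)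
Definition dilate (a lam t : R) : R := t + (lam - 1) * Num.max 0 (t - a).

Section dilation.
Variables (U D : R -> H) (a lam : R).
Hypothesis UD : prim U D.
Hypothesis lam0 : 0 < lam.

Lemma dilate_le t : t <= a -> dilate a lam t = t.
Proof. by move=> ta; rewrite /dilate (max_idPl _) ?subr_le0// mulr0 addr0. Qed.

Lemma dilate_ge t : a <= t -> dilate a lam t = lam * t + (1 - lam) * a.
Proof. by move=> ta; rewrite /dilate (max_idPr _) ?subr_ge0//; ring. Qed.

Lemma dilate_continuous : continuous (dilate a lam).
Proof.
have -> : dilate a lam = (fun t => t + (lam - 1) * ((t - a + `|t - a|) / 2)).
  by apply/funext => t; rewrite /dilate maxr_absE add0r sub0r normrN.
move=> t; apply: cvgD; first exact: cvg_id.
apply: cvgMl_tmp; apply: cvgMr_tmp.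
have h : (fun s => s - a) @ t --> t - a by apply: cvgB; [exact: cvg_id|exact: cvg_cst].
by apply: cvgD => //; exact: cvg_norm.
Qed.

Definition dilated t := U (dilate a lam t).

Definition dilated_deriv t : H :=
  D (dilate a lam t) + (lam - 1) *: ((\1_(`[a, +oo[%classic) t : R) *: D (dilate a lam t)).

Let mtheta : @measurable_fun _ _ (measurableTypeR R) (measurableTypeR R) setT (dilate a lam).
Proof. exact: continuous_measurable_fun dilate_continuous. Qed.

Lemma dilated_deriv_lt t : t < a -> dilated_deriv t = D t.
Proof.
move=> ta; rewrite /dilated_deriv indicE memNset ?scale0r ?scaler0 ?addr0; last first.
  by rewrite /= in_itv/= andbT; apply/negP; rewrite -ltNge.
by rewrite dilate_le// ltW.
Qed.

Lemma dilated_deriv_ge t : a <= t ->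
  dilated_deriv t = lam *: D (lam * t + (1 - lam) * a).
Proof.
move=> ta; rewrite /dilated_deriv indicE mem_set; last by rewrite /= in_itv/= ta.
by rewrite scale1r dilate_ge// scalerBl scale1r addrC subrK.
Qed.

Let loc_int_dilate (f : R -> R) : loc_int f -> (forall t, 0 <= f t) ->
  loc_int (fun t => f (dilate a lam t)).
Proof.
move=> [mf fi] f0; have m : measurable_fun [set: R] (fun t => f (dilate a lam t)).
  exact: (measurableT_comp mf mtheta).
apply: (@loc_int_le _ _ (fun t => f t + f (lam * t + (1 - lam) * a))) => // [t|].
  rewrite ger0_norm//; case: (leP t a) => ta; first by rewrite dilate_le// lerDl.
  by rewrite (dilate_ge (ltW ta)) lerDr.
apply: loc_intD; first by split.
by apply: loc_int_affine => //; split.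
Qed.

Lemma dilated_prim : prim dilated dilated_deriv.
Proof.
have [cU D2 UDE] := UD.
have D2' : L2loc (fun t => D (dilate a lam t)).
  apply: L2locP.
    by apply: (strongly_measurable_comp mtheta); case: D2.
  by apply: (@loc_int_dilate (fun t => `|D t| ^+ 2)) => //; exact: loc_int_sqr.
have G2 : L2loc dilated_deriv.
  apply: L2locD => //; apply: L2locZ; apply: L2loc_restrict => //.
split => // [t|x y h xy].
  by apply: continuous_comp; [exact: dilate_continuous|exact: cU].
have Di := loc_int_inner h D2; have Gi := loc_int_inner h G2.
have before s t : s <= t -> t <= a -> inner (dilated t - dilated s) h =
    itg (fun r => inner (dilated_deriv r) h) s t.
  move=> st ta; rewrite /dilated !dilate_le// ?(le_trans st)// UDE//.
  by apply: eq_itg => // r /andP[_ rt]; rewrite dilated_deriv_lt// (lt_le_trans rt).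
have after s t : s <= t -> a <= s -> inner (dilated t - dilated s) h =
    itg (fun r => inner (dilated_deriv r) h) s t.
  move=> st as_; rewrite /dilated !dilate_ge// ?(le_trans as_)// UDE; last first.
    by rewrite lerD2r ler_pM2l.
  rewrite itg_affine//.
  have Dai := loc_int_affine ((1 - lam) * a) lam0 Di.
  rewrite -itgZ//; apply: eq_itg => //; first exact: loc_intZ.
  move=> r /andP[/ltW sr _]; rewrite dilated_deriv_ge ?innerZl//.
  exact: le_trans sr.
have [ya|ay] := leP y a; first exact: before.
have [ax|xa] := leP a x; first exact: after.
rewrite (itg_split Gi (ltW xa) (ltW ay)) -(before x a (ltW xa) (lexx a)) -(after a y (ltW ay) (lexx a)).
by rewrite !innerBl; ring.
Qed.

Let mI : measurable (`]-oo, a[%classic : set (measurableTypeR R)).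
Proof. exact: measurable_itv. Qed.

Let mJ : measurable (`[a, +oo[%classic : set (measurableTypeR R)).
Proof. exact: measurable_itv. Qed.

Lemma integral_split_at (f : R -> \bar R) : measurable_fun [set: R] f ->
  (forall t, (0 <= f t)%E) ->
  (\int[mu]_t f t = \int[mu]_(t in `]-oo, a[) f t + \int[mu]_(t in `[a, +oo[) f t)%E.
Proof.
move=> mf f0; rewrite -ge0_integral_setU//=; last 2 first.
- exact: measurable_funTS.
- apply/disj_setPS => t []; rewrite /= !in_itv/= andbT => t1 t2; lra.
congr (integral _ _ _); apply/seteqP; split => t // _ /=; rewrite !in_itv/= andbT.
by case: (ltP t a) => ta; [left|right].
Qed.

Let preim : (fun t => lam * t + (1 - lam) * a) @^-1` `[a, +oo[ = `[a, +oo[%classic.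
Proof.
apply/seteqP; split => t /=; rewrite !in_itv/= !andbT => ta.
  by rewrite -(ler_pM2l lam0); lra.
by move: ta; rewrite -(ler_pM2l lam0); lra.
Qed.

Lemma dilated_kin : kin dilated_deriv =
  (\int[mu]_(t in `]-oo, a[) ((2^-1 * `|D t| ^+ 2)%:E) +
   lam%:E * \int[mu]_(t in `[a, +oo[) ((2^-1 * `|D t| ^+ 2)%:E))%E.
Proof.
have [_ G2 _] := dilated_prim; have [_ D2 _] := UD.
have mK := measurable_kin D2.
rewrite /kin integral_split_at; [|exact: measurable_kin|]; last first.
  by move=> t; rewrite lee_fin mulr_ge0 ?invr_ge0.
congr (_ + _)%E.
  by apply: eq_integral => t; rewrite inE /= in_itv/= => ta; rewrite dilated_deriv_lt.
rewrite (ge0_integral_affine_set ((1 - lam) * a) lam0 mJ mK); last first.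
  by move=> t; rewrite lee_fin mulr_ge0 ?invr_ge0.
rewrite preim muleA -EFinM -ge0_integralZl//; last 2 first.
- apply: measurable_funTS.
  have cth : continuous (fun t => lam * t + (1 - lam) * a).
    move=> t; apply: cvgD; last exact: cvg_cst.
    by apply: cvgMl_tmp; exact: cvg_id.
  exact: (measurableT_comp mK (continuous_measurable_fun cth)).
- by rewrite lee_fin mulr_ge0 ?ltW.
apply: eq_integral => t; rewrite inE /= in_itv/= andbT => ta.
rewrite dilated_deriv_ge// normrZ (gtr0_norm lam0) -EFinM; congr EFin; ring.
Qed.

Lemma dilated_pot : pot W dilated =
  (\int[mu]_(t in `]-oo, a[) W (U t) +
   lam^-1%:E * \int[mu]_(t in `[a, +oo[) W (U t))%E.
Proof.
have [cV _ _] := dilated_prim; have [cU _ _] := UD.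
rewrite /pot integral_split_at//; last exact: measurable_pot.
congr (_ + _)%E.
  apply: eq_integral => t; rewrite inE /= in_itv/= => ta.
  by rewrite /dilated dilate_le// ltW.
rewrite (ge0_integral_affine_set ((1 - lam) * a) lam0 mJ (measurable_pot W_lsc cU))//.
rewrite preim muleA -EFinM mulVf ?gt_eqF// mul1e.
apply: eq_integral => t; rewrite inE /= in_itv/= andbT => ta.
by rewrite /dilated dilate_ge.
Qed.

Lemma dilated_admissible em ep : admissible em ep U -> admissible em ep dilated.
Proof.
move=> [_ [tm [tp [_ Um Up]]]]; split; first exact: prim_H1loc dilated_prim.
exists (Num.min tm a), (Num.max a (a + (tp - a) / lam) + 1); split.
- have : Num.min tm a <= a by rewrite ge_min lexx orbT.
  have : a <= Num.max a (a + (tp - a) / lam) by rewrite le_max lexx.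
  lra.
- move=> t; rewrite le_min => /andP[ttm ta]; rewrite /dilated dilate_le//; exact: Um.
move=> t tM.
have aM : a <= Num.max a (a + (tp - a) / lam) by rewrite le_max lexx.
have tpM : a + (tp - a) / lam <= Num.max a (a + (tp - a) / lam).
  by rewrite le_max lexx orbT.
rewrite /dilated dilate_ge; last lra.
apply: Up; have : (tp - a) / lam <= t - a by lra.
by rewrite ler_pdivrMr//; lra.
Qed.

End dilation.

(** With A and B the kinetic and potential energies on t >= a, minimality says
    that lam A + B / lam is minimal at lam = 1. *)
Lemma equipartition_half_line em ep U D a : prim U D -> admissible em ep U ->
  (action W U < +oo)%E ->
  (forall V, admissible em ep V -> (action W U <= action W V)%E) ->
  (\int[mu]_(t in `[a, +oo[) ((2^-1 * `|D t| ^+ 2)%:E) =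
   \int[mu]_(t in `[a, +oo[) W (U t))%E.
Proof.
move=> UD Uadm Ufin Umin; have [cU D2 _] := UD.
have mK := measurable_kin D2; have mP := measurable_pot W_lsc cU.
have K0 t : (0 <= (2^-1 * `|D t| ^+ 2)%:E)%E by rewrite lee_fin mulr_ge0 ?invr_ge0.
set A := (\int[mu]_(t in `[a, +oo[) ((2^-1 * `|D t| ^+ 2)%:E))%E.
set B := (\int[mu]_(t in `[a, +oo[) W (U t))%E.
set A' := (\int[mu]_(t in `]-oo, a[) ((2^-1 * `|D t| ^+ 2)%:E))%E.
set B' := (\int[mu]_(t in `]-oo, a[) W (U t))%E.
have kE : kin D = (A' + A)%E by exact: integral_split_at.
have pE : pot W U = (B' + B)%E by exact: integral_split_at.
have [A0 A'0] : (0 <= A)%E /\ (0 <= A')%E by split; exact: integral_ge0.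
have [B0 B'0] : (0 <= B)%E /\ (0 <= B')%E by split; exact: integral_ge0.
have actU : action W U = (A' + A + (B' + B))%E.
  by rewrite (action_prim W_ge0 W_lsc UD) kE pE.
have ineq (lam : R) : 0 < lam ->
    (A' + A + (B' + B) <= A' + lam%:E * A + (B' + lam^-1%:E * B))%E.
  move=> lam0; rewrite -actU; apply: le_trans (Umin _ (dilated_admissible a UD lam0 Uadm)) _.
  rewrite (action_prim W_ge0 W_lsc (dilated_prim a UD lam0)).
  by rewrite (dilated_kin a UD lam0) (dilated_pot a UD lam0).
have fin (x y : \bar R) : (0 <= x)%E -> (0 <= y)%E -> (x + y < +oo)%E ->
    x \is a fin_num /\ y \is a fin_num.
  move=> x0 y0 xy; rewrite !ge0_fin_numE//; split; apply: le_lt_trans xy.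
    by rewrite leeDl.
  by rewrite leeDr.
rewrite actU in Ufin; clear kE pE actU; clearbody A B A' B'.
have [/= f1 f2] := fin _ _ (adde_ge0 A'0 A0) (adde_ge0 B'0 B0) Ufin.
move: f1 f2; rewrite !fin_numD => /andP[fA' fA] /andP[fB' fB].
move: ineq A0 B0; rewrite -(fineK fA) -(fineK fB) -(fineK fA') -(fineK fB').
move: (fine A) (fine B) (fine A') (fine B') => p q p' q' ineq.
rewrite !lee_fin => p0 q0; congr EFin.
have {}ineq (lam : R) : 0 < lam -> p + q <= lam * p + lam^-1 * q.
  by move=> /ineq; rewrite -!EFinM -!EFinD lee_fin; lra.
(* Take lam = 1 + s with s of the order of e; the other inequality is the same
   with lam replaced by its inverse. *)
have le (c b : R) : (forall lam : R, 0 < lam -> c + b <= lam * c + lam^-1 * b) ->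
    0 <= c -> b <= c.
  move=> ineqcb c0; apply/ler_addgt0Pr => e e0.
  have c1 : 0 < c + 1 by rewrite ltr_wpDl.
  pose s := e / (c + 1); have s0 : 0 < s by rewrite divr_gt0.
  have s1 : 0 < 1 + s by lra.
  have : (1 + s) * (c + b) <= (1 + s) * ((1 + s) * c + (1 + s)^-1 * b).
    by rewrite ler_pM2l//; exact: ineqcb.
  have -> : (1 + s) * ((1 + s) * c + (1 + s)^-1 * b) = (1 + s) ^+ 2 * c + b.
    by rewrite mulrDr [_ * (_^-1 * _)]mulrA mulfV ?gt_eqF//; ring.
  have -> : (1 + s) ^+ 2 * c + b = (1 + s) * c + b + s * (c * (1 + s)) by ring.
  move=> h; have : s * b <= s * (c * (1 + s)) by lra.
  rewrite ler_pM2l// mulrDr mulr1 => {}h; apply: (le_trans h).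
  rewrite lerD2l /s mulrA ler_pdivrMr// mulrC ler_pM2l//; lra.
apply/eqP; rewrite eq_le; apply/andP; split; last exact: le.
apply: le => // lam lam0; have := ineq lam^-1; rewrite invr_gt0 invrK => /(_ lam0); lra.
Qed.

(** Subtracting half lines, the two energies agree on every segment. *)
Theorem equipartition em ep U D : prim U D -> admissible em ep U ->
  (action W U < +oo)%E ->
  (forall V, admissible em ep V -> (action W U <= action W V)%E) ->
  {ae mu, forall t, ((2^-1 * `|D t| ^+ 2)%:E = W (U t))%E}.
Proof.
move=> UD Uadm Ufin Umin; have [cU D2 _] := UD.
have mK := measurable_kin D2; have mP := measurable_pot W_lsc cU.
have K0 t : (0 <= (2^-1 * `|D t| ^+ 2)%:E)%E by rewrite lee_fin mulr_ge0 ?invr_ge0.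
have pfin : (pot W U < +oo)%E.
  apply: le_lt_trans Ufin; rewrite (action_prim W_ge0 W_lsc UD).
  by rewrite leeDr ?kin_ge0.
have Pi : mu.-integrable [set: R] (fun t => W (U t)).
  apply/integrableP; split => //; under eq_integral do rewrite gee0_abs//.
  exact: pfin.
have Pfin : {ae mu, forall t, W (U t) \is a fin_num}.
  have := integrable_ae measurableT Pi.
  by apply: filterS => t; exact.
pose w t := fine (W (U t)).
have mw : measurable_fun [set: R] w by apply: measurableT_comp mP; exact: fine_measurable.
have wP (A : set R) : measurable (A : set (measurableTypeR R)) ->
    (\int[mu]_(t in A) (w t)%:E = \int[mu]_(t in A) W (U t))%E.
  move=> mA; apply: ae_eq_integral => //.
  - by apply: measurable_funTS; apply/measurable_EFinP.
  - exact: measurable_funTS.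
  - move: Pfin; apply: filterS; first exact: (ae_filter_ringOfSetsType mu).
    by move=> t /fineK.
have w0 t : 0 <= w t by rewrite /w fine_ge0.
have wi : loc_int w.
  split => // a b.
  have mab : measurable (`[a, b]%classic : set (measurableTypeR R)).
    exact: measurable_itv.
  apply/integrableP; split; first by apply/measurable_EFinP; exact: measurable_funTS.
  under eq_integral do rewrite /= ger0_norm//.
  by rewrite wP//; apply: le_lt_trans (pot_sub W_ge0 W_lsc cU mab) pfin.
have Ki := loc_intZ 2^-1 (loc_int_sqr D2).
have eqi x y : x <= y -> itg (fun t => 2^-1 * `|D t| ^+ 2) x y = itg w x y.
  move=> xy; pose I : set R := `[x, y[%classic; pose J : set R := `[y, +oo[%classic.
  have mI : measurable (I : set (measurableTypeR R)) by exact: measurable_itv.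
  have mJ : measurable (J : set (measurableTypeR R)) by exact: measurable_itv.
  have IJ : [disjoint I & J].
    apply/disj_setPS => t []; rewrite /I /J /= !in_itv/= andbT => /andP[_ ty].
    by rewrite leNgt ty.
  have UE : `[x, +oo[%classic = I `|` J.
    apply/seteqP; split => t; rewrite /I /J /= !in_itv/= !andbT.
      by move=> xt; case: (ltP t y) => ty; [left; rewrite xt|right].
    by move=> [/andP[]//|]; exact: le_trans.
  have := equipartition_half_line x UD Uadm Ufin Umin.
  have := equipartition_half_line y UD Uadm Ufin Umin.
  rewrite UE !ge0_integral_setU//; try exact: measurable_funTS.
  rewrite -/J => -> hI.
  have JF : (\int[mu]_(t in J) W (U t))%E \is a fin_num.
    rewrite ge0_fin_numE; last exact: integral_ge0.
    by apply: le_lt_trans (pot_sub W_ge0 W_lsc cU mJ) pfin.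
  have {}hI : (\int[mu]_(t in I) (2^-1 * `|D t| ^+ 2)%:E =
               \int[mu]_(t in I) W (U t))%E.
    by rewrite -[LHS](addeK _ JF) hI addeK.
  apply: EFin_inj; rewrite (EFin_itg _ _ Ki) (EFin_itg _ _ wi).
  rewrite -!integral_itv_bndo_bndc; last 2 first.
  - by apply/measurable_EFinP; exact: measurable_funTS.
  - exact: measurable_funTS.
  by rewrite wP.
have : {ae mu, forall t, 2^-1 * `|D t| ^+ 2 - w t = 0}.
  apply: itg0_ae; first exact: loc_intB.
  by move=> x y xy; rewrite itgB// eqi// subrr.
move=> h; have ff := ae_filter_ringOfSetsType mu.
move: h Pfin; apply: filterS2 => t /eqP; rewrite subr_eq0 => /eqP -> fW.
by rewrite /w fineK.
Qed.

End equipartition.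

(** * Regularity of minimizers *)

(** ** A second order du Bois-Reymond lemma *)

Section second_order.
Context (R : realType).
Local Notation mu := (@lebesgue_measure R).
Implicit Types (phi psi eta : R -> R) (a c t x y : R).

Lemma test_window phi : test_function phi -> exists2 M, 0 <= M & forall N, M <= N ->
  [/\ phi (- N) = 0, phi N = 0 &
      forall t, ~ (- N <= t <= N) -> phi t = 0 /\ derive1 phi t = 0].
Proof.
move=> [_ _ [M M0]]; exists (`|M| + 1); first by rewrite addr_ge0.
have MM := ler_norm M.
move=> N MN; have N0 : 0 <= N by apply: le_trans MN; rewrite addr_ge0.
split; [apply: M0|apply: M0|]; rewrite ?normrN ?ger0_norm//; first lra.
  by lra.
move=> t tN; have Mt : M < `|t|.
  by rewrite ltNge; apply/negP; rewrite ler_norml => h; apply: tN; lra.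
by split; [exact: M0|exact: test_function_derive1 M0 _ _].
Qed.

Lemma test_functionB phi psi c : test_function phi -> test_function psi ->
  test_function (fun t => phi t - c * psi t) /\
  derive1 (fun t => phi t - c * psi t) = (fun t => derive1 phi t - c * derive1 psi t).
Proof.
move=> [dphi cphi [M M0]] [dpsi cpsi [N N0]].
have dE t : is_derive t 1 (fun t => phi t - c * psi t) (derive1 phi t - c * derive1 psi t).
  have h1 : is_derive t 1 phi (derive1 phi t).
    by rewrite derive1E; apply: DeriveDef.
  have h2 : is_derive t 1 psi (derive1 psi t).
    by rewrite derive1E; apply: DeriveDef.
  have h3 := @is_deriveZ _ _ _ _ c _ _ _ h2.
  exact: (@is_deriveB _ _ _ _ _ _ _ _ _ h1 h3).
have dE' : derive1 (fun t => phi t - c * psi t) = (fun t => derive1 phi t - c * derive1 psi t).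
  by apply/funext => t; rewrite derive1E derive_val.
split => //; split.
- by move=> t; have [] := dE t.
- rewrite dE' => t; apply: cvgB; first exact: cphi.
  by apply: cvgMl_tmp; exact: cpsi.
- exists (Num.max M N) => t; rewrite gt_max => /andP[Mt Nt].
  by rewrite M0// N0// mulr0 subrr.
Qed.

Lemma test_continuous phi : test_function phi -> continuous phi.
Proof.
move=> [dphi _ _] t; apply: differentiable_continuous; exact/derivable1_diffP.
Qed.

Lemma test_by_parts phi (v g : R -> R) : test_function phi -> continuous v ->
  loc_int g -> (forall x y, x <= y -> v y - v x = itg g x y) ->
  \int[mu]_t (phi t * g t) = - \int[mu]_t (derive1 phi t * v t).
Proof.
move=> tphi cv gi vg; have [M M0 MP] := test_window tphi.
have [e1 e2 out] := MP M (lexx M); have [dphi cphi _] := tphi.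
rewrite !(@Rintegral_support _ _ (- M) M); last 2 first.
- by move=> t /out[_ ->]; rewrite mul0r.
- by move=> t /out[-> _]; rewrite mul0r.
have MM : - M <= M by lra.
have := itg_by_parts MM cv gi vg dphi cphi; rewrite e1 e2; lra.
Qed.

Lemma loc_int_deriv phi (g : R -> R) : test_function phi -> continuous g ->
  loc_int (fun t => derive1 phi t * g t).
Proof.
by move=> [_ cphi _] cg; apply: loc_intM => //; exact: loc_int_continuous.
Qed.

Lemma loc_int_test phi : test_function phi -> loc_int phi.
Proof. by move=> tphi; apply: loc_int_continuous; exact: test_continuous. Qed.

Lemma itg_id x y : x <= y -> (y : R) - x = itg (cst 1) x y.
Proof. by move=> xy; rewrite itg_cst// mul1r. Qed.

(** Otherwise the identity map would be orthogonal to all derivatives of test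
    functions, hence constant. *)
Lemma test_mean_neq0 : exists2 eta, test_function eta & \int[mu]_t eta t != 0.
Proof.
apply: contrapT => no; have := @du_bois_reymond R idfun _ _ 0 1.
suff h phi : test_function phi -> \int[mu]_t (derive1 phi t * t) = 0.
  by move=> /(_ (fun t => cvg_id) h)/eqP; rewrite eq_sym oner_eq0.
move=> tphi; have := test_by_parts tphi (fun t => cvg_id) (loc_int_cst 1) itg_id.
have -> : (fun t => phi t * cst 1 t) = phi by apply/funext => t; rewrite mulr1.
move=> /eqP; rewrite -eqr_oppLR => /eqP <-; apply/eqP; rewrite oppr_eq0.
by apply: contrapT => /negP h; apply: no; exists phi.
Qed.

(** Subtracting from a test function a multiple of a fixed bump brings its mean
    to zero, which reduces the claim to the first order lemma for y t - c t. *)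
Lemma du_bois_reymond2 (y : R -> R) : continuous y ->
  (forall phi, test_function phi -> \int[mu]_t phi t = 0 ->
    \int[mu]_t (derive1 phi t * y t) = 0) ->
  exists c, forall t, y t = y 0 + c * t.
Proof.
move=> cy y0; have [eta teta I0] := test_mean_neq0.
set I := \int[mu]_t eta t in I0.
pose k := (\int[mu]_t (derive1 eta t * y t)) / I.
pose z t := y t + k * t.
have cz : continuous z.
  move=> t; apply: cvgD; first exact: cy.
  by apply: cvgMl_tmp; exact: cvg_id.
have cid : continuous (idfun : R -> R) by move=> t; exact: cvg_id.
suff zE phi : test_function phi -> \int[mu]_t (derive1 phi t * z t) = 0.
  exists (- k) => t; have := du_bois_reymond cz zE t 0; rewrite /z mulr0 addr0; lra.
move=> tphi; pose a := (\int[mu]_t phi t) / I.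
have [trho rhoE] := test_functionB a tphi teta.
have [M M0 MP] := test_window tphi; have [N N0 NP] := test_window teta.
pose K := Num.max M N.
have [p1 p2 pout] : [/\ phi (- K) = 0, phi K = 0 &
    forall t, ~ (- K <= t <= K) -> phi t = 0 /\ derive1 phi t = 0].
  by apply: MP; rewrite le_max lexx.
have [n1 n2 nout] : [/\ eta (- K) = 0, eta K = 0 &
    forall t, ~ (- K <= t <= K) -> eta t = 0 /\ derive1 eta t = 0].
  by apply: NP; rewrite le_max lexx orbT.
have intK (f : R -> R) : (forall t, phi t = 0 /\ derive1 phi t = 0 ->
    eta t = 0 /\ derive1 eta t = 0 -> f t = 0) -> \int[mu]_t f t = itg f (- K) K.
  by move=> f0; apply: Rintegral_support => t tK; apply: f0; [exact: pout|exact: nout].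
have iphi := loc_int_test tphi; have ieta := loc_int_test teta.
have ipy := loc_int_deriv tphi cy; have iey := loc_int_deriv teta cy.
have ipt := loc_int_deriv tphi cid.
have Iphi : \int[mu]_t phi t = itg phi (- K) K by apply: intK => t [].
have Ieta : \int[mu]_t eta t = itg eta (- K) K by apply: intK => t _ [].
have rho0 : \int[mu]_t (phi t - a * eta t) = 0.
  rewrite intK => [|t [-> _] [-> _]]; last by rewrite mulr0 subrr.
  rewrite itgB//; last exact: loc_intZ.
  by rewrite itgZ// -Iphi -Ieta /a divfK// subrr.
have := y0 _ trho rho0; rewrite rhoE intK; last first.
  by move=> t [_ ->] [_ ->]; rewrite mulr0 subrr mul0r.
have -> : (fun t => (derive1 phi t - a * derive1 eta t) * y t) =
    (fun t => derive1 phi t * y t - a * (derive1 eta t * y t)).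
  by apply/funext => t; ring.
rewrite itgB//; last exact: loc_intZ.
rewrite itgZ// -(intK (fun t => derive1 eta t * y t)); last first.
  by move=> t _ [_ ->]; rewrite mul0r.
have -> : \int[mu]_t (derive1 eta t * y t) = k * I by rewrite /k divfK.
have -> : a * (k * I) = k * \int[mu]_t phi t.
  by rewrite mulrCA /a divfK.
have := test_by_parts tphi cid (loc_int_cst 1) itg_id.
have -> : (fun t => phi t * cst 1 t) = phi by apply/funext => t; rewrite mulr1.
move=> ->; rewrite (intK (fun t => derive1 phi t * idfun t)); last first.
  by move=> t [_ ->]; rewrite mul0r.
rewrite intK; last by move=> t [_ ->]; rewrite mul0r.
have -> : (fun t => derive1 phi t * z t) =
    (fun t => derive1 phi t * y t + k * (derive1 phi t * idfun t)).
  by apply/funext => t; rewrite /z /=; ring.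
rewrite itgD//; last exact: loc_intZ.
by rewrite itgZ//; lra.
Qed.

End second_order.

(** ** Primitives of continuous vector-valued functions *)

Section vector_primitive.
Context (R : realType) (H : hilbertType R).
Local Notation mu := (@lebesgue_measure R).
Implicit Types (F P Q U D V G : R -> H) (a b c t : R) (h : H).

Lemma itg_le_inner F h a b : continuous F ->
  `|itg (fun t => inner (F t) h) a b| <= itg (fun t => `|F t|) a b * `|h|.
Proof.
move=> cF; have F2 := L2loc_continuous cF; have Fi := loc_int_inner h F2.
have Fn := loc_int_normL2 F2.
apply: (le_trans (itg_norm _ _ Fi)); rewrite mulrC -itgZ//.
apply: itg_le; [exact: loc_int_norm|exact: loc_intZ|].
by move=> t _; rewrite mulrC abs_inner_le.
Qed.

(** The integral of F over a segment is given by the Riesz theorem. *)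
Lemma vector_primitive F : continuous F -> exists P, prim P F.
Proof.
move=> cF; have F2 := L2loc_continuous cF; have Fi h := loc_int_inner h F2.
have itgE a b : exists g, forall h, inner g h = itg (fun t => inner (F t) h) a b.
  apply: (riesz (C := itg (fun t => `|F t|) a b)) => [u v|k u|u].
  - rewrite -itgD//; congr (itg _ _ _); apply/funext => t; exact: innerDr.
  - rewrite -itgZ//; congr (itg _ _ _); apply/funext => t; exact: innerZr.
  - exact: itg_le_inner.
have [J JE] : exists J : R -> R -> H,
    forall a b h, inner (J a b) h = itg (fun t => inner (F t) h) a b.
  have [f fP] := choice (fun p : R * R => itgE p.1 p.2).
  by exists (fun a b => f (a, b)) => a b; exact: (fP (a, b)).
pose P t := if 0 <= t then J 0 t else - J t 0.
have PE a b h : a <= b -> inner (P b - P a) h = itg (fun t => inner (F t) h) a b.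
  move=> ab; rewrite innerBl /P; case: (leP 0 b) => b0; case: (leP 0 a) => a0.
  - by rewrite !JE (itg_split (Fi h) a0 ab); ring.
  - by rewrite innerNl !JE (itg_split (Fi h) (ltW a0) b0); ring.
  - lra.
  - by rewrite !innerNl !JE (itg_split (Fi h) ab (ltW b0)); ring.
exists P; split => // t.
have Fn := loc_int_normL2 F2.
have [w cw wE] := primitive_exists Fn.
have PW a b : a <= b -> `|P b - P a| <= w b - w a.
  move=> ab; rewrite wE//; apply: norm_le_inner; first by apply: itg_ge0.
  by move=> h; rewrite PE//; exact: le_trans (ler_norm _) (itg_le_inner _ _ _ cF).
apply/cvgrPdist_le => e e0; have /cvgrPdist_le/(_ _ e0) := cw t.
apply: filterS => s ws; have [st|ts] := leP s t.
  by apply: le_trans (PW _ _ st) _; exact: le_trans (ler_norm _) ws.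
rewrite distrC; apply: le_trans (PW _ _ (ltW ts)) _.
by rewrite distrC in ws; exact: le_trans (ler_norm _) ws.
Qed.

Lemma prim_derive1 Q F t : prim Q F -> continuous F ->
  derivable Q t 1 /\ derive1 Q t = F t.
Proof.
move=> [cQ F2 QF] cF; apply: derive1_increment => e e0.
have /cvgrPdist_le/(_ _ e0) := cF t => -[r /= r0 rP].
exists (r / 2); first by rewrite divr_gt0.
move=> x y tx xy yt; apply: norm_le_inner.
  by rewrite mulr_ge0 ?(ltW e0)// subr_ge0.
move=> h; have Fi := loc_int_inner h F2.
rewrite innerBl QF// innerZl mulrC -itg_cst// -itgB//; last exact: loc_int_cst.
have -> : e * (y - x) * `|h| = itg (cst (e * `|h|)) x y by rewrite itg_cst//; ring.
apply: itg_le; [by apply: loc_intB => //; exact: loc_int_cst|exact: loc_int_cst|].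
move=> s /andP[xs sy]; rewrite -innerBl; apply: le_trans (inner_le _ _) _.
rewrite ler_wpM2r// distrC; apply: rP => /=.
have : `|t - s| <= r / 2 by rewrite ler_norml; lra.
lra.
Qed.

Lemma primD_scaled V G (psi : R -> R) h : prim V G ->
  (forall t, derivable psi t 1) -> continuous (derive1 psi : R -> R) ->
  prim (fun t => V t + psi t *: h) (fun t => G t + derive1 psi t *: h).
Proof.
move=> [cV G2 VG] dpsi cpsi; have ci : continuous (fun t => derive1 psi t *: h).
  by move=> t; apply: cvgZr_tmp; exact: cpsi.
split.
- move=> t; apply: cvgD; first exact: cV.
  apply: cvgZr_tmp; apply: differentiable_continuous; exact/derivable1_diffP.
- by apply: L2locD => //; exact: L2loc_continuous.
- move=> a b k ab; have Gi := loc_int_inner k G2.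
  have pi_ := loc_int_continuous cpsi.
  have -> : (fun t => inner (G t + derive1 psi t *: h) k) =
      (fun t => inner (G t) k + inner h k * derive1 psi t).
    by apply/funext => t; rewrite innerDl innerZl [_ * inner h k]mulrC.
  rewrite itgD//; last exact: loc_intZ.
  rewrite itgZ// itg_derive1// -VG//.
  by rewrite !innerBl !innerDl !innerZl; ring.
Qed.

End vector_primitive.

(** ** The gradient *)

Section gradient.
Context (R : realType) (H : hilbertType R) (w : H -> R).
Hypothesis wC1 : C1 w.
Implicit Types (u v h : H) (t s a b : R).

Lemma gradientE u v : inner (gradient w u) v = 'd w u v.
Proof.
have [dw _] := wC1; have cd : continuous ('d w u : H -> R).
  exact: diff_continuous.
have /linear_bounded_continuous/linear_boundedP hb := cd.
have [C Cb] : exists C : R, forall v, `|'d w u v| <= C * `|v|.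
  by have [C] := @filter_ex _ _ _ _ hb; exists C.
have : exists g, forall h, inner g h = 'd w u h.
  apply: (riesz (C := C)) => [x y|k x|x]; first exact: linearD.
    exact: linearZ.
  exact: Cb.
by move=> [g gP]; rewrite /gradient; case: xgetP => [_ -> //|/(_ g)].
Qed.

Lemma C1_continuous : continuous w.
Proof. by move=> u; apply: differentiable_continuous; case: wC1. Qed.

Lemma gradient_continuous : continuous (gradient w).
Proof.
move=> u; apply/cvgrPdist_le => e e0; have [_ cw] := wC1.
apply: filterS (cw u e e0) => v dv; apply: norm_le_inner => [|h]; first exact: ltW.
rewrite innerBl !gradientE; apply: le_trans (dv h).
by rewrite distrC ler_norm.
Qed.

Lemma line_derive u v s : is_derive s 1 (fun s : R => w (u + s *: v)) ('d w (u + s *: v) v).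
Proof.
have [dw _] := wC1; have dv : derivable w (u + s *: v) v by exact: diff_derivable.
have E : (fun k : R => k^-1 *: (w (u + (k *: 1 + s) *: v) - w (u + s *: v))) =
    (fun k => k^-1 *: (w (k *: v + (u + s *: v)) - w (u + s *: v))).
  apply/funext => k; congr (_ *: (w _ - _)).
  have -> : k *: (1 : R) = k by exact: mulr1.
  by rewrite scalerDl addrCA.
apply: DeriveDef; first by rewrite /derivable E.
by rewrite -deriveE// /derive E.
Qed.

Lemma mean_value u v : exists2 s, 0 <= s <= 1 &
  w (u + v) - w u = inner (gradient w (u + s *: v)) v.
Proof.
have [] := @MVT _ (fun s : R => w (u + s *: v)) (fun s => 'd w (u + s *: v) v) 0 1 ltr01.
- by move=> s _; exact: line_derive.
- apply: continuous_subspaceT => s; have [d _] := line_derive u v s.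
  by apply: differentiable_continuous; exact/derivable1_diffP.
- move=> s; rewrite in_itv/= => /andP[s0 s1].
  rewrite scale1r scale0r addr0 subr0 mulr1 -gradientE => dE.
  by exists s => //; rewrite !ltW.
Qed.

(** Compactness of the arc of U over [a, b] makes differentiability uniform. *)
Lemma uniform_differentiability (U : R -> H) a b e : continuous U -> 0 < e ->
  exists2 d, 0 < d & forall t v, a <= t <= b -> `|v| <= d ->
    `|w (U t + v) - w (U t) - inner (gradient w (U t)) v| <= e * `|v|.
Proof.
move=> cU e0.
have /compact_near_coveringP/(_ R 0^'+ (fun d t => forall v, `|v| <= d ->
  `|w (U t + v) - w (U t) - inner (gradient w (U t)) v| <= e * `|v|)) :
  compact `[a, b] by exact: segment_compact.
case=> [t0 _|d /= d0 dP].
  have e20 : 0 < e / 2 by rewrite divr_gt0.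
  have /cvgrPdist_le/(_ _ e20) := @gradient_continuous (U t0).
  move=> /nbhs_ballP[r /= r0 rP].
  have r20 : 0 < r / 2 by rewrite divr_gt0.
  near=> t d => v vd.
  have Ut : `|U t0 - U t| < r / 2.
    by near: t; move/cvgrPdist_lt: (cU t0); exact.
  have dr : d < r / 2 by near: d; exact: nbhs_right_lt.
  have [s /andP[s0 s1] ->] := mean_value (U t) v.
  rewrite -innerBl; apply: le_trans (abs_inner_le _ _) _; rewrite ler_wpM2r//.
  have -> : gradient w (U t + s *: v) - gradient w (U t) =
      (gradient w (U t0) - gradient w (U t)) -
      (gradient w (U t0) - gradient w (U t + s *: v)).
    by rewrite opprB [RHS]addrC addrA subrK.
  rewrite (le_trans (ler_normB _ _))// [leRHS]splitr lerD//.
    by apply: rP; rewrite -ball_normE /= (lt_trans Ut)// ltr_pdivrMr// ltr_pMr// ltr1n.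
  apply: rP; rewrite -ball_normE /= opprD addrA (le_lt_trans (ler_normB _ _))//.
  rewrite [ltRHS]splitr ltrD// normrZ ger0_norm//.
  by rewrite (le_lt_trans _ dr)// (le_trans _ vd)// ler_piMl.
exists (d / 2); first by rewrite divr_gt0.
have d2 : ball_ [eta Num.Def.normr] 0 d (d / 2).
  by rewrite /= sub0r normrN gtr0_norm ?divr_gt0// ltr_pdivrMr// ltr_pMr// ltr1n.
by move=> t v tab; apply: dP => //; rewrite divr_gt0.
Unshelve. all: by end_near. Qed.

End gradient.

(** ** The Euler-Lagrange equation *)

Section stationary.
Context (R : realType) (H : hilbertType R) (W : H -> \bar R).
Local Notation mu := (@lebesgue_measure R).
Hypothesis W_ge0 : forall u, (0 <= W u)%E.
Hypothesis W_lsc : weakly_lsc W.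
Hypothesis W_fin : forall u, W u \is a fin_num.
Let w : H -> R := fine \o W.
Hypothesis wC1 : C1 w.
Implicit Types (U D V G : R -> H) (phi : R -> R) (a b t : R) (h : H).

Let W_E u : W u = (w u)%:E.
Proof. by rewrite /w /= fineK. Qed.

Lemma loc_int_pot U : continuous U -> loc_int (fun t => w (U t)).
Proof.
move=> cU; apply: loc_int_continuous => t.
by apply: continuous_comp; [exact: cU|exact: C1_continuous wC1 _].
Qed.

(** The energies off [a, b] are equal and finite, so they cancel. *)
Lemma window_le U D V G a b : prim U D -> prim V G ->
  (forall t, ~ (a <= t <= b) -> V t = U t /\ G t = D t) ->
  (action W U < +oo)%E -> (action W U <= action W V)%E ->
  itg (fun t => 2^-1 * `|D t| ^+ 2) a b + itg (fun t => w (U t)) a b <=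
  itg (fun t => 2^-1 * `|G t| ^+ 2) a b + itg (fun t => w (V t)) a b.
Proof.
move=> UD VG out; rewrite (action_prim W_ge0 W_lsc UD) (action_prim W_ge0 W_lsc VG).
have [cU D2 _] := UD; have [cV G2 _] := VG.
pose A : set R := `[a, b]%classic.
have mA : measurable (A : set (measurableTypeR R)) by exact: measurable_itv.
have split_ (f : R -> \bar R) : measurable_fun [set: R] f -> (forall t, (0 <= f t)%E) ->
    (\int[mu]_t f t = \int[mu]_(t in A) f t + \int[mu]_(t in ~` A) f t)%E.
  move=> mf f0; rewrite -ge0_integral_setU ?setUv//; first exact: measurableC.
  by apply/disj_setPS => t [].
have kD : (kin D = (itg (fun t => 2^-1 * `|D t| ^+ 2) a b)%:E +
    \int[mu]_(t in ~` A) ((2^-1 * `|D t| ^+ 2)%:E))%E.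
  rewrite (EFin_itg _ _ (loc_intZ _ (loc_int_sqr D2))); apply: split_.
    exact: measurable_kin.
  by move=> t; rewrite lee_fin mulr_ge0 ?invr_ge0.
have kG : (kin G = (itg (fun t => 2^-1 * `|G t| ^+ 2) a b)%:E +
    \int[mu]_(t in ~` A) ((2^-1 * `|D t| ^+ 2)%:E))%E.
  rewrite (EFin_itg _ _ (loc_intZ _ (loc_int_sqr G2))) /kin split_; last 2 first.
  - exact: measurable_kin.
  - by move=> t; rewrite lee_fin mulr_ge0 ?invr_ge0.
  congr (_ + _)%E; apply: eq_integral => t; rewrite inE => tA.
  by have [_ ->] := out t (contra_not (fun e => e) tA).
have pU : (pot W U = (itg (fun t => w (U t)) a b)%:E +
    \int[mu]_(t in ~` A) W (U t))%E.
  rewrite (EFin_itg _ _ (loc_int_pot cU)) /pot split_//; last exact: measurable_pot.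
  by congr (_ + _)%E; apply: eq_integral => t _; rewrite W_E.
have pV : (pot W V = (itg (fun t => w (V t)) a b)%:E +
    \int[mu]_(t in ~` A) W (U t))%E.
  rewrite (EFin_itg _ _ (loc_int_pot cV)) /pot split_//; last exact: measurable_pot.
  congr (_ + _)%E; apply: eq_integral => t; first by rewrite W_E.
  by rewrite inE => tA; have [->] := out t tA.
rewrite kD kG pU pV.
have : (0 <= \int[mu]_(t in ~` A) ((2^-1 * `|D t| ^+ 2)%:E))%E.
  by apply: integral_ge0 => t _; rewrite lee_fin mulr_ge0 ?invr_ge0.
have : (0 <= \int[mu]_(t in ~` A) W (U t))%E by exact: integral_ge0.
move: (\int[mu]_(t in ~` A) W (U t))%E => x.
move: (\int[mu]_(t in ~` A) ((2^-1 * `|D t| ^+ 2)%:E))%E => y.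
move: (itg _ _ _) (itg _ _ _) (itg _ _ _) (itg _ _ _) => p q r s.
case: x => [x| |] //; case: y => [y| |] //.
by move=> _ _ _; rewrite -!EFinD !lee_fin; lra.
Qed.

Lemma bump_admissible em ep U D phi h : prim U D -> admissible em ep U ->
  test_function phi -> admissible em ep (fun t => U t + phi t *: h).
Proof.
move=> UD /admissibleP[_ [tm [tp [_ Um Up]]]] tphi.
have [M M0 /(_ M (lexx M))[_ _ out]] := test_window tphi.
have [dphi cphi _] := tphi.
apply/admissibleP; split; first exact: prim_H1loc (primD_scaled h UD dphi cphi).
exists (Num.min tm (- M - 1)), (Num.max tp (M + 1)); split.
- have : Num.min tm (- M - 1) <= - M - 1 by rewrite ge_min lexx orbT.
  have : M + 1 <= Num.max tp (M + 1) by rewrite le_max lexx orbT.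
  lra.
- move=> t; rewrite le_min => /andP[ttm tM]; have [|-> _] := out t; first lra.
  by rewrite scale0r addr0; exact: Um.
- move=> t; rewrite ge_max => /andP[ttp tM]; have [|-> _] := out t; first lra.
  by rewrite scale0r addr0; exact: Up.
Qed.

(** S is the derivative at s = 0 of a function with a minimum there; the error
    term is the modulus of differentiability of W along the path. *)
Lemma first_order_eq0 (S B : R) : 0 <= B ->
  (forall e, 0 < e -> exists2 d, 0 < d & forall s, `|s| <= d ->
    0 <= s * S + s ^+ 2 * B + `|s| * e) -> S = 0.
Proof.
move=> B0 SP; apply/eqP; rewrite -normr_le0; apply/ler_addgt0Pr => e e0.
have e20 : 0 < e / 2 by rewrite divr_gt0.
have [d d0 dP] := SP _ e20; rewrite add0r.
have B1 : 0 < B + 1 by rewrite ltr_wpDl.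
pose s := Num.min d (e / 2 / (B + 1)).
have s0 : 0 < s by rewrite lt_min d0 divr_gt0.
have sB : s * B <= e / 2.
  have : s <= e / 2 / (B + 1) by rewrite ge_min lexx orbT.
  by rewrite ler_pdivlMr//; lra.
have sS : `|s| * `|S| <= s ^+ 2 * B + s * (e / 2).
  have [S0|S0] := leP 0 S.
    have := dP (- s); rewrite normrN gtr0_norm// ger0_norm// => /(_ _).
    have -> : (- s) ^+ 2 = s ^+ 2 by ring.
    by move=> h; have := h (ltac:(by rewrite ge_min lexx)); lra.
  have := dP s; rewrite gtr0_norm// ltr0_norm// => h.
  by have := h (ltac:(by rewrite ge_min lexx)); lra.
rewrite gtr0_norm// in sS.
have : s * `|S| <= s * (s * B + e / 2) by lra.
rewrite ler_pM2l//; lra.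
Qed.

(** First variation in the direction phi h.  The kinetic energy is a polynomial
    of degree 2 in the size s of the variation, the potential energy is handled
    by uniform_differentiability. *)
Lemma euler_lagrange em ep U D phi h : prim U D -> admissible em ep U ->
  (action W U < +oo)%E ->
  (forall V, admissible em ep V -> (action W U <= action W V)%E) ->
  test_function phi ->
  \int[mu]_t (phi t * inner (gradient w (U t)) h) =
  - \int[mu]_t (derive1 phi t * inner (D t) h).
Proof.
move=> UD Uadm Ufin Umin tphi; have [cU D2 _] := UD.
have [M M0 /(_ M (lexx M))[_ _ out]] := test_window tphi.
have MM : - M <= M by lra.
have [dphi cphi _] := tphi; have cp := test_continuous tphi.
pose f t := inner (gradient w (U t)) h.
have cf : continuous f.
  move=> t; apply: innerl_cvg; apply: continuous_comp; first exact: cU.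
  exact: gradient_continuous wC1 _.
have ipf : loc_int (fun t => phi t * f t) by apply: loc_intM => //; exact: loc_int_continuous.
have ipd : loc_int (fun t => derive1 phi t * inner (D t) h).
  by apply: loc_intM => //; exact: loc_int_inner.
have ipp : loc_int (fun t => (derive1 phi t) ^+ 2).
  apply: loc_int_continuous => t.
  have -> : (fun t => derive1 phi t ^+ 2) = (fun t => derive1 phi t * derive1 phi t).
    by apply/funext => s; rewrite expr2.
  by apply: cvgM; exact: cphi.
rewrite !(@Rintegral_support _ _ (- M) M); last 2 first.
- by move=> t /out[_ ->]; rewrite mul0r.
- by move=> t /out[-> _]; rewrite mul0r.
set A := itg (fun t => derive1 phi t * _) _ _; set C := itg _ _ _.
pose B := 2^-1 * (`|h| ^+ 2 * itg (fun t => derive1 phi t ^+ 2) (- M) M).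
suff : A + C = 0 by lra.
have [K K0 phiK] : exists2 K, 0 <= K & forall t, - M <= t <= M -> `|phi t| <= K.
  have cphin : {within `[- M, M], continuous (fun t => `|phi t|)}.
    by apply: continuous_subspaceT => t; apply: cvg_norm; exact: cp.
  have [c _ phic] := EVT_max MM cphin.
  by exists `|phi c| => // t tM; apply: phic; rewrite in_itv.
apply: (@first_order_eq0 _ B).
  rewrite !mulr_ge0 ?invr_ge0// ?exprn_ge0//.
  by apply: itg_ge0 => t _; exact: sqr_ge0.
move=> e e0; pose L := K * `|h| * (M - - M) + 1.
have L0 : 0 < L by rewrite ltr_wpDl// !mulr_ge0// subr_ge0.
have eL : 0 < e / L by rewrite divr_gt0.
have [d d0 dP] := uniform_differentiability wC1 (- M) M cU eL.
have Kh0 : 0 <= K * `|h| by rewrite mulr_ge0.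
exists (d / (K * `|h| + 1)); first by rewrite divr_gt0// ltr_wpDl.
move=> s; rewrite ler_pdivlMr ?ltr_wpDl// => sd.
have UV := primD_scaled (s *: h) UD dphi cphi; have [cV G2 _] := UV.
have Vadm := bump_admissible (s *: h) UD Uadm tphi.
have := window_le (a := - M) (b := M) UD UV _ Ufin (Umin _ Vadm).
move=> /(_ _)/wrap[t /out[-> ->]|]; first by rewrite !scale0r !addr0.
have vh t : - M <= t <= M -> `|phi t *: (s *: h)| <= `|s| * (K * `|h|).
  move=> /phiK tK; rewrite !normrZ mulrCA ler_wpM2l//.
  by rewrite ler_wpM2r.
have iV := loc_int_pot cV; have iU := loc_int_pot cU.
have potle : itg (fun t => w (U t + phi t *: (s *: h))) (- M) M <=
    itg (fun t => w (U t)) (- M) M + s * C + `|s| * e.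
  have -> : itg (fun t => w (U t)) (- M) M + s * C =
      itg (fun t => w (U t) + s * (phi t * f t)) (- M) M.
    by rewrite itgD//; [rewrite itgZ|exact: loc_intZ].
  apply: (@le_trans _ _ (itg (fun t => w (U t) + s * (phi t * f t) +
      cst (e / L * (`|s| * (K * `|h|))) t) (- M) M)); last first.
    rewrite itgD//; [|by apply: loc_intD => //; exact: loc_intZ|exact: loc_int_cst].
    rewrite lerD2l itg_cst//.
    have -> : e / L * (`|s| * (K * `|h|)) * (M - - M) = `|s| * (e / L * (L - 1)).
      by rewrite /L; ring.
    rewrite ler_wpM2l// mulrBr mulr1 divfK ?gt_eqF//; lra.
  apply: itg_le => //.
    apply: loc_intD; last exact: loc_int_cst.
    by apply: loc_intD => //; exact: loc_intZ.
  move=> t tM; have vt := vh t tM.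
  have := dP t (phi t *: (s *: h)) tM.
  have -> : inner (gradient w (U t)) (phi t *: (s *: h)) = s * (phi t * f t).
    by rewrite !innerZr mulrCA.
  move=> /(_ (ltac:(by apply: le_trans vt _; rewrite mulrDr in sd;
    have := normr_ge0 s; lra)))/ler_normlW => h1.
  have : e / L * `|phi t *: (s *: h)| <= e / L * (`|s| * (K * `|h|)).
    by rewrite ler_pM2l.
  rewrite /=; lra.
have kinE : itg (fun t => 2^-1 * `|D t + derive1 phi t *: (s *: h)| ^+ 2) (- M) M =
    itg (fun t => 2^-1 * `|D t| ^+ 2) (- M) M + s * A + s ^+ 2 * B.
  have -> : (fun t => 2^-1 * `|D t + derive1 phi t *: (s *: h)| ^+ 2) =
      (fun t => 2^-1 * `|D t| ^+ 2 + s * (derive1 phi t * inner (D t) h) +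
        2^-1 * (s ^+ 2 * `|h| ^+ 2) * (derive1 phi t ^+ 2)).
    apply/funext => t; rewrite normD_sqr !innerZr !normrZ !exprMn !real_normK ?num_real//.
    by field.
  have iD := loc_intZ 2^-1 (loc_int_sqr D2).
  rewrite itgD; [|by apply: loc_intD => //; exact: loc_intZ|exact: loc_intZ].
  rewrite itgD//; last exact: loc_intZ.
  by rewrite !itgZ//; [rewrite /B /A; ring|exact: loc_int_sqr].
move: potle kinE; lra.
Qed.

(** P and Q are the first and second primitives of the gradient along U.  By the
    weak equation, each coordinate of U - Q is orthogonal to the second
    derivatives of test functions of class C2. *)
Lemma minimizer_affine em ep U D P Q : prim U D -> admissible em ep U ->
  (action W U < +oo)%E ->
  (forall V, admissible em ep V -> (action W U <= action W V)%E) ->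
  prim P (fun t => gradient w (U t)) -> prim Q P ->
  exists k, forall t, U t = Q t + (U 0 - Q 0) + t *: k.
Proof.
move=> UD Uadm Ufin Umin PF QP.
have [cU D2 UDE] := UD; have [cP F2 PFE] := PF; have [cQ P2 QPE] := QP.
pose Y t := U t - Q t.
have Yaff h : exists c, forall t, inner (Y t) h = inner (Y 0) h + c * t.
  apply: du_bois_reymond2.
    by move=> t; apply: innerl_cvg; apply: cvgB; [exact: cU|exact: cQ].
  move=> rho trho rho0; have [M M0 /(_ M (lexx M))[_ _ out]] := test_window trho.
  have MM : - M <= M by lra.
  have [phi tphi phiE] : exists2 phi, test_function phi & derive1 phi = rho.
    apply: (test_function_primitive (test_continuous trho) MM).
      by move=> t /out[].
    by rewrite -(@Rintegral_support _ _ (- M) M)// => t /out[].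
  have Di := loc_int_inner h D2; have Pi := loc_int_inner h P2.
  have EL := euler_lagrange h UD Uadm Ufin Umin tphi.
  have cPh : continuous (fun t => inner (P t) h).
    by move=> t; apply: innerl_cvg; exact: cP.
  have := test_by_parts tphi cPh (loc_int_inner h F2) _.
  move=> /(_ _)/wrap[x y xy|]; first by rewrite -innerBl PFE.
  rewrite EL phiE => /oppr_inj dp.
  have cY : continuous (fun t => inner (Y t) h).
    by move=> t; apply: innerl_cvg; apply: cvgB; [exact: cU|exact: cQ].
  have := test_by_parts trho cY (loc_intB Di Pi) _.
  move=> /(_ _)/wrap[x y xy|].
    by rewrite itgB// -UDE// -QPE// /Y !innerBl; ring.
  move=> /(congr1 -%R); rewrite opprK => <-; apply/eqP; rewrite oppr_eq0; apply/eqP.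
  have rsupp (g : R -> R) : \int[mu]_t (rho t * g t) = itg (fun t => rho t * g t) (- M) M.
    by apply: Rintegral_support => t /out[-> _]; rewrite mul0r.
  rewrite rsupp; have -> : (fun t => rho t * (inner (D t) h - inner (P t) h)) =
      (fun t => rho t * inner (D t) h - rho t * inner (P t) h).
    by apply/funext => t; ring.
  have cr := test_continuous trho.
  by rewrite itgB; [rewrite -!rsupp dp subrr|exact: loc_intM|exact: loc_intM].
exists (Y 1 - Y 0) => t; apply: inner_ext => h; have [c cY] := Yaff h.
have cE : c = inner (Y 1 - Y 0) h by rewrite innerBl cY; ring.
have := cY t; rewrite cE /Y !innerDl !innerZl ?innerDl !innerNl; lra.
Qed.

(** U' is P plus a constant vector, so U'' is the gradient along U. *)
Theorem minimizer_C2 em ep U D : prim U D -> admissible em ep U ->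
  (action W U < +oo)%E ->
  (forall V, admissible em ep V -> (action W U <= action W V)%E) ->
  C2 U /\ forall t, derive1n 2 U t = gradient w (U t).
Proof.
move=> UD Uadm Ufin Umin; have [cU _ _] := UD.
pose F t := gradient w (U t).
have cF : continuous F.
  move=> t; apply: continuous_comp; first exact: cU.
  exact: gradient_continuous wC1 _.
have [P PF] := vector_primitive cF; have [cP _ PFE] := PF.
have [Q QP] := vector_primitive cP; have [cQ _ QPE] := QP.
have [k Uk] := minimizer_affine UD Uadm Ufin Umin PF QP.
have cPk : continuous (fun t => P t + k).
  by move=> t; apply: cvgD; [exact: cP|exact: cvg_cst].
have UP : prim U (fun t => P t + k).
  split => // [|a b h ab]; first exact: L2loc_continuous.
  have -> : (fun t => inner (P t + k) h) = (fun t => inner (P t) h + cst (inner k h) t).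
    by apply/funext => t; rewrite innerDl.
  rewrite itgD; [|exact: loc_int_inner (L2loc_continuous cP)|exact: loc_int_cst].
  rewrite itg_cst// -QPE// (Uk a) (Uk b) !innerBl !innerDl !innerZl; ring.
have dU : derive1 U = (fun t => P t + k).
  by apply/funext => t; have [] := prim_derive1 t UP cPk.
have dUF : prim (derive1 U) F.
  rewrite dU; split => // [|a b h ab]; first exact: L2loc_continuous.
  by rewrite -PFE// !innerBl !innerDl; ring.
have d2 : derive1n 2 U = F.
  by apply/funext => t; rewrite derive1nS derive1n1; have [] := prim_derive1 t dUF cF.
split; last by move=> t; rewrite d2.
split => [t|t|]; [by have [] := prim_derive1 t UP cPk|by have [] := prim_derive1 t dUF cF|].
by rewrite d2.
Qed.

End stationary.

(** * A path of finite action for regular potentials *)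

Section finite_infimum.
Context (R : realType) (H : hilbertType R) (W : H -> \bar R) (em ep : H).
Local Notation mu := (@lebesgue_measure R).
Hypothesis W_ge0 : forall u, (0 <= W u)%E.
Hypothesis W_lsc : weakly_lsc W.
Hypothesis W_fin : forall u, W u \is a fin_num.
Hypothesis W_em : W em = 0%E.
Hypothesis W_ep : W ep = 0%E.

(** The primitive of a normalized tent supported in [0, 1]. *)
Lemma smooth_step : exists psi : R -> R,
  [/\ forall t, derivable psi t 1, continuous (derive1 psi : R -> R),
      forall t, t <= 0 -> psi t = 0, forall t, 1 <= t -> psi t = 1 &
      forall t, ~ (0 <= t <= 1) -> derive1 psi t = 0].
Proof.
pose T : R -> R := tent 2^-1 2^-1.
have h0 : (0 : R) < 2^-1 by rewrite invr_gt0.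
have cT : continuous T by exact: tent_continuous.
have c0 : continuous (cst (0 : R) : R -> R) by move=> t; exact: cvg_cst.
have close (t : R) : `|t - 2^-1| <= 2^-1 -> `|cst (0 : R) (2^-1 : R) - cst (0 : R) t| <= 1.
  by rewrite /= subrr normr0.
have ge0h : (0 : R) <= 2^-1 - 2^-1 by rewrite subrr.
have leh1 : 2^-1 + 2^-1 <= (1 : R) by lra.
have [I0 _] := tent_average c0 h0 close ge0h leh1.
rewrite -/T in I0.
pose g t := (itg T 0 1)^-1 * T t.
have cg : continuous g by move=> t; apply: cvgMl_tmp; exact: cT.
have gi := loc_int_continuous cg.
have g0 t : ~ (0 < t < 1) -> g t = 0.
  move=> t01; rewrite /g /T tent_out ?mulr0// leNgt; apply/negP.
  by rewrite ltr_norml => h; apply: t01; lra.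
have [v cv vE] := primitive_exists gi.
have out x y : x <= y -> (y <= 0) || (1 <= x) -> v y = v x.
  move=> xy h; apply/eqP; rewrite -subr_eq0 vE// (@eq_itg _ _ (cst 0))//.
  - by rewrite itg_cst// mul0r.
  - exact: loc_int_cst.
  - by move=> t txy; apply: g0; case/orP: h => h; lra.
pose psi t := v t - v 0.
have psiE x y : x <= y -> psi y - psi x = itg g x y.
  by move=> xy; rewrite -vE// /psi; ring.
have dpsi t := derive1_primitive t cg psiE.
have dE : derive1 psi = g by apply/funext => t; have [] := dpsi t.
exists psi; split.
- by move=> t; have [] := dpsi t.
- by rewrite dE.
- by move=> t t0; rewrite /psi (out t 0 t0) ?lexx ?subrr.
- move=> t t1; rewrite /psi (out 1 t t1) ?lexx ?orbT// vE//.
  by rewrite itgZ ?mulVf ?gt_eqF//; exact: loc_int_continuous.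
- by move=> t t01; rewrite dE g0// => h; apply: t01; lra.
Qed.

Lemma integral_fin_support (f : R -> R) a b : loc_int f ->
  (forall t, ~ (a <= t <= b) -> f t = 0) -> (\int[mu]_t (f t)%:E < +oo)%E.
Proof.
move=> fi f0; have -> : (\int[mu]_t (f t)%:E = (itg f a b)%:E)%E; last exact: ltry.
rewrite (EFin_itg _ _ fi) [RHS]integral_mkcond; apply: eq_integral => t _.
rewrite patchE; case: ifPn => //; rewrite notin_setE /= in_itv/= => h.
by rewrite f0.
Qed.

(** Move along the segment from em to ep during the time interval [0, 1]. *)
Lemma finite_action : em <> ep -> C1 (fine \o W) ->
  exists2 V, admissible em ep V & (action W V < +oo)%E.
Proof.
move=> neq wC1; have [psi [dpsi cpsi psi0 psi1 dpsi0]] := smooth_step.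
have cst_prim : prim (cst em : R -> H) (cst 0).
  split; [by move=> t; exact: cvg_cst|apply: L2loc_continuous => t; exact: cvg_cst|].
  move=> a b h ab; rewrite subrr inner0l; transitivity (itg (cst (0 : R)) a b).
    by rewrite itg_cst// mul0r.
  by congr (itg _ _ _); apply/funext => t; rewrite /= inner0l.
have VP := primD_scaled (ep - em) cst_prim dpsi cpsi.
have [cV G2 _] := VP.
have l0 : 0 < `|ep - em|.
  by rewrite normr_gt0 subr_eq0; apply/eqP => e; apply: neq.
have hE t : height em ep (cst em t + psi t *: (ep - em)) = psi t * `|ep - em|.
  rewrite /height /= addrC addKr innerZl innerZr inner_norm expr2.
  by rewrite [_^-1 * _]mulrA mulVf ?gt_eqF// mul1r.
exists (fun t => cst em t + psi t *: (ep - em)).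
  apply/admissibleP; split; first exact: prim_H1loc VP.
  exists 0, 1; split => // t ht; rewrite hE.
    by rewrite psi0// mul0r divr_ge0// mulr_ge0.
  by rewrite psi1// mul1r ler_pdivrMr//; lra.
rewrite (action_prim W_ge0 W_lsc VP); apply: lte_add_pinfty.
  apply: (@integral_fin_support _ 0 1); first exact: loc_intZ (loc_int_sqr G2).
  by move=> t /dpsi0 ->; rewrite scale0r addr0 normr0 expr0n mulr0.
have -> : pot W (fun t => cst em t + psi t *: (ep - em)) =
    (\int[mu]_t (fine (W (cst em t + psi t *: (ep - em))))%:E)%E.
  by apply: eq_integral => t _; rewrite fineK.
apply: (@integral_fin_support (fun t => fine (W (cst em t + psi t *: (ep - em)))) 0 1).
  exact: loc_int_pot.
move=> t t01; have [t0|t0] := leP t 0; first by rewrite psi0// scale0r addr0 /= W_em.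
have t1 : 1 <= t by apply: ltW; rewrite ltNge; apply/negP => h; apply: t01; rewrite (ltW t0).
by rewrite psi1// scale1r /= addrC subrK W_ep.
Qed.

End finite_infimum.

Theorem theorem1p1 (R : realType) (H : hilbertType R) (W : H -> \bar R)
    (em ep : H)
    (W_ge0 : forall u, (0 <= W u)%E)
    (W_lsc : weakly_lsc W)
    (em_neq_ep : em <> ep)
    (W_zeros : forall u, W u = 0%E <-> u = em \/ u = ep)
    (W_infty : (0 < limf_einf W (norm_infty H))%E) :
  let finite_inf : Prop :=
    (ereal_inf [set action W V | V in admissible em ep] < +oo)%E in
  let W_C1 : Prop := (forall u, W u \is a fin_num) /\ C1 (fine \o W) in
  (W_C1 -> finite_inf) /\
  (finite_inf ->
    exists2 U : R -> H, admissible em ep U &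
      [/\ forall V, admissible em ep V -> (action W U <= action W V)%E,
          weak_cvg U -oo em /\ weak_cvg U +oo ep,
          {ae lebesgue_measure, forall t : R,
            ((2^-1 * `|weak_deriv U t| ^+ 2)%:E = W (U t))%E} &
          W_C1 -> C2 U /\
            forall t, derive1n 2 U t = gradient (fine \o W) (U t)]).
Proof.
move=> finite_inf W_C1; split.
  move=> [W_fin wC1]; have W_em : W em = 0%E by apply/W_zeros; left.
  have W_ep : W ep = 0%E by apply/W_zeros; right.
  have [V Vadm Vfin] := finite_action W_ge0 W_lsc W_fin W_em W_ep em_neq_ep wC1.
  by apply: le_lt_trans Vfin; apply: ereal_inf_lbound; exists V.
move=> fininf.
have [U Uadm [Ufin Umin]] := minimizer_exists W_ge0 W_lsc em_neq_ep W_zeros W_infty fininf.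
have /admissibleP[UH1 [tm [tp [_ Um Up]]]] := Uadm.
have UD := weak_derivP UH1.
have U0 : (0 <= action W U)%E by rewrite (action_prim W_ge0 W_lsc UD) adde_ge0 ?kin_ge0 ?pot_ge0.
have Ufn : action W U \is a fin_num by rewrite ge0_fin_numE.
have [kC pC] : (kin (weak_deriv U) <= (fine (action W U))%:E)%E /\
    (pot W U <= (fine (action W U))%:E)%E.
  by apply: (action_le W_ge0 W_lsc UD); rewrite fineK.
exists U => //; split => //.
- split.
    exact: (weak_cvg_ninfty W_ge0 W_lsc em_neq_ep W_zeros W_infty UD kC pC Um).
  exact: (weak_cvg_pinfty W_ge0 W_lsc em_neq_ep W_zeros W_infty UD kC pC Up).
- exact: (equipartition W_ge0 W_lsc UD Uadm Ufin Umin).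
- move=> [W_fin wC1].
  exact: (minimizer_C2 W_ge0 W_lsc W_fin wC1 UD Uadm Ufin Umin).
Qed.
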